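(* Let $n=3^{k_1}+3^{k_2}+3^{k_3}$ where $k_1>k_2>k_3\geq 0$ are integers. Then the following question has a negative answer for this $n$: ''Given any field extension $E/F$ with $\operatorname{char}(F)=0$ and $[E:F]=n$, can one always find an element $0\neq\delta\in E$ such that $\operatorname{Tr}_{E/F}(\delta)=\operatorname{Tr}_{E/F}(\delta^3)=0$?'' That is, there exists a field extension $E/F$ with $\operatorname{char}(F)=0$ and $[E:F]=n$ such that no element $0\neq \delta\in E$ satisfies $\operatorname{Tr}_{E/F}(\delta)=\operatorname{Tr}_{E/F}(\delta^3)=0$.
   Context: $\operatorname{Tr}_{E/F}$ denotes the trace of the finite field extension $E/F$. *)

(* Defs.v *)
From mathcomp Require Import all_boot all_algebra all_field.
Set Implicit Arguments.
Unset Strict Implicit.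
Unset Printing Implicit Defensive.
Import GRing.Theory passmx.
Local Open Scope ring_scope.

(* [mxof] represents maps acting on row vectors, so this is the transpose of
   the usual matrix of multiplication by x, which has the same trace; by
   [fieldTraceE] the choice of basis does not matter. *)
Definition fieldTrace (F : fieldType) (E : fieldExtType F) (x : E) : F :=
  \tr (mxof (vbasis {:E}) (vbasis {:E}) (amulr x)).

Lemma fieldTraceE (F : fieldType) (E : fieldExtType F) (x : E)
    (e : (\dim {:E}).-tuple E) :
  basis_of {:E} e -> fieldTrace x = \tr (mxof e e (amulr x)).
Proof.
move=> eB; set b := vbasis {:E}; have bB : basis_of {:E} b := vbasisP {:E}.
rewrite /fieldTrace -/b -[in LHS](comp_lfun1l (amulr x)).
rewrite (mxof_comp _ _ eB) mxtrace_mulC -(mxof_comp _ _ bB).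
by rewrite comp_lfun1r.
Qed.

(* Main.v *)
Require Import Defs.
From HB Require Import structures.
From mathcomp Require Import all_boot all_order all_algebra all_field.
From mathcomp Require Import ring lra zify.
Set Implicit Arguments.
Unset Strict Implicit.
Unset Printing Implicit Defensive.
Import Order.TTheory GRing.Theory Num.Theory.
Local Open Scope ring_scope.

(* The system sum_i 3^(k_i) c_i = sum_i 3^(k_i) c_i^3 = 0 has no nonzero rational solution:
   clearing denominators, such a solution yields coprime integers with x^3 + y^3 = 9^b w^3 and
   w = y + 9^m x, where b, m > 0. Descent in the Eisenstein integers forces b = 3 j + 1, so that
   z = 9^j w satisfies x^3 + y^3 = 9 z^3. A 2-descent over Q(6^(1/3)) combined with a 2-adic
   obstruction shows that (x : y : z) is twice a rational point of this curve, and for a doubled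
   point the line w = y + 9^m x contradicts the size of the coordinates.

   Weights are then traded for degrees. Replacing f(x), over k, by f(x^3 - t), over k(t),
   multiplies the degree by 3. Consider the statement that sum_i w_i Tr(g_i) = 0 and
   sum_i w_i Tr(g_i^3) = 0, traces being taken modulo f_i, only if every f_i divides g_i.
   Comparing leading coefficients in t, one passes from weight 3 w on f to weight w on
   f(x^3 - t). Starting from f_i = x with weights 3^(k_i), one reaches weights 1 and degrees
   3^(k_i). The f_i are then coprime, f = f_1 f_2 f_3 has degree n, and k(s)[x]/(f(x) - s) is a
   field extension of k(s) of degree n, in which a solution would specialize at s = 0 to a
   solution modulo f. *)

(** * Cubic descent in the Eisenstein integers *)

(** The curve x^3 + y^3 = 9 z^3 is elliptic with the flex (1 : -1 : 0) as origin; exchanging x and y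
    is negation, and for th^3 = 36 the line x + y = th z is the tangent at a point of order 2,
    whence the 2-descent map. Its image is found without units or class groups of Q(6^(1/3)): a
    point with z nonzero and divisible by 3 is divided by 3, up to sign; any other is first moved
    along a chord through (1 : 2 : 1). This lowers the height and controls the class modulo squares,
    so only the trivial class and that of (1 : 2 : 1) occur. The latter fails 2-adically, because w
    = y + 9^m x, read modulo 8, forces 8 to divide x, y or w.

    Passing from f to f(x^3 - t) adjoins a cube root x of u + t, with u a root of f, so t counts for
    three times the degree of x. A leading degree in x that is not a multiple of 3 is visible only
    in the cubic equation and only for one f_i. This is why each f_i must separately have no
    nontrivial zero of Tr(g^3) ([cube_aniso]). *)

Lemma coprime_cube_factor (R : comNzRingType) (m n z g a b u v m' z' : R) :
  m * n = z ^+ 3 -> u * m + v * n = 1 -> g = a * m + b * z ->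
  m = m' * g -> z = z' * g ->
  (exists h, g ^+ 3 = m * h) /\ (exists h, m = g ^+ 3 * h).
Proof.
(* [g] is a gcd of m and z. As m is prime to n, g^3 and m divide each other, so m is a unit times a
   cube. Only Bezout relations enter, so the argument serves both [int] and [eis]. *)
move=> mn uv gE mE zE; split.
  exists (a ^+ 3 * m ^+ 2 + 3%:R * a ^+ 2 * b * m * z + 3%:R * a * b ^+ 2 * z ^+ 2
          + b ^+ 3 * n).
  have : b ^+ 3 * (m * n) = b ^+ 3 * z ^+ 3 by rewrite mn.
  rewrite gE => e; rewrite !mulrDr.
  have -> : m * (b ^+ 3 * n) = b ^+ 3 * (m * n) by ring.
  by rewrite e; ring.
exists (u ^+ 2 * m' ^+ 3 + (2%:R * u * m * v + v ^+ 2 * n) * z' ^+ 3).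
transitivity (m * (u * m + v * n) ^+ 2); first by rewrite uv expr1n mulr1.
transitivity (u ^+ 2 * m ^+ 3 + (2%:R * u * m * v + v ^+ 2 * n) * (m * n)); first by ring.
have m3 : m ^+ 3 = m' ^+ 3 * g ^+ 3 by rewrite -exprMn -mE.
have z3 : z ^+ 3 = z' ^+ 3 * g ^+ 3 by rewrite -exprMn -zE.
by rewrite mn m3 z3; ring.
Qed.

Lemma mulz_eq1 (m n : int) : m * n = 1 -> m = 1 \/ m = -1.
Proof. by move/(congr1 absz)/eqP; rewrite abszM muln_eq1 => /andP[/eqP]; lia. Qed.

Lemma coprimez_cube (m n z : int) :
  coprimez m n -> m * n = z ^+ 3 -> exists u, m = u ^+ 3.
Proof.
move=> /coprimezP[[u v] /= uv] mn.
have [a [b gE]] := Bezoutz m z.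
have /dvdzP[m' mE] := dvdz_gcdl m z; have /dvdzP[z' zE] := dvdz_gcdr m z.
have [[h hE] [h' h'E]] := coprime_cube_factor mn uv (esym gE) mE zE.
set g := gcdz m z in gE mE zE hE h'E *.
have [g0|gn0] := eqVneq g 0; first by exists 0; rewrite h'E g0; ring.
have : h' * h = 1.
  apply: (mulfI (x := g ^+ 3)); first by rewrite expf_neq0.
  by rewrite mulr1 mulrA -h'E.
by case/mulz_eq1=> e; [exists g | exists (- g)]; rewrite h'E e; ring.
Qed.

(* [Eis a b] is a + b omega, where omega^2 + omega + 1 = 0. *)
Record eis := Eis { eis_re : int; eis_om : int }.

Definition eis_pair (x : eis) := (eis_re x, eis_om x).
Definition pair_eis (p : int * int) := Eis p.1 p.2.
Lemma eis_pairK : cancel eis_pair pair_eis. Proof. by case. Qed.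
HB.instance Definition _ := Choice.copy eis (can_type eis_pairK).

Definition eis_add x y := Eis (eis_re x + eis_re y) (eis_om x + eis_om y).
Definition eis_opp x := Eis (- eis_re x) (- eis_om x).
Definition eis_mul x y :=
  Eis (eis_re x * eis_re y - eis_om x * eis_om y)
      (eis_re x * eis_om y + eis_om x * eis_re y - eis_om x * eis_om y).

Fact eis_addA : associative eis_add.
Proof. by case=> ? ? [? ?] [? ?]; congr Eis => /=; ring. Qed.
Fact eis_addC : commutative eis_add.
Proof. by case=> ? ? [? ?]; congr Eis => /=; ring. Qed.
Fact eis_add0 : left_id (Eis 0 0) eis_add.
Proof. by case=> ? ?; congr Eis => /=; ring. Qed.
Fact eis_addN : left_inverse (Eis 0 0) eis_opp eis_add.
Proof. by case=> ? ?; congr Eis => /=; ring. Qed.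
HB.instance Definition _ :=
  GRing.isZmodule.Build eis eis_addA eis_addC eis_add0 eis_addN.

Fact eis_mulA : associative eis_mul.
Proof. by case=> ? ? [? ?] [? ?]; congr Eis => /=; ring. Qed.
Fact eis_mulC : commutative eis_mul.
Proof. by case=> ? ? [? ?]; congr Eis => /=; ring. Qed.
Fact eis_mul1 : left_id (Eis 1 0) eis_mul.
Proof. by case=> ? ?; congr Eis => /=; ring. Qed.
Fact eis_mulDl : left_distributive eis_mul +%R.
Proof. by case=> ? ? [? ?] [? ?]; congr Eis => /=; ring. Qed.
Fact eis_1neq0 : Eis 1 0 != 0.
Proof. by []. Qed.
HB.instance Definition _ := GRing.Zmodule_isComNzRing.Build eis
  eis_mulA eis_mulC eis_mul1 eis_mulDl eis_1neq0.

Definition eis_conj x := Eis (eis_re x - eis_om x) (- eis_om x).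
Definition eis_norm (x : eis) : int :=
  eis_re x ^+ 2 - eis_re x * eis_om x + eis_om x ^+ 2.

Lemma eisM a b c d : Eis a b * Eis c d = Eis (a * c - b * d) (a * d + b * c - b * d).
Proof. by []. Qed.

Lemma eis_normM x y : eis_norm (x * y) = eis_norm x * eis_norm y.
Proof. by case: x y => ? ? [? ?]; rewrite eisM /eis_norm /=; ring. Qed.

Lemma mul_eis_conj x : x * eis_conj x = Eis (eis_norm x) 0.
Proof. by case: x => ? ?; congr Eis; rewrite /= /eis_norm /=; ring. Qed.

Lemma eis_norm_ge0 x : 0 <= eis_norm x.
Proof. by case: x => a b; rewrite /eis_norm /=; nia. Qed.

Lemma eis_norm_eq0 x : eis_norm x = 0 -> x = 0.
Proof.
case: x => a b; rewrite /eis_norm /= => e.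
have -> : a = 0 by nia.
by have -> : b = 0 by nia.
Qed.

Lemma round_div (a n : int) : 0 < n -> exists q, `|2 * (a - q * n)| <= n.
Proof. by move=> n0; exists ((2 * a + n) %/ (2 * n))%Z; lia. Qed.

(** Both coordinates of the quotient are rounded to within 1/2, which leaves an error of norm at
    most 3/4. *)
Lemma eis_div (x y : eis) : y != 0 ->
  exists q, 0 <= eis_norm (x - q * y) < eis_norm y.
Proof.
move=> y0; have Ny : 0 < eis_norm y.
  by rewrite lt0r eis_norm_ge0 andbT; apply: contra_neq y0; apply: eis_norm_eq0.
have [q0 Hq0] := round_div (eis_re (x * eis_conj y)) Ny.
have [q1 Hq1] := round_div (eis_om (x * eis_conj y)) Ny.
exists (Eis q0 q1); rewrite eis_norm_ge0 /=.
have e : (x - Eis q0 q1 * y) * eis_conj y =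
   Eis (eis_re (x * eis_conj y) - q0 * eis_norm y) (eis_om (x * eis_conj y) - q1 * eis_norm y).
  rewrite mulrBl -mulrA mul_eis_conj; case: (x * eis_conj y) => a b.
  by congr Eis => /=; ring.
have Nconj : eis_norm (eis_conj y) = eis_norm y.
  by case: (y) => ? ?; rewrite /eis_norm /=; ring.
have := congr1 eis_norm e; rewrite eis_normM Nconj [RHS]/eis_norm /=.
move: Hq0 Hq1 Ny (eis_norm_ge0 (x - Eis q0 q1 * y)).
set r := eis_norm (x - _); set n := eis_norm y.
set s := _ - q0 * _; set t := _ - q1 * _.
move: r n s t => r n s t Hs Ht n0 r0 h.
have Hst : 4 * (s ^+ 2 - s * t + t ^+ 2) <= 3 * n ^+ 2 by nia.
by nia.
Qed.

Lemma eis_bezout (x y : eis) :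
  exists g a b x' y', [/\ g = a * x + b * y, x = x' * g & y = y' * g].
Proof.
have [n] := ubnP `|eis_norm y|%N; elim: n => // n IH in x y *.
move=> lt; have [->|y0] := eqVneq y 0.
  by exists x, 1, 0, 1, 0; split; ring.
have [q /andP[r0 rlt]] := eis_div x y0.
have [|g [a [b [y' [r' [gE yE rE]]]]]] := IH y (x - q * y); first by lia.
exists g, b, (a - b * q), (r' + q * y'), y'; split=> //; first by rewrite gE; ring.
by rewrite mulrDl -rE -mulrA -yE; ring.
Qed.

(** [Eis (-1) (-1)] is omega^2. The sign is described by e^3 = e because this lets it be absorbed
    into a cube. *)
Lemma eis_units x : eis_norm x = 1 ->
  exists e, [/\ e ^+ 3 = e & x \in [:: e; e * Eis 0 1; e * Eis (-1) (-1)]].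
Proof.
case: x => a b; rewrite /eis_norm /= => e.
have Ha : -1 <= a <= 1 by nia.
have Hb : -1 <= b <= 1 by nia.
have Ca : a \in [:: -1; 0; 1] by rewrite !inE; lia.
have Cb : b \in [:: -1; 0; 1] by rewrite !inE; lia.
move: Ca Cb e; rewrite !inE => /or3P[]/eqP-> /or3P[]/eqP-> // _;
  by [exists 1 | exists (-1)].
Qed.

(** Coprimality of a and b puts sqrt(-3) in the ideal generated by z = a + b omega and its
    conjugate. Their product B^3 is prime to 3, so the two are coprime and z is a unit times a
    cube. *)
Lemma eis_cube (a b B : int) :
    coprimez a b -> a ^+ 2 - a * b + b ^+ 2 = B ^+ 3 -> ~~ (3 %| B)%Z ->
  exists g, Eis a b \in [:: g ^+ 3; Eis 0 1 * g ^+ 3; Eis (-1) (-1) * g ^+ 3].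
Proof.
move=> /coprimezP[[s t] /= st] NB B3.
have zz : Eis a b * eis_conj (Eis a b) = Eis B 0 ^+ 3.
  by rewrite mul_eis_conj /eis_norm /= NB; congr Eis => /=; ring.
have : coprimez 3 (B ^+ 3).
  by rewrite coprimezXr // coprimezE /= prime_coprime // -dvdzE.
move=> /coprimezP[[al be] /= ab].
set z := Eis a b in zz *; set z' := eis_conj z in zz *.
(* [l] is a square root of -3; so 3 al + B^3 be = 1 becomes a Bezout relation between z and its
   conjugate. *)
pose l := Eis 1 2.
have lE : l = (Eis t 0 - Eis s 0 * Eis (-1) (-1)) * z + (Eis s 0 * Eis 0 1 - Eis t 0) * z'.
  rewrite /z' /z /l; transitivity (Eis (s * a + t * b) 0 * Eis 1 2); first by rewrite st.
  by congr Eis => /=; ring.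
move: lE; set U := _ - _ * Eis (-1) _; set V := _ * Eis 0 1 - _ => lE.
have uv : (Eis be 0 * z' - Eis al 0 * l * U) * z + (- (Eis al 0 * l * V)) * z' = 1.
  transitivity (Eis be 0 * (z * z') - Eis al 0 * l * (U * z + V * z')); first by ring.
  by rewrite -lE zz -[RHS]/(Eis 1 0) -ab; congr Eis => /=; ring.
have [g [p [q [z1 [B1 [gE zE BE]]]]]] := eis_bezout z (Eis B 0).
have [[h hE] [h' h'E]] := coprime_cube_factor zz uv gE zE BE.
have Nh : eis_norm h' = 1.
  have N0 : eis_norm z != 0.
    apply: contra_neq B3 => /eis_norm_eq0 [a0 b0].
    by move: st; rewrite a0 b0 !mulr0.
  have : eis_norm h' * eis_norm h = 1.
    apply: (mulfI N0); rewrite mulrA mulr1 [in RHS]h'E hE !eis_normM; ring.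
  by have := eis_norm_ge0 h'; move=> h'0 /mulz_eq1; lia.
have [e [e3]] := eis_units Nh; rewrite !inE => /or3P[]/eqP eh;
  exists (e * g); rewrite !inE h'E eh exprMn e3; apply/or3P.
- by constructor 1; rewrite mulrC.
- by constructor 2; apply/eqP; ring.
- by constructor 3; apply/eqP; ring.
Qed.

Lemma dvd3E (x : int) : (3 %| x)%Z \/ exists t, x = 3 * t + 1 \/ x = 3 * t - 1.
Proof.
case: (boolP (3 %| x)%Z) => h; [by left | right].
have [e|e] : (x %% 3)%Z = 1 \/ (x %% 3)%Z = 2 by lia.
  by exists (x %/ 3)%Z; left; lia.
by exists ((x %/ 3)%Z + 1); right; lia.
Qed.

Lemma dvd3M (x y : int) : (3 %| x * y)%Z = (3 %| x)%Z || (3 %| y)%Z.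
Proof. by rewrite !dvdzE abszM Euclid_dvdM. Qed.

Lemma dvd3X (x : int) n : (3 %| x ^+ n.+1)%Z = (3 %| x)%Z.
Proof. by rewrite !dvdzE abszX Euclid_dvdX // andbT. Qed.

Lemma coprimez3 (x : int) : coprimez x 3 = ~~ (3 %| x)%Z.
Proof. by rewrite coprimezE coprime_sym prime_coprime // dvdzE. Qed.

Lemma cube_mod9 (x : int) : ~~ (3 %| x)%Z ->
  exists t, x ^+ 3 = 9 * t + 1 \/ x ^+ 3 = 9 * t - 1.
Proof.
case: (dvd3E x) => [->//|[t [-> | ->]] _].
  by exists (3 * t ^+ 3 + 3 * t ^+ 2 + t); left; ring.
by exists (3 * t ^+ 3 - 3 * t ^+ 2 + t); right; ring.
Qed.

Lemma coprimez_span (a b u v p q r s : int) :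
  a = p * u + q * v -> b = r * u + s * v -> coprimez a b -> coprimez u v.
Proof.
move=> aE bE /coprimezP[[i j] /= ij]; apply/coprimezP.
by exists (i * p + j * r, i * q + j * s) => /=; rewrite -ij aE bE; ring.
Qed.

Lemma cubez_inj (x y : int) : x ^+ 3 = y ^+ 3 -> x = y.
Proof.
move=> e; have /eqP : (x - y) * (x ^+ 2 + x * y + y ^+ 2) = 0.
  by transitivity (x ^+ 3 - y ^+ 3); [ring | rewrite e subrr].
rewrite mulf_eq0 => /orP[|] /eqP h; first by lia.
by have y0 : y = 0; [nia | subst y; nia].
Qed.

(** With x + y = 3 S the other factor of x^3 + y^3 is 3 (3 S^2 - x y), and 3 S^2 - x y is prime to
    both 3 and S, hence a cube. *)
Lemma sum_cubes_norm (x y z : int) k :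
    (0 < k)%N -> coprimez x y -> x ^+ 3 + y ^+ 3 = 3 ^+ k * z ^+ 3 ->
  exists S B : int, [/\ x + y = 3 * S, x ^+ 2 - x * y + y ^+ 2 = 3 * B ^+ 3,
    ~~ (3 %| B)%Z & coprimez B S].
Proof.
move=> k0 cxy e; have [S xyS] : exists S : int, x + y = 3 * S.
  exists ((x + y) %/ 3)%Z.
  suff : (3 %| x + y)%Z by lia.
  rewrite -(dvd3X _ 2) (_ : _ ^+ 3 = x ^+ 3 + y ^+ 3 + 3 * (x * y * (x + y))); last by ring.
  by rewrite e -(prednK k0) exprS -mulrA -mulrDr dvdz_mulr.
have yE : y = 3 * S - x by lia.
pose N := 3 * S ^+ 2 - x * y.
have x3 : ~~ (3 %| x)%Z.
  apply/negP => h; have h' : (3 %| y)%Z by lia.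
  have : (3 %| gcdz x y)%Z by rewrite dvdz_gcd h h'.
  by rewrite (eqP cxy).
have N3 : ~~ (3 %| N)%Z.
  have -> : N = 3 * (S ^+ 2 - x * S) + x ^+ 2 by rewrite /N yE; ring.
  by move: x3; rewrite -(dvd3X _ 1); lia.
have cNS : coprimez N S.
  have : coprimez (x * y) (x + y).
    rewrite coprimezMl; apply/andP; split.
      by apply: (coprimez_span (p := 1) (q := 0) (r := -1) (s := 1)) cxy; ring.
    by apply: (coprimez_span (p := -1) (q := 1) (r := 1) (s := 0)) cxy; ring.
  by apply: (coprimez_span (p := -1) (q := 3 * S) (r := 0) (s := 3)); rewrite /N ?xyS; ring.
have [B NB] : exists B, N = B ^+ 3.
  (* From 9 S N = 3^k z^3; the extra 3^(2 k) completes the right-hand side to the cube of 3^k z. *)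
  apply: (@coprimez_cube N (9 * S * 3 ^+ (k * 2)) (3 ^+ k * z)).
    have c3 : coprimez N 3 by rewrite coprimez3.
    by rewrite !coprimezMr cNS (_ : (9 : int) = 3 ^+ 2) // !(coprimezXr _ c3).
  rewrite [RHS]exprMn -exprM (_ : (k * 3 = k + k * 2)%N); last by lia.
  rewrite exprD; transitivity (9 * S * N * 3 ^+ (k * 2)); first by ring.
  rewrite (_ : 9 * S * N = 3 ^+ k * z ^+ 3); first by ring.
  by rewrite -e /N yE; ring.
exists S, B; split=> //; first by rewrite -NB /N yE; ring.
  by rewrite -(dvd3X _ 2) -NB.
by rewrite -(coprimez_pexpl (k := 3)) // -NB.
Qed.

(** (x - S) + S omega is (x + y omega) / (1 - omega), of norm B^3, hence a power of omega times (u +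
    v omega)^3. As 3 divides S but not x - S, the powers omega and omega^2 are excluded modulo 3. *)
Lemma eis_descent (x y S B : int) :
    coprimez x y -> x + y = 3 * S -> (3 %| S)%Z ->
    x ^+ 2 - x * y + y ^+ 2 = 3 * B ^+ 3 -> ~~ (3 %| B)%Z ->
  exists u v : int, [/\ coprimez u v, S = 3 * (u * v * (u - v)) & B = u ^+ 2 - u * v + v ^+ 2].
Proof.
move=> cxy xyS S3 NB B3; have yE : y = 3 * S - x by lia.
have caS : coprimez (x - S) S.
  by apply: (coprimez_span (p := 1) (q := 1) (r := -1) (s := 2)) cxy; rewrite ?yE; ring.
have NB' : (x - S) ^+ 2 - (x - S) * S + S ^+ 2 = B ^+ 3.
  suff : 3 * ((x - S) ^+ 2 - (x - S) * S + S ^+ 2) = 3 * B ^+ 3 by lia.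
  by rewrite -NB yE; ring.
have cubeE u v : Eis u v ^+ 3
    = Eis (u ^+ 3 + v ^+ 3 - 3 * u * v ^+ 2) (3 * (u * v * (u - v))).
  by rewrite !exprS expr0 mulr1 !eisM; congr Eis; ring.
have [[u v]] := eis_cube caS NB' B3.
have absurd : (3 %| x - S)%Z -> False.
  move=> h; have : (3 %| gcdz (x - S) S)%Z by rewrite dvdz_gcd h S3.
  by rewrite (eqP caS).
rewrite !inE cubeE !eisM => /or3P[]/eqP[aE SE].
- exists u, v; split=> //; last first.
    by apply: cubez_inj; rewrite -NB' aE SE; ring.
  apply: (coprimez_span (p := u ^+ 2) (q := v ^+ 2 - 3 * u * v)
     (r := 3 * v * (u - v)) (s := 0)) caS; rewrite ?aE ?SE; ring.
- case: absurd; rewrite aE (_ : _ - _ = 3 * - (u * v * (u - v))) ?dvdz_mulr //; ring.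
- have h : (3 %| u ^+ 3 + v ^+ 3 - 3 * u * v ^+ 2)%Z.
    have SE' : S = - (u ^+ 3 + v ^+ 3 - 3 * u * v ^+ 2) by rewrite SE; ring.
    by move: S3; rewrite SE' rpredN.
  case: absurd; rewrite aE.
  rewrite (_ : _ - _ = 3 * (u * v * (u - v)) - (u ^+ 3 + v ^+ 3 - 3 * u * v ^+ 2)); last by ring.
  by rewrite rpredB // dvdz_mulr.
Qed.

Lemma three_cubes_aux l (e1 e2 e3 A : int) :
    e1 + e2 + e3 = 0 -> coprimez e1 e2 -> e1 * e2 * e3 = 3 ^+ l * A ^+ 3 ->
    ~~ (3 %| e1)%Z -> ~~ (3 %| e2)%Z ->
  exists p q r : int, [/\ e1 = p ^+ 3, e2 = q ^+ 3 & e3 = - (3 ^+ l * r ^+ 3)].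
Proof.
move=> e0 c12 eA n1 n2.
have c13 : coprimez e1 e3.
  by apply: (coprimez_span (p := 1) (q := 0) (r := -1) (s := -1)) c12; lia.
have c23 : coprimez e2 e3.
  by apply: (coprimez_span (p := -1) (q := -1) (r := 1) (s := 0)) c12; lia.
have c31 : coprimez 3 e1 by rewrite coprimez_sym coprimez3.
have c32 : coprimez 3 e2 by rewrite coprimez_sym coprimez3.
have /dvdzP[e' e3E] : (3 ^+ l %| e3)%Z.
  rewrite -(@Gauss_dvdzr _ (e1 * e2)); last by rewrite coprimezXl // coprimezMr c31.
  by rewrite eA dvdz_mulr.
have l0 : (3 ^+ l : int) != 0 by rewrite expf_neq0.
have eA' : e1 * e2 * e' = A ^+ 3.
  by apply: (mulfI l0); rewrite -eA e3E; ring.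
move: c13 c23; rewrite e3E !coprimezMr => /andP[c1 _] /andP[c2 _].
have [p pE] : exists p, e1 = p ^+ 3.
  by apply: (@coprimez_cube _ (e2 * e') A); rewrite ?coprimezMr ?c12 // mulrA.
have [q qE] : exists q, e2 = q ^+ 3.
  apply: (@coprimez_cube _ (e1 * e') A); last by rewrite -eA'; ring.
  by rewrite coprimezMr coprimez_sym c12.
have [r rE] : exists r, e' = r ^+ 3.
  apply: (@coprimez_cube _ (e1 * e2) A); last by rewrite -eA'; ring.
  by rewrite coprimezMr ![coprimez e' _]coprimez_sym c1.
by exists p, q, (- r); split=> //; rewrite rE; ring.
Qed.

(** u, -v and v - u are pairwise coprime with sum 0. The one divisible by 3, or v - u if there is
    none, is put last; the other two are then cubes, and the vanishing sum is an equation of the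
    initial shape. *)
Lemma three_cubes l (u v A : int) :
    coprimez u v -> u * v * (u - v) = 3 ^+ l * A ^+ 3 ->
  exists p q r : int, [/\ coprimez p q, p ^+ 3 + q ^+ 3 = 3 ^+ l * r ^+ 3,
    u ^+ 2 - u * v + v ^+ 2 = p ^+ 6 + p ^+ 3 * q ^+ 3 + q ^+ 6
    & u * v * (u - v) = - (3 ^+ l * (p * q * r) ^+ 3)].
Proof.
move=> cuv uvA; set goal := exists p, _.
suff H e1 e2 e3 : e1 + e2 + e3 = 0 -> coprimez e1 e2 ->
    e1 * e2 * e3 = u * v * (u - v) -> e1 ^+ 2 + e1 * e2 + e2 ^+ 2 = u ^+ 2 - u * v + v ^+ 2 ->
    ~~ (3 %| e1)%Z -> ~~ (3 %| e2)%Z -> goal.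
- have [n1|n1] := boolP (3 %| u)%Z.
    have n2 : ~~ (3 %| v)%Z.
      apply/negP => n2; have : (3 %| gcdz u v)%Z by rewrite dvdz_gcd n1 n2.
      by rewrite (eqP cuv).
    apply: (H (- v) (v - u) u); [ring | | ring | ring | lia | lia].
    by apply: (coprimez_span (p := -1) (q := -1) (r := -1) (s := 0)) cuv; ring.
  have [n2|n2] := boolP (3 %| v)%Z.
    apply: (H u (v - u) (- v)); [ring | | ring | ring | lia | lia].
    by apply: (coprimez_span (p := 1) (q := 0) (r := 1) (s := 1)) cuv; ring.
  apply: (H u (- v) (v - u)); [ring | | ring | ring | lia | lia].
  by rewrite coprimezN.
move=> e0 c12 eP eN n1 n2.
have [p [q [r [pE qE rE]]]] := three_cubes_aux e0 c12 (etrans eP uvA) n1 n2.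
exists p, q, r; split.
- by rewrite -(coprimez_pexpl (k := 3)) // -(coprimez_pexpr (k := 3)) // -pE -qE.
- rewrite -pE -qE; move: e0 rE; move: (3 ^+ l * r ^+ 3) => a; clear; lia.
- by rewrite -eN pE qE; ring.
- by rewrite -eP pE qE rE; ring.
Qed.

(** A round of [eis_descent] and [three_cubes] lowers k by 3 and keeps the unknowns prime to 3.
    Cubes prime to 3 are 1 or -1 modulo 9, which excludes k = 0 and k = 1. *)
Lemma sum_cubes_pow3 k (x y z : int) :
    coprimez x y -> ~~ (3 %| x)%Z -> ~~ (3 %| y)%Z -> ~~ (3 %| z)%Z ->
    x ^+ 3 + y ^+ 3 = 3 ^+ k * z ^+ 3 ->
  (k %% 3 = 2)%N.
Proof.
have [n] := ubnP k; elim: n => // n IH in k x y z *.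
move=> kn cxy x3 y3 z3 e.
have [t1 xE] := cube_mod9 x3; have [t2 yE] := cube_mod9 y3; have [t3 zE] := cube_mod9 z3.
case: k => [|[|[|k]]] // in kn e *; first by lia.
  by move: e; rewrite expr1; lia.
have k0 : (0 < k.+3)%N by [].
have [S [B [xyS NB B3 cBS]]] := sum_cubes_norm k0 cxy e.
have SB : S * B ^+ 3 = 3 ^+ k.+1 * z ^+ 3.
  apply: (mulfI (x := 9)) => //.
  transitivity ((x + y) * (x ^+ 2 - x * y + y ^+ 2)); first by rewrite xyS NB; ring.
  transitivity (x ^+ 3 + y ^+ 3); first by ring.
  have -> : 9 * (3 ^+ k.+1 * z ^+ 3) = 3 ^+ k.+3 * z ^+ 3 by rewrite !exprS; ring.
  exact: e.
have S3 : (3 %| S)%Z.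
  have : (3 %| S * B ^+ 3)%Z by rewrite SB exprS -mulrA dvdz_mulr.
  by rewrite dvd3M dvd3X (negPf B3) orbF.
have [u [v [cuv SE BE]]] := eis_descent cxy xyS S3 NB B3.
have /dvdzP[A zA] : (B %| z)%Z.
  rewrite -(dvdz_pexp2r _ _ (k := 3)) // -(@Gauss_dvdzr _ (3 ^+ k.+1)).
    by rewrite -SB dvdz_mull.
  by rewrite coprimezXl // coprimezXr // coprimez3.
have B0 : B != 0 by apply: contraNneq B3 => ->.
have uvA : u * v * (u - v) = 3 ^+ k * A ^+ 3.
  apply: (mulfI (x := 3 * B ^+ 3)); first by rewrite mulf_neq0 ?expf_neq0.
  transitivity (S * B ^+ 3); first by rewrite SE; ring.
  by rewrite SB zA exprS; ring.
have [p [q [r [cpq pqr _ uvr]]]] := three_cubes cuv uvA.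
have AE : A = - (p * q * r).
  apply: cubez_inj; apply: (mulfI (x := 3 ^+ k)); first by rewrite expf_neq0.
  by rewrite -uvA uvr; ring.
have : ~~ (3 %| A)%Z by apply: contra z3 => h; rewrite zA dvdz_mulr.
rewrite AE (_ : - _ = p * q * (- r)) ?dvd3M ?negb_or; last by ring.
move=> /andP[/andP[p3 q3] r3].
have r3' : ~~ (3 %| r)%Z by move: r3; rewrite rpredN.
have kn' : (k < n)%N by move: kn; clear; lia.
by rewrite -addn3 modnDr (IH k p q r).
Qed.

(** * Two-descent on x^3 + y^3 = 9 z^3 *)

Definition is_square (L : nzRingType) (a : L) := exists t, a = t ^+ 2.

(* For [L = Q(th)] with [th ^+ 3 = 36], its class modulo squares is the 2-descent map of the
   curve [x^3 + y^3 = 9 z^3], whose 2-division field contains the cube roots of 6. *)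
Definition tangent_form (L : nzRingType) (th x y z : L) : L :=
  - 3 * th * (x + y) * (x + y - th * z).

(** (X : Y : Z) is the third point of the curve on the chord through (x : y : z) and (1 : 2 : 1),
    and the form takes the value 9 th (th - 3) at the latter: the classes of three collinear points
    multiply to a square. The root found has denominator x + y - 3 z. *)
Lemma tangent_form_third (L : fieldType) (al x y z : L) :
    let th := al ^+ 2 in
    let X := 2 * x ^+ 2 - y * z in let Y := y ^+ 2 - 4 * x * z in
    let Z := 2 * z ^+ 2 - x * y in
    al ^+ 3 = 6 -> x ^+ 3 + y ^+ 3 = 9 * z ^+ 3 -> x + y - 3 * z != 0 ->
  is_square (tangent_form th x y z * tangent_form th X Y Z * (th * (th - 3))).
Proof.
move=> th X Y Z al3 xyz nz.
have th3 : th ^+ 3 = 36 by rewrite /th -exprM (exprM al 3 2) al3; ring.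
have e : th ^+ 2 * (x + y - th * z) * (X + Y - th * Z) * (th - 3) * (x + y - 3 * z) ^+ 2
   = 9 * (x + y) * (X + Y) * (th * (y - x - z) + 2 * (2 * x - y)) ^+ 2.
  rewrite /X /Y /Z; have y3 : x ^+ 3 = 9 * z ^+ 3 - y ^+ 3 by rewrite -xyz; ring.
  ring: th3 y3.
exists (9 * al * (x + y) * (X + Y) * (th * (y - x - z) + 2 * (2 * x - y)) / (x + y - 3 * z)).
apply: (mulIf (x := (x + y - 3 * z) ^+ 2)); first by rewrite expf_neq0.
rewrite exprMn exprVn mulrVK ?unitfE ?expf_neq0 //.
transitivity (9 * th * (x + y) * (X + Y) * (th ^+ 2 * (x + y - th * z) * (X + Y - th * Z) * (th - 3) * (x + y - 3 * z) ^+ 2)).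
  by rewrite /tangent_form; ring.
by rewrite e /th; ring.
Qed.

(** The factor th (th B - 27 (p q r)^2) is, up to a square, the tangent form at plus or minus three
    times (p : q : r); an odd multiple keeps the class modulo squares. *)
Lemma tangent_form_triple (L : fieldType) (th p q r : L) :
    let B := p ^+ 6 + p ^+ 3 * q ^+ 3 + q ^+ 6 in
    th ^+ 3 = 36 -> p ^+ 3 + q ^+ 3 = 9 * r ^+ 3 ->
  is_square (th * (th * B - 27 * (p * q * r) ^+ 2) * tangent_form th p q r).
Proof.
move=> B th3 pqr.
have p3 : p ^+ 3 = 9 * r ^+ 3 - q ^+ 3 by rewrite -pqr; ring.
exists (- 54 * th * r ^+ 4 + 3 * th ^+ 2 * q ^+ 2 * r ^+ 2 - 6 * q ^+ 4 - 54 * p * r ^+ 3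
   + 3 * th ^+ 2 * p * q * r ^+ 2 - 3 * th * p * q ^+ 2 * r + 6 * p * q ^+ 3
   + 3 * th ^+ 2 * p ^+ 2 * r ^+ 2 - 3 * th * p ^+ 2 * q * r + 12 * p ^+ 2 * q ^+ 2).
rewrite /tangent_form /B (_ : p ^+ 6 = (p ^+ 3) ^+ 2); last by ring.
by rewrite p3; ring: th3 p3.
Qed.

Lemma param9 (x y z : int) :
    coprimez x y -> x ^+ 3 + y ^+ 3 = 9 * z ^+ 3 ->
  exists B C : int, [/\ x + y = 3 * C ^+ 3, x ^+ 2 - x * y + y ^+ 2 = 3 * B ^+ 3,
    z = C * B, ~~ (3 %| B)%Z & coprimez B C].
Proof.
move=> cxy e; have e2 : x ^+ 3 + y ^+ 3 = 3 ^+ 2 * z ^+ 3 by rewrite e.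
have [S [B [xyS NB B3 cBS]]] := sum_cubes_norm (isT : (0 < 2)%N) cxy e2.
have SB : S * B ^+ 3 = z ^+ 3.
  apply: (mulfI (x := 9)) => //; rewrite -e.
  transitivity ((x + y) * (x ^+ 2 - x * y + y ^+ 2)); last by ring.
  by rewrite xyS NB; ring.
have [C SE] : exists C, S = C ^+ 3.
  by apply: coprimez_cube SB; rewrite coprimez_sym coprimezXl.
exists B, C; split; rewrite -?SE //.
  by apply: cubez_inj; rewrite exprMn -SE SB.
by rewrite -(coprimez_pexpr (k := 3)) // -SE.
Qed.

(** In s = (p + q)^2 and t = (p - q)^2, the difference times 64 has nonnegative coefficients. It
    vanishes for p = -q, so 27 is sharp. *)
Lemma norm_triple_bound (p q : int) :
  (p ^+ 2 - p * q + q ^+ 2) ^+ 3 <= 27 * (p ^+ 6 + p ^+ 3 * q ^+ 3 + q ^+ 6).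
Proof.
pose s := (p + q) ^+ 2; pose t := (p - q) ^+ 2.
have s0 : 0 <= s by apply: sqr_ge0.
have t0 : 0 <= t by apply: sqr_ge0.
suff : 0 <= 64 * (27 * (p ^+ 6 + p ^+ 3 * q ^+ 3 + q ^+ 6) - (p ^+ 2 - p * q + q ^+ 2) ^+ 3).
  by rewrite pmulr_rge0 // subr_ge0.
rewrite (_ : 64 * _ = 80 * (s ^+ 3) + 720 * (s ^+ 2 * t) + 864 * (s * t ^+ 2)).
  move: (exprn_ge0 3 s0) (mulr_ge0 (exprn_ge0 2 s0) t0) (mulr_ge0 s0 (exprn_ge0 2 t0)).
  by move: (s ^+ 3) (s ^+ 2 * t) (s * t ^+ 2) => a b c; clear; lia.
by rewrite /s /t; ring.
Qed.

Lemma eis_form_ge (x y : int) :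
  [/\ 0 <= x ^+ 2 - x * y + y ^+ 2, (x + y) ^+ 2 <= 4 * (x ^+ 2 - x * y + y ^+ 2)
    & x ^+ 2 + y ^+ 2 <= 2 * (x ^+ 2 - x * y + y ^+ 2)].
Proof.
have E : (x - y) ^+ 2 = x ^+ 2 - 2 * (x * y) + y ^+ 2 by ring.
have E' : (x + y) ^+ 2 = x ^+ 2 + 2 * (x * y) + y ^+ 2 by ring.
move: (sqr_ge0 x) (sqr_ge0 y) (sqr_ge0 (x - y)); rewrite E E'.
by move: (x ^+ 2) (y ^+ 2) (x * y) => a b c; clear; split; lia.
Qed.

Lemma normM_le (x y : int) : 2 * `|x * y| <= x ^+ 2 + y ^+ 2.
Proof.
have E : (`|x| - `|y|) ^+ 2 = x ^+ 2 - 2 * `|x * y| + y ^+ 2.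
  by rewrite normrM -(real_normK (num_real x)) -(real_normK (num_real y)); ring.
by move: (sqr_ge0 (`|x| - `|y|)); rewrite E; move: (x ^+ 2) (y ^+ 2) => a b; clear; lia.
Qed.

(** (x + y)^2 <= 4 N reads 9 C^6 <= 12 B^3, so C^2 <= 3 B and (C B)^2 <= 3 B^3 = N. As z = C B, the
    norm N of (x, y) serves as the height of the whole point. *)
Lemma param9_bound (x y B C : int) :
    x + y = 3 * C ^+ 3 -> x ^+ 2 - x * y + y ^+ 2 = 3 * B ^+ 3 ->
  0 <= B /\ (C * B) ^+ 2 <= x ^+ 2 - x * y + y ^+ 2.
Proof.
have [N0 Nxy _] := eis_form_ge x y; move=> xyC NB; rewrite NB in N0 Nxy *.
rewrite xyC in Nxy; move: N0 Nxy; clear.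
have -> : (3 * C ^+ 3) ^+ 2 = 9 * (C ^+ 2) ^+ 3 by ring.
have -> : (C * B) ^+ 2 = C ^+ 2 * B ^+ 2 by ring.
have := sqr_ge0 C; move: (C ^+ 2) => D D0 N0 Nxy.
have B0 : 0 <= B by nia.
have DB : D <= 3 * B.
  rewrite leNgt; apply/negP => h.
  have : (3 * B) ^+ 3 <= D ^+ 3 by apply: lerXn2r; rewrite ?nnegrE //; lia.
  have -> : (3 * B) ^+ 3 = 27 * B ^+ 3 by ring.
  have : 0 <= B ^+ 3 by rewrite exprn_ge0.
  have [B00|Bn] := eqVneq B 0.
    subst B; rewrite expr0n /= => _ _; nia.
  have : 0 < B ^+ 3 by rewrite exprn_gt0 // lt0r Bn.
  by move: (B ^+ 3) (D ^+ 3) Nxy => b d; clear; lia.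
split=> //; have -> : 3 * B ^+ 3 = 3 * B * B ^+ 2 by ring.
apply: ler_wpM2r => //.
by rewrite exprn_ge0.
Qed.

Lemma third_point_bound (x y z X Y : int) :
    x ^+ 3 + y ^+ 3 = 9 * z ^+ 3 -> coprimez x y ->
    X = 2 * x ^+ 2 - y * z -> Y = y ^+ 2 - 4 * x * z ->
  4 * (X ^+ 2 - X * Y + Y ^+ 2) <= (21 * (x ^+ 2 - x * y + y ^+ 2)) ^+ 2.
Proof.
move=> e cxy XE YE; have [B [C [xyC NB zE _ _]]] := param9 cxy e.
have [B0] := param9_bound xyC NB; rewrite -zE => zN.
have [N0 _ xy2] := eis_form_ge x y.
move: XE YE zN N0 xy2; clear; set N := x ^+ 2 - _ + _ => XE YE zN N0 xy2.
have hX : `|X| <= 2 * x ^+ 2 + `|y * z|.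
  have := sqr_ge0 x; rewrite XE; move: (x ^+ 2) (y * z) => a b; clear; lia.
have hY : `|Y| <= y ^+ 2 + 4 * `|x * z|.
  have := sqr_ge0 y; rewrite YE -mulrA; move: (y ^+ 2) (x * z) => a b; clear; lia.
(* The left side is at most 8 x^2 + 3 y^2 + 5 z^2, and x^2 + y^2 <= 2 N, z^2 <= N: this gives 8 * 2
   + 5 = 21. *)
have XY : 2 * (`|X| + `|Y|) <= 21 * N.
  move: hX hY (normM_le y z) (normM_le x z) zN N0 xy2 (sqr_ge0 x) (sqr_ge0 y).
  by move: (x ^+ 2) (y ^+ 2) (z ^+ 2) `|y * z| `|x * z| N `|X| `|Y|; clear; lia.
have h1 : X ^+ 2 - X * Y + Y ^+ 2 <= (`|X| + `|Y|) ^+ 2 by clear; nia.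
have h2 : (2 * (`|X| + `|Y|)) ^+ 2 <= (21 * N) ^+ 2.
  by apply: lerXn2r; rewrite ?nnegrE //; move: XY N0; clear; lia.
have E : (2 * (`|X| + `|Y|)) ^+ 2 = 4 * (`|X| + `|Y|) ^+ 2 by ring.
move: h1 h2; rewrite E; move: (X ^+ 2 - _ + _) ((_ + _) ^+ 2) ((21 * _) ^+ 2) => a b c.
by clear; lia.
Qed.

Lemma int_cube_eq (L : nzRingType) (x y c z : int) :
  x ^+ 3 + y ^+ 3 = c * z ^+ 3 ->
  (x%:~R : L) ^+ 3 + y%:~R ^+ 3 = c%:~R * z%:~R ^+ 3.
Proof. by move=> e; rewrite -!rmorphXn -rmorphD e rmorphM. Qed.

(** Division by 3 on the curve, up to sign: 3 | z makes S = C^3 divisible by 3, as [eis_descent]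
    requires. The norm of (x, y) is 3 B^3 and that of (p, q) has cube at most 27 B, so 81^2 is 27^3
    / 3. *)
Lemma triple_descent (x y z : int) :
    coprimez x y -> x ^+ 3 + y ^+ 3 = 9 * z ^+ 3 -> z != 0 -> (3 %| z)%Z ->
  exists p q r : int, [/\ coprimez p q, p ^+ 3 + q ^+ 3 = 9 * r ^+ 3, r != 0,
    (p ^+ 2 - p * q + q ^+ 2) ^+ 9 <= 81 ^+ 2 * (x ^+ 2 - x * y + y ^+ 2)
    & forall (L : fieldType) (th : L), th ^+ 3 = 36 ->
      is_square (tangent_form th x%:~R y%:~R z%:~R * tangent_form th p%:~R q%:~R r%:~R)].
Proof.
move=> cxy e z0 z3; have [B [C [xyC NB zE B3 cBC]]] := param9 cxy e.
have /dvdzP[D CE] : (3 %| C)%Z by move: z3; rewrite zE dvd3M (negPf B3) orbF.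
have C33 : (3 %| C ^+ 3)%Z by rewrite dvd3X CE dvdz_mull.
have [u [v [cuv CE' BE]]] := eis_descent cxy xyC C33 NB B3.
have uvD : u * v * (u - v) = 3 ^+ 2 * D ^+ 3.
  apply: (mulfI (x := 3)) => //; rewrite -CE' CE; ring.
have [p [q [r [cpq pqr BE' uvr]]]] := three_cubes cuv uvD.
have CE2 : C = - 3 * (p * q * r) by apply: cubez_inj; rewrite CE' uvr; ring.
exists p, q, r; split=> //.
- by apply: contraNneq z0 => r0; rewrite zE CE2 r0; apply/eqP; ring.
- rewrite NB BE BE' (_ : 9 = 3 * 3)%N // exprM.
  have -> : 81 ^+ 2 * (3 * (p ^+ 6 + p ^+ 3 * q ^+ 3 + q ^+ 6) ^+ 3)
    = (27 * (p ^+ 6 + p ^+ 3 * q ^+ 3 + q ^+ 6)) ^+ 3 by ring.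
  have := norm_triple_bound p q; have [N0 _ _] := eis_form_ge p q.
  have N3 := exprn_ge0 3 N0.
  by move=> h; apply: lerXn2r; rewrite ?nnegrE //; apply: le_trans h.
move=> L th th3; have [s sE] := tangent_form_triple th3 (@int_cube_eq L _ _ _ _ pqr).
exists (3 * C%:~R ^+ 2 * s); rewrite exprMn -sE.
rewrite /tangent_form -[x%:~R + y%:~R]rmorphD xyC zE BE BE' CE2.
rewrite !(rmorphM, rmorphXn, rmorphD, rmorphN) /=; ring.
Qed.

Lemma dvd2M (x y : int) : (2 %| x * y)%Z = (2 %| x)%Z || (2 %| y)%Z.
Proof. by rewrite !dvdzE abszM Euclid_dvdM. Qed.

Lemma dvd2X (x : int) n : (2 %| x ^+ n.+1)%Z = (2 %| x)%Z.
Proof. by rewrite !dvdzE abszX Euclid_dvdX // andbT. Qed.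

Lemma rat_cube_neq6 (x : rat) : x ^+ 3 != 6.
Proof.
apply/eqP => x3; have d0 := denq_neq0 x.
have e : numq x ^+ 3 = 6 * denq x ^+ 3.
  apply: (@intr_inj rat); rewrite [RHS]rmorphM !rmorphXn /= -[6%:~R]/(6 : rat) -x3.
  by rewrite numqE exprMn.
have n2 : (2 %| numq x)%Z.
  by rewrite -(dvd2X _ 2) e (_ : 6 = 2 * 3) // -mulrA dvdz_mulr.
have d2 : (2 %| denq x)%Z.
  have /dvdzP[m mE] := n2; have e' : 3 * denq x ^+ 3 = 2 * (2 * m ^+ 3).
    by apply: (mulfI (x := 2)) => //; transitivity (6 * denq x ^+ 3); [ring | rewrite -e mE; ring].
  have : (2 %| 3 * denq x ^+ 3)%Z by rewrite e' dvdz_mulr.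
  by rewrite dvd2M dvd2X.
have := coprime_num_den x; have : (2 %| gcdn `|numq x| `|denq x|)%N.
  by move: n2 d2; rewrite dvdn_gcd !dvdzE => -> ->.
by move=> h /eqP h1; rewrite h1 in h.
Qed.

Lemma cube_root6_field : exists (L : fieldExtType rat) (al : L),
  [/\ al ^+ 3 = 6,
      forall t, exists p q r : rat, t = p%:A + q%:A * al + r%:A * al ^+ 2
    & forall p q r : rat, p%:A + q%:A * al + r%:A * al ^+ 2 = 0 -> [/\ p = 0, q = 0 & r = 0]].
Proof.
pose P : {poly rat} := 'X^3 - 6%:P.
have sP : size P = 4%N by rewrite size_XnsubC.
have irrP : irreducible_poly P.
  apply: cubic_irreducible; rewrite ?sP // => x.
  by rewrite rootE !hornerE subr_eq0 rat_cube_neq6.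
have [L dimL [al ral fal]] := irredp_FAdjoin irrP; exists L, al.
have dega : adjoin_degree 1 al = 3%N.
  by rewrite adjoin_degreeE fal dimL sP dimv1 divn1.
have hornerE3 (p q r : rat) : (\poly_(i < 3) [:: p%:A; q%:A; r%:A : L]`_i).[al]
    = p%:A + q%:A * al + r%:A * al ^+ 2.
  by rewrite horner_poly !big_ord_recl big_ord0 /= addr0 expr0 expr1 mulr1 addrA.
split.
- move: ral; rewrite rootE rmorphB /= map_polyXn map_polyC /= !hornerE subr_eq0.
  by move=> /eqP ->; rewrite scaler_nat.
- move=> t; have := memvf t; rewrite -fal => ht.
  have := Fadjoin_poly_eq ht; have := Fadjoin_polyOver 1 al t.
  have := size_Fadjoin_poly 1 al t; rewrite dega.
  move: (Fadjoin_poly _ _ _) => f sf /polyOverP fo <-.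
  have [p pE] := vlineP _ _ (fo 0%N); have [q qE] := vlineP _ _ (fo 1%N).
  have [r rE] := vlineP _ _ (fo 2%N).
  exists p, q, r; rewrite -hornerE3; congr (_.[_]); apply/polyP => i; rewrite coef_poly.
  case: ltnP => [|h]; first by case: i => [|[|[|]]].
  by rewrite nth_default // (leq_trans sf).
move=> p q r; rewrite -hornerE3.
set f := \poly_(i < 3) _ => fal0.
have fo : f \is a polyOver 1%VS.
  by apply/polyOver_poly => -[|[|[|i]]] //= _; rewrite rpredZ ?memv_line.
have sf : (size f <= adjoin_degree 1 al)%N by rewrite dega size_poly.
have f0 : f = 0 by apply/eqP; rewrite -(root_small_adjoin_poly fo sf) rootE fal0.
have inj (c : rat) : c%:A = 0 :> L -> c = 0.
  by move/eqP; rewrite scaler_eq0 oner_eq0 orbF => /eqP.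
by split; apply: inj; [have := congr1 (fun g : {poly L} => g`_0) f0
  | have := congr1 (fun g : {poly L} => g`_1) f0
  | have := congr1 (fun g : {poly L} => g`_2) f0]; rewrite coef_poly coef0.
Qed.

Lemma tangent_form_scale (L : comNzRingType) (th g x y z : L) :
  tangent_form th (g * x) (g * y) (g * z) = g ^+ 2 * tangent_form th x y z.
Proof. by rewrite /tangent_form; ring. Qed.

Lemma tangent_formC (L : comNzRingType) (th x y z : L) :
  tangent_form th x y z = tangent_form th y x z.
Proof. by rewrite /tangent_form (addrC x). Qed.

Lemma is_square_trans (L : fieldType) (a b c : L) :
  b != 0 -> is_square (a * b) -> is_square (b * c) -> is_square (a * c).
Proof.
move=> b0 [s sE] [t tE]; exists (s * t / b).
apply: (mulIf (x := b ^+ 2)); first by rewrite expf_neq0.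
by rewrite !exprMn exprVn mulrVK ?unitfE ?expf_neq0 // -sE -tE; ring.
Qed.

Lemma cancel_cubes_sum (x y z g : int) :
    g != 0 -> ~~ (3 %| g)%Z -> (g * x) ^+ 3 + (g * y) ^+ 3 = 9 * z ^+ 3 ->
  exists2 z' : int, z = g * z' & x ^+ 3 + y ^+ 3 = 9 * z' ^+ 3.
Proof.
move=> g0 g3 e; have /dvdzP[z' zE] : (g %| z)%Z.
  rewrite -(dvdz_pexp2r _ _ (k := 3)) // -(@Gauss_dvdzr _ (3 ^+ 2)).
    by rewrite -[3 ^+ 2 * _]e !exprMn -mulrDr dvdz_mulr.
  by rewrite coprimezXl // coprimezXr // coprimez3.
exists z'; first by rewrite mulrC.
apply: (mulfI (x := g ^+ 3)); first by rewrite expf_neq0.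
by transitivity (9 * z ^+ 3); [rewrite -e; ring | rewrite zE; ring].
Qed.

(** 1701 = 81 * 21 combines the constants of [triple_descent] and [third_point_bound]; from n = 24
    on, n^3 exceeds 1701 and the ninth power wins over the square. *)
Lemma pow9_bound (n m : int) : 24 <= n -> 4 * m ^+ 9 <= (1701 * n) ^+ 2 -> m < n.
Proof.
move=> n24 h; rewrite ltNge; apply/negP => nm.
have n9 : n ^+ 9 <= m ^+ 9 by apply: lerXn2r; rewrite ?nnegrE //; lia.
have n3 : 1701 <= n ^+ 3.
  have : 24 ^+ 3 <= n ^+ 3 by apply: lerXn2r; rewrite ?nnegrE //; lia.
  by apply: le_trans.
have n8 : (1701 * n) ^+ 2 <= n ^+ 8.
  have -> : n ^+ 8 = (n ^+ 3 * n) ^+ 2 by ring.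
  have n0 : 0 <= n by lia.
  apply: lerXn2r; rewrite ?nnegrE; [exact: mulr_ge0 | | exact: ler_wpM2r].
  by rewrite mulr_ge0 ?exprn_ge0.
have n0 : 0 < n ^+ 8 by rewrite exprn_gt0 //; lia.
have : n ^+ 8 <= n ^+ 9 by rewrite exprS ler_peMl //; lia.
by move: n9 h n8 n0; move: (n ^+ 9) (m ^+ 9) (n ^+ 8) (_ ^+ 2) => a b c d; clear; lia.
Qed.

Section SquareClass.
Variables (L : fieldType) (al : L).
Hypothesis al3 : al ^+ 3 = 6.
Hypothesis indep : forall a b c : int,
  a%:~R + b%:~R * al + c%:~R * al ^+ 2 = 0 -> [/\ a = 0, b = 0 & c = 0].
Let th := al ^+ 2.

Let th3 : th ^+ 3 = 36.
Proof. by rewrite /th -exprM (exprM al 3 2) al3; ring. Qed.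

Lemma indep_intr (a : int) : a%:~R = 0 :> L -> a = 0.
Proof. by move=> a0; have [|->] // := indep (a := a) (b := 0) (c := 0); rewrite a0; ring. Qed.

Lemma th_neq0 : th != 0.
Proof.
apply/eqP => t0; have [|_ _ //] := indep (a := 0) (b := 0) (c := 1).
by rewrite -/th t0; ring.
Qed.

Lemma base_tangent_neq0 : th * (th - 3) != 0.
Proof.
rewrite mulf_neq0 ?th_neq0 //; apply/eqP => t0.
have [|_ _ //] := indep (a := -3) (b := 0) (c := 1).
by rewrite -t0 -/th; ring.
Qed.

Lemma tangent_form_neq0 (x y z : int) :
  x ^+ 3 + y ^+ 3 = 9 * z ^+ 3 -> z != 0 -> tangent_form th x%:~R y%:~R z%:~R != 0.
Proof.
move=> e z0; have xy0 : x + y != 0.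
  apply: contraNneq z0 => xy0; have := e; rewrite (_ : y = - x); last by lia.
  rewrite (_ : x ^+ 3 + _ = 0); last by ring.
  by move/esym/eqP; rewrite mulf_eq0 expf_eq0.
apply: mulf_neq0; first (apply: mulf_neq0; first (apply: mulf_neq0 th_neq0)).
- by apply/eqP => h; have := indep_intr (a := -3); rewrite -h => /(_ erefl).
- by apply: contraNneq xy0; rewrite -intrD => /indep_intr ->.
apply: contraNneq z0 => h; have [|_ _] := indep (a := x + y) (b := 0) (c := - z).
  by rewrite -h -/th rmorphD rmorphN /=; ring.
by lia.
Qed.

Lemma tangent_form_base (x y z : int) : x + y = 3 * z ->
  is_square (tangent_form th x%:~R y%:~R z%:~R * (th * (th - 3))).
Proof.
move=> e; exists (3 * z%:~R * (th * (th - 3))).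
rewrite /tangent_form -[x%:~R + y%:~R]rmorphD e rmorphM /=; ring.
Qed.

(** As x = -y modulo 3, the condition y z = 1 modulo 3 makes Z = 2 z^2 - x y divisible by 3 and X =
    2 x^2 - y z prime to 3. Removing the gcd thus keeps 3 in the last coordinate, ready for
    [triple_descent]. *)
Lemma third_point_descent (x y z : int) :
    coprimez x y -> x ^+ 3 + y ^+ 3 = 9 * z ^+ 3 -> (3 %| y * z - 1)%Z -> x + y != 3 * z ->
  exists x' y' z' : int, [/\ coprimez x' y', x' ^+ 3 + y' ^+ 3 = 9 * z' ^+ 3, (z' != 0) && (3 %| z')%Z,
    4 * (x' ^+ 2 - x' * y' + y' ^+ 2) <= (21 * (x ^+ 2 - x * y + y ^+ 2)) ^+ 2
    & is_square (tangent_form th x%:~R y%:~R z%:~R * tangent_form th x'%:~R y'%:~R z'%:~R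
                 * (th * (th - 3)))].
Proof.
move=> cxy e yz1 nz; have [B [C [xyC NB zE B3 cBC]]] := param9 cxy e.
pose X := 2 * x ^+ 2 - y * z; pose Y := y ^+ 2 - 4 * x * z; pose Z := 2 * z ^+ 2 - x * y.
have XYZ : X ^+ 3 + Y ^+ 3 = 9 * Z ^+ 3.
  apply/eqP; rewrite -subr_eq0; apply/eqP.
  transitivity ((x ^+ 3 + y ^+ 3 - 9 * z ^+ 3) * (8 * x ^+ 3 + y ^+ 3 + 8 * z ^+ 3 - 12 * x * y * z)).
    rewrite /X /Y /Z; ring.
  by rewrite e subrr mul0r.
have z3 : ~~ (3 %| z)%Z by move: yz1; apply: contraL => h; have := dvdz_mull y h; clear; lia.
have y3 : ~~ (3 %| y)%Z by move: yz1; apply: contraL => h; have := dvdz_mulr z h; clear; lia.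
have x3 : ~~ (3 %| x)%Z by move: y3 xyC; move: (C ^+ 3) => c; clear; lia.
have x2 : (3 %| x ^+ 2 - 1)%Z.
  have [|[t [->|->]]] := dvd3E x; first by rewrite (negPf x3).
    by rewrite (_ : _ - 1 = 3 * (3 * t ^+ 2 + 2 * t)) ?dvdz_mulr //; ring.
  by rewrite (_ : _ - 1 = 3 * (3 * t ^+ 2 - 2 * t)) ?dvdz_mulr //; ring.
have X3 : ~~ (3 %| X)%Z.
  by rewrite /X; move: x2 yz1; move: (x ^+ 2) (y * z) => a b; clear; lia.
have Z3 : (3 %| Z)%Z.
  have yE : y = 3 * C ^+ 3 - x by rewrite -xyC; ring.
  have z2 : (3 %| z ^+ 2 - 1)%Z.
    have [|[t [->|->]]] := dvd3E z; first by rewrite (negPf z3).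
      by rewrite (_ : _ - 1 = 3 * (3 * t ^+ 2 + 2 * t)) ?dvdz_mulr //; ring.
    by rewrite (_ : _ - 1 = 3 * (3 * t ^+ 2 - 2 * t)) ?dvdz_mulr //; ring.
  have -> : Z = 2 * (z ^+ 2 - 1) + (x ^+ 2 - 1) + 3 * (1 - x * C ^+ 3) by rewrite /Z yE; ring.
  by rewrite rpredD ?dvdz_mulr // rpredD // dvdz_mull.
(* If Z = 0, the curve equation becomes a cubic in x + y with root 3 z, whose other factor is
   positive definite. *)
have Z0 : Z != 0.
  apply: contraNneq nz => Z0.
  have : (x + y - 3 * z) * ((x + y) ^+ 2 + 3 * (x + y) * z + 3 * z ^+ 2) = 0.
    transitivity (x ^+ 3 + y ^+ 3 - 9 * z ^+ 3 - 3 * (x + y) * Z); first by rewrite /Z; ring.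
    by rewrite e Z0; ring.
  move/eqP; rewrite mulf_eq0 subr_eq0 => /orP[//|/eqP h]; exfalso.
  have : 4 * ((x + y) ^+ 2 + 3 * (x + y) * z + 3 * z ^+ 2)
     = (2 * (x + y) + 3 * z) ^+ 2 + 3 * z ^+ 2 by ring.
  have z20 : 0 < z ^+ 2 by rewrite exprn_even_gt0 //=; apply: contraNneq z3 => ->.
  have := sqr_ge0 (2 * (x + y) + 3 * z); rewrite h; move: (_ ^+ 2) (z ^+ 2) z20 => a b.
  by clear; lia.
have [x' XE] : exists x', X = gcdz X Y * x'.
  by have /dvdzP[x' XE] := dvdz_gcdl X Y; exists x'; rewrite mulrC.
have [y' YE] : exists y', Y = gcdz X Y * y'.
  by have /dvdzP[y' YE] := dvdz_gcdr X Y; exists y'; rewrite mulrC.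
have [s [t stg]] := Bezoutz X Y.
have g3 : ~~ (3 %| gcdz X Y)%Z by apply: contra X3 => h; rewrite XE dvdz_mulr.
move: (gcdz X Y) XE YE stg g3 => g XE YE stg g3.
have g0 : g != 0 by apply: contraNneq g3 => ->.
have [z' ZE xyz'] : exists2 z', Z = g * z' & x' ^+ 3 + y' ^+ 3 = 9 * z' ^+ 3.
  by apply: cancel_cubes_sum; rewrite -?XE -?YE.
have cxy' : coprimez x' y'.
  apply/coprimezP; exists (s, t) => /=; apply: (mulfI g0).
  by rewrite mulr1 -[RHS]stg XE YE; ring.
exists x', y', z'; split=> //.
- apply/andP; split; first by apply: contraNneq Z0 => z0; rewrite ZE z0 mulr0.
  by move: Z3; rewrite ZE dvd3M (negPf g3).
- apply: le_trans (third_point_bound e cxy erefl erefl); rewrite -/X -/Y ler_pM2l // XE YE.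
  have [N0 _ _] := eis_form_ge x' y'.
  have -> : (g * x') ^+ 2 - g * x' * (g * y') + (g * y') ^+ 2
     = g ^+ 2 * (x' ^+ 2 - x' * y' + y' ^+ 2) by ring.
  by rewrite ler_peMl // -gtz0_ge1 exprn_even_gt0.
have nzL : (x%:~R + y%:~R - 3 * z%:~R : L) != 0.
  apply: contraNneq nz => h; rewrite -subr_eq0; apply/eqP/indep_intr.
  by rewrite -h !(rmorphD, rmorphN, rmorphM).
have [w wE] := tangent_form_third al3 (@int_cube_eq L _ _ _ _ e) nzL.
have gL : (g%:~R : L) != 0 by apply: contraNneq g0 => /indep_intr ->.
exists (w / g%:~R); apply: (mulfI (x := g%:~R ^+ 2)); first by rewrite expf_neq0.
have -> : g%:~R ^+ 2 * (w / g%:~R) ^+ 2 = w ^+ 2 by field.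
rewrite -wE -/th.
have -> : 2 * x%:~R ^+ 2 - y%:~R * z%:~R = g%:~R * x'%:~R :> L.
  by rewrite -[RHS]intrM -XE /X rmorphB !rmorphM ?rmorphXn.
have -> : y%:~R ^+ 2 - 4 * x%:~R * z%:~R = g%:~R * y'%:~R :> L.
  by rewrite -[RHS]intrM -YE /Y rmorphB !rmorphM ?rmorphXn.
have -> : 2 * z%:~R ^+ 2 - x%:~R * y%:~R = g%:~R * z'%:~R :> L.
  by rewrite -[RHS]intrM -ZE /Z rmorphB !rmorphM ?rmorphXn.
rewrite tangent_form_scale; ring.
Qed.

Theorem tangent_form_class (x y z : int) :
    coprimez x y -> x ^+ 3 + y ^+ 3 = 9 * z ^+ 3 -> z != 0 ->
  is_square (tangent_form th x%:~R y%:~R z%:~R) \/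
  is_square (tangent_form th x%:~R y%:~R z%:~R * (th * (th - 3))).
Proof.
have [n] := ubnP (absz (x ^+ 2 - x * y + y ^+ 2)).
elim: n => // n IH in x y z * => lt cxy e z0.
have [N0 N4 _] := eis_form_ge x y.
have [B [C [xyC NB zE B3 cBC]]] := param9 cxy e.
have [xy3z|xy3z] := eqVneq (x + y) (3 * z).
  by right; apply: tangent_form_base.
(* N = 3 B^3 with B at least 2: B = 1 would bound C^3 by 1 in absolute value, so C^3 = C and x + y =
   3 z. *)
have N24 : 24 <= x ^+ 2 - x * y + y ^+ 2.
  have [B0 _] := param9_bound xyC NB.
  have Bn0 : B != 0 by apply: contraNneq B3 => ->.
  have Bn1 : B != 1.
    apply: contraNneq xy3z => B1; rewrite xyC zE B1 mulr1; apply/eqP; congr (3 * _).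
    have C1 : -1 <= C ^+ 3 <= 1.
      by move: N4; rewrite xyC NB B1; move: (C ^+ 3) => c; clear; nia.
    have [h|[h|h]] : C ^+ 3 = (-1) ^+ 3 \/ C ^+ 3 = 0 ^+ 3 \/ C ^+ 3 = 1 ^+ 3.
    - by move: C1; move: (C ^+ 3) => c; clear; lia.
    - by rewrite (cubez_inj h).
    - by rewrite (cubez_inj h).
    - by rewrite (cubez_inj h).
  have : 2 ^+ 3 <= B ^+ 3 by apply: lerXn2r; rewrite ?nnegrE //; move: B0 Bn0 Bn1; clear; lia.
  by rewrite NB; move: (B ^+ 3) => b; clear; lia.
have step p q r : coprimez p q -> p ^+ 3 + q ^+ 3 = 9 * r ^+ 3 -> r != 0 ->
    4 * (p ^+ 2 - p * q + q ^+ 2) ^+ 9 <= (1701 * (x ^+ 2 - x * y + y ^+ 2)) ^+ 2 ->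
  is_square (tangent_form th p%:~R q%:~R r%:~R) \/
  is_square (tangent_form th p%:~R q%:~R r%:~R * (th * (th - 3))).
  have [M0 _ _] := eis_form_ge p q.
  move=> cpq pqr r0 h; apply: IH => //; have := pow9_bound N24 h.
  by move: M0 N0 lt; clear; lia.
have f0 := base_tangent_neq0.
have [z3|z3] := boolP (3 %| z)%Z.
  have [p [q [r [cpq pqr r0 bd sq]]]] := triple_descent cxy e z0 z3.
  have F0 := tangent_form_neq0 pqr r0.
  have [|sq'|sq'] := step p q r cpq pqr r0.
  - apply: le_trans (_ : 4 * (81 ^+ 2 * (x ^+ 2 - x * y + y ^+ 2)) <= _).
      by rewrite ler_pM2l.
    move: N24; move: (_ + y ^+ 2) => N N24.
    have -> : (1701 * N) ^+ 2 = 81 ^+ 2 * (21 * N) ^+ 2 by ring.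
    by rewrite mulrCA ler_pM2l //; move: N24; clear; nia.
  - by left; rewrite -[X in is_square X]mulr1; apply: is_square_trans (sq _ _ th3) _; rewrite ?mulr1.
  - by right; apply: is_square_trans (sq _ _ th3) sq'.
(* Meant for (x, y) and (y, x): as x = -y modulo 3, one of y z and x z is 1 modulo 3, and the
   tangent form is symmetric in x and y. *)
have third u v : coprimez u v -> u ^+ 3 + v ^+ 3 = 9 * z ^+ 3 -> (3 %| v * z - 1)%Z ->
    u + v != 3 * z -> u ^+ 2 - u * v + v ^+ 2 = x ^+ 2 - x * y + y ^+ 2 ->
  is_square (tangent_form th u%:~R v%:~R z%:~R) \/
  is_square (tangent_form th u%:~R v%:~R z%:~R * (th * (th - 3))).
  move=> cuv euv vz1 nz Nuv.
  have [x' [y' [z' [cxy' e' /andP[z0' z3'] bd' sq']]]] := third_point_descent cuv euv vz1 nz.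
  have [p [q [r [cpq pqr r0 bd sq]]]] := triple_descent cxy' e' z0' z3'.
  have F0 := tangent_form_neq0 pqr r0; have F0' := tangent_form_neq0 e' z0'.
  have sq'' : is_square (tangent_form th u%:~R v%:~R z%:~R
      * (tangent_form th p%:~R q%:~R r%:~R * (th * (th - 3)))).
    apply: (is_square_trans (b := tangent_form th x'%:~R y'%:~R z'%:~R * (th * (th - 3)))).
    - by rewrite mulf_neq0.
    - by rewrite mulrA.
    have [s sE] := sq _ _ th3; exists (s * (th * (th - 3))).
    by rewrite exprMn -sE; ring.
  have [|sqp|[s sE]] := step p q r cpq pqr r0.
  - apply: le_trans (_ : 81 ^+ 2 * (4 * (x' ^+ 2 - x' * y' + y' ^+ 2)) <= _).
      by rewrite [leRHS]mulrCA ler_pM2l.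
    have -> : (1701 * (x ^+ 2 - x * y + y ^+ 2)) ^+ 2
       = 81 ^+ 2 * (21 * (x ^+ 2 - x * y + y ^+ 2)) ^+ 2 by ring.
    by rewrite ler_pM2l // -Nuv.
  - have b0 := mulf_neq0 F0 f0; right; apply: is_square_trans b0 sq'' _.
    by case: sqp => s sE; exists (s * (th * (th - 3))); rewrite exprMn -sE; ring.
  - have b0 := mulf_neq0 F0 f0; left; rewrite -[tangent_form _ _ _ _]mulr1.
    by apply: is_square_trans b0 sq'' _; exists s; rewrite mulr1.
have yE : y = 3 * C ^+ 3 - x by rewrite -xyC; ring.
have yz3 : ~~ (3 %| y * z)%Z.
  rewrite dvd3M negb_or z3 andbT; apply/negP => y3.
  have x3 : (3 %| x)%Z by move: y3; rewrite yE; move: (C ^+ 3) => c; clear; lia.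
  have : (3 %| gcdz x y)%Z by rewrite dvdz_gcd x3.
  by rewrite (eqP cxy).
have [yz1|yz1] := boolP (3 %| y * z - 1)%Z; first exact: third.
have xz1 : (3 %| x * z - 1)%Z.
  have -> : x * z - 1 = 3 * (C ^+ 3 * z) - (y * z + 1) by rewrite yE; ring.
  have h : (3 %| y * z + 1)%Z by move: yz3 yz1; move: (y * z) => a; clear; lia.
  by rewrite rpredB // dvdz_mulr.
rewrite tangent_formC; apply: third => //; last by ring.
- by rewrite coprimez_sym.
- by rewrite addrC.
- by rewrite addrC.
Qed.
End SquareClass.

(** * The obstruction at 2 and division of points by 2 *)

Lemma coprimez_square (m n c : int) :
  0 <= m -> coprimez m n -> m * n = c ^+ 2 -> exists u, m = u ^+ 2.
Proof.
move=> m0 /coprimezP[[u v] /= uv] mn.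
have [a [b gE]] := Bezoutz m c.
have /dvdzP[m' mE] := dvdz_gcdl m c; have /dvdzP[c' cE] := dvdz_gcdr m c.
move: (gcdz m c) gE mE cE => g gE mE cE.
have gm : g ^+ 2 = m * (a ^+ 2 * m + 2 * a * b * c + b ^+ 2 * n).
  transitivity ((a * m + b * c) ^+ 2); first by rewrite gE.
  transitivity (m * (a ^+ 2 * m + 2 * a * b * c) + b ^+ 2 * c ^+ 2); first by ring.
  by rewrite -mn; ring.
have mg : m = (u * m' ^+ 2 + v * c' ^+ 2) * g ^+ 2.
  transitivity (u * m ^+ 2 + v * (m * n)).
    by transitivity (m * (u * m + v * n)); [rewrite uv mulr1 | ring].
  have m2 : m ^+ 2 = m' ^+ 2 * g ^+ 2 by rewrite -exprMn -mE.
  have c2 : c ^+ 2 = c' ^+ 2 * g ^+ 2 by rewrite -exprMn -cE.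
  by rewrite mn m2 c2; ring.
have [m00|mn0] := eqVneq m 0; first by exists 0; rewrite m00; ring.
exists g; have : (u * m' ^+ 2 + v * c' ^+ 2) * (a ^+ 2 * m + 2 * a * b * c + b ^+ 2 * n) = 1.
  apply: (mulfI mn0); rewrite mulr1 [RHS]mg gm; ring.
move=> /mulz_eq1[e|e]; move: mg; rewrite e ?mul1r // mulN1r => mg.
by have := sqr_ge0 g; move: mg m0 mn0; move: (g ^+ 2) => k; clear; lia.
Qed.

Lemma int_parity (x : int) : exists k, x = 2 * k \/ x = 2 * k + 1.
Proof.
exists (x %/ 2)%Z; lia.
Qed.

Lemma sqr_odd8 (k : int) : exists j, (2 * k + 1) ^+ 2 = 8 * j + 1.
Proof.
have [i [->|->]] := int_parity k.
  by exists (2 * i ^+ 2 + i); ring.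
by exists (2 * i ^+ 2 + 3 * i + 1); ring.
Qed.

(* 2-adic obstruction: [N] is a common denominator of the coordinates of a square root of
   [9 C^2 + 6 B al - 3 (B + C^2) al^2]. *)
Lemma no_twisted_root (B C P Q R N : int) :
    (~~ (2 %| C)%Z /\ (4 %| B + 1)%Z) \/ ((4 %| C)%Z /\ (4 %| B - 1)%Z) ->
    N != 0 -> P ^+ 2 + 12 * Q * R = 9 * C ^+ 2 * N ^+ 2 -> P * Q + 3 * R ^+ 2 = 3 * B * N ^+ 2 ->
  Q ^+ 2 + 2 * P * R = - 3 * (B + C ^+ 2) * N ^+ 2 -> False.
Proof.
move=> BC; have [n] := ubnP `|N|%N.
elim: n => // n IH in P Q R N * => lt N0 e1 e2 e3.
have B2 : ~~ (2 %| B)%Z by case: BC => -[]; clear; lia.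
(* For even N the equations make P, R and Q even in turn, and the halved quadruple is a smaller
   solution. *)
have [N' [NE|NE]] := int_parity N; subst N.
  have /dvdzP[P' PE] : (2 %| P)%Z by rewrite -(dvd2X _ 1); move: e1; clear; lia.
  subst P.
  have /dvdzP[R' RE] : (2 %| R)%Z by rewrite -(dvd2X _ 1); move: e2; clear; lia.
  subst R.
  have /dvdzP[Q' QE] : (2 %| Q)%Z by rewrite -(dvd2X _ 1); move: e3; clear; lia.
  subst Q; apply: (IH P' Q' R' N').
  - by move: N0 lt; clear; lia.
  - by move: N0; clear; lia.
  - by move: e1; clear; lia.
  - by move: e2; clear; lia.
  - by move: e3; clear; lia.
(* For odd N the parities of P, Q and R are forced; then the third equation fails modulo 4 if C is
   odd, and the first two conflict if 4 divides C. *)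
have [j NE] := sqr_odd8 N'; rewrite NE in e1 e2 e3.
have [B' BE] := int_parity B; have [P' PE] := int_parity P; have [R' RE] := int_parity R.
have [Q' QE] := int_parity Q; have [C' CE] := int_parity C.
have {}BE : B = 2 * B' + 1 by case: BE => // BE; move: B2 BE; clear; lia.
case: BC => -[C2 B4].
  have {}CE : C = 2 * C' + 1 by case: CE => // CE; move: C2 CE; clear; lia.
  have [c CE2] := sqr_odd8 C'; rewrite -CE in CE2; rewrite CE2 in e1 e3.
  case: PE => PE; first by move: e1; rewrite PE; clear; lia.
  case: QE => QE; last by move: e3; rewrite QE BE; clear; lia.
  case: RE => RE; first by move: e2; rewrite RE QE BE; clear; lia.
  have /dvdzP[b bE] := B4.
  move: e3; rewrite PE QE RE (_ : B = 4 * b - 1); last by move: bE; clear; lia.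
  by clear; lia.
have /dvdzP[c cE] := C2; have /dvdzP[b bE] := B4; subst C.
have {}bE : B = 4 * b + 1 by move: bE; clear; lia.
case: PE => PE; last by move: e1; rewrite PE; clear; lia.
case: RE => RE; first by move: e2; rewrite PE RE BE; clear; lia.
case: QE => QE; first by move: e3; rewrite PE QE BE; clear; lia.
have [r rE] := sqr_odd8 R'; rewrite -RE in rE.
have [P1 [P1E|P1E]] := int_parity P'.
  by move: e1; rewrite PE P1E QE RE; clear; lia.
by move: e2; rewrite rE PE P1E QE bE; clear; lia.
Qed.

Lemma rat_common_denom (p q r : rat) : exists P Q R N : int,
  [/\ N != 0, p * N%:~R = P%:~R, q * N%:~R = Q%:~R & r * N%:~R = R%:~R].
Proof.
exists (numq p * denq q * denq r), (numq q * denq p * denq r), (numq r * denq p * denq q).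
exists (denq p * denq q * denq r); split; first by rewrite !mulf_neq0 ?denq_neq0.
all: by rewrite !intrM !numqE; ring.
Qed.

(* A rational solution of these equations encodes a square root of [6 B al - 3 C^2 al^2];
   the parameters [s] and [rho^2] are the coordinate of the halved point. *)
Lemma halving_param (p q r : rat) (B C : int) :
    p ^+ 2 + 12 * q * r = 0 -> p * q + 3 * r ^+ 2 = 3 * B%:~R ->
    q ^+ 2 + 2 * p * r = - 3 * C%:~R ^+ 2 ->
    ~~ (3 %| B)%Z -> C != 0 -> coprimez B C ->
  exists s t : int, [/\ B = s * (s ^+ 3 + 6 * t ^+ 3), C ^+ 2 = t * (4 * s ^+ 3 - 3 * t ^+ 3),
    0 < t, coprimez s t & ~~ (3 %| s)%Z].
Proof.
move=> e1 e2 e3 B3 C0 cBC.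
have r0 : r != 0.
  apply: contraNneq B3 => r0; have p0 : p = 0.
    by move: e1; rewrite r0 mulr0 addr0 => /eqP; rewrite expf_eq0 => /eqP.
  have /eqP : (B%:~R : rat) = 0.
    by apply: (mulfI (x := 3)) => //; rewrite -e2 p0 r0; ring.
  by rewrite intr_eq0 => /eqP ->.
(* The first equation is a conic, parametrized by tau; the other two become B = r^2 (1 + 6 tau^3)
   and C^2 = r^2 (4 tau - 3 tau^4). *)
pose tau := - p / (6 * r).
have pE : p = - 6 * r * tau by rewrite /tau; field.
have qE : q = - 3 * r * tau ^+ 2.
  apply: (mulfI (x := 12 * r)); first by rewrite mulf_neq0.
  by apply: (addrI (p ^+ 2)); rewrite mulrAC e1 pE; ring.
pose t := numq tau; pose s := denq tau.
have s0 : 0 < s := denq_gt0 tau.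
have sL : (s%:~R : rat) != 0 by rewrite intr_eq0 gt_eqF.
have tE : tau * s%:~R = t%:~R by rewrite -numqE.
have cst : coprimez s t by rewrite coprimez_sym; apply: coprime_num_den.
pose ka := r / s%:~R ^+ 2.
have BE : B%:~R = ka ^+ 2 * (s * (s ^+ 3 + 6 * t ^+ 3))%:~R.
  have -> : (s * (s ^+ 3 + 6 * t ^+ 3))%:~R = s%:~R ^+ 4 * (1 + 6 * tau ^+ 3) :> rat.
    by rewrite !(rmorphM, rmorphD, rmorphXn) /= -tE; ring.
  apply: (mulfI (x := 3)) => //; rewrite -e2 pE qE /ka; field.
  by rewrite -/s.
have CE : C%:~R ^+ 2 = ka ^+ 2 * (t * (4 * s ^+ 3 - 3 * t ^+ 3))%:~R.
  have -> : (t * (4 * s ^+ 3 - 3 * t ^+ 3))%:~R = s%:~R ^+ 4 * (4 * tau - 3 * tau ^+ 4) :> rat.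
    by rewrite !(rmorphM, rmorphB, rmorphXn) /= -tE; ring.
  apply: (mulfI (x := -3)) => //; rewrite -e3 pE qE /ka; field.
  by rewrite -/s.
pose n := numq ka; pose d := denq ka.
have d0 : d != 0 := denq_neq0 ka.
have kaE : ka * d%:~R = n%:~R by rewrite -numqE.
have BE' : d ^+ 2 * B = n ^+ 2 * (s * (s ^+ 3 + 6 * t ^+ 3)).
  by apply: (@intr_inj rat); rewrite [LHS]rmorphM [RHS]rmorphM !rmorphXn /= BE -kaE; ring.
have CE' : d ^+ 2 * C ^+ 2 = n ^+ 2 * (t * (4 * s ^+ 3 - 3 * t ^+ 3)).
  by apply: (@intr_inj rat); rewrite [LHS]rmorphM [RHS]rmorphM !rmorphXn /= CE -kaE; ring.
have cnd : coprimez (n ^+ 2) (d ^+ 2).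
  by rewrite coprimezXl // coprimezXr //; apply: coprime_num_den.
(* n^2 / d^2 is the common ratio of (B, C^2) to the pair of quartic forms at (s, t). Both pairs are
   coprime, so n^2 = d^2 = 1. *)
have n1 : n ^+ 2 = 1.
  have nB : (n ^+ 2 %| B)%Z by rewrite -(Gauss_dvdzr _ cnd) BE' dvdz_mulr.
  have nC : (n ^+ 2 %| C ^+ 2)%Z by rewrite -(Gauss_dvdzr _ cnd) CE' dvdz_mulr.
  have : (n ^+ 2 %| gcdz B (C ^+ 2))%Z by rewrite dvdz_gcd nB.
  rewrite (eqP (coprimezXr 2 cBC)) => /dvdzP[k kE].
  by have := sqr_ge0 n; have [] := mulz_eq1 (esym kE); move: kE; move: (n ^+ 2) => a; clear; nia.
rewrite n1 !mul1r in BE' CE'.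
have s3 : ~~ (3 %| s)%Z.
  apply/negP => h; have t3 : ~~ (3 %| t)%Z.
    apply/negP => h'; have : (3 %| gcdz s t)%Z by rewrite dvdz_gcd h.
    by rewrite (eqP cst).
  have /dvdzP[s' sE] := h.
  have CE'' : (d * C) ^+ 2 = 3 * (t * (36 * s' ^+ 3 - t ^+ 3)) by rewrite exprMn CE' sE; ring.
  have /dvdzP[c cE] : (3 %| d * C)%Z by rewrite -(dvd3X _ 1) CE'' dvdz_mulr.
  have : (3 %| t ^+ 4)%Z.
    have : 3 * c ^+ 2 = t * (36 * s' ^+ 3 - t ^+ 3).
      by apply: (mulfI (x := 3)) => //; rewrite -CE'' cE; ring.
    move=> e; have -> : t ^+ 4 = 3 * (12 * t * s' ^+ 3 - c ^+ 2).
      by rewrite mulrBr e; ring.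
    by rewrite dvdz_mulr.
  by rewrite dvd3X (negPf t3).
have cm : coprimez (s * (s ^+ 3 + 6 * t ^+ 3)) (t * (4 * s ^+ 3 - 3 * t ^+ 3)).
  have c3s : coprimez s 3 by rewrite coprimez3.
  have cU3 : coprimez (s ^+ 3 + 6 * t ^+ 3) 3.
    rewrite coprimez3; apply: contra s3 => h; rewrite -(dvd3X _ 2).
    by move: h; move: (s ^+ 3) (t ^+ 3) => a b; clear; lia.
  have cUt : coprimez (s ^+ 3 + 6 * t ^+ 3) t.
    have : coprimez (s ^+ 3) t by rewrite coprimezXl.
    by apply: (coprimez_span (p := 1) (q := - 6 * t ^+ 2) (r := 0) (s := 1)); ring.
  rewrite coprimezMl !coprimezMr cst cUt /=; apply/andP; split.
    have : coprimez s (3 * t ^+ 3) by rewrite coprimezMr c3s coprimezXr.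
    by apply: (coprimez_span (p := 1) (q := 0) (r := 4 * s ^+ 2) (s := -1)); ring.
  have : coprimez (s ^+ 3 + 6 * t ^+ 3) (3 ^+ 3 * t ^+ 3).
    by rewrite coprimezMr !coprimezXr.
  by apply: (coprimez_span (p := 1) (q := 0) (r := 4) (s := -1)); ring.
have d1 : d ^+ 2 = 1.
  have : (d ^+ 2 %| gcdz (s * (s ^+ 3 + 6 * t ^+ 3)) (t * (4 * s ^+ 3 - 3 * t ^+ 3)))%Z.
    by rewrite dvdz_gcd -BE' -CE'; apply/andP; split; apply: dvdz_mulr.
  rewrite (eqP cm) => /dvdzP[k kE].
  by have := sqr_ge0 d; have [] := mulz_eq1 (esym kE); move: kE; move: (d ^+ 2) => a; clear; nia.
rewrite d1 !mul1r in BE' CE'.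
exists s, t; split=> //; rewrite ltNge; apply/negP => t0.
have : 0 < C ^+ 2 by rewrite exprn_even_gt0.
rewrite CE'; have s30 : 0 < s ^+ 3 by rewrite exprn_gt0.
have t30 : 0 <= (- t) ^+ 3 by rewrite exprn_ge0 // oppr_ge0.
rewrite (_ : t * _ = - (- t * (4 * s ^+ 3 + 3 * (- t) ^+ 3))); last by ring.
rewrite oppr_gt0 ltNge => /negP; apply.
by rewrite mulr_ge0 ?oppr_ge0 // addr_ge0 // mulr_ge0 // ltW.
Qed.

(** Modulo 8, 3 B^3 is an odd square if 8 divides x or y, and three times an odd square if 8 divides
    z; in the latter case B is odd, so the 8 lies in C. *)
Lemma param9_parity (x y z B C : int) :
    coprimez x y -> [|| 8 %| x, 8 %| y | 8 %| z]%Z ->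
    x ^+ 3 + y ^+ 3 = 9 * z ^+ 3 ->
    x + y = 3 * C ^+ 3 -> x ^+ 2 - x * y + y ^+ 2 = 3 * B ^+ 3 -> z = C * B ->
  (~~ (2 %| C)%Z /\ (4 %| B + 1)%Z) \/ ((4 %| C)%Z /\ (4 %| B - 1)%Z).
Proof.
move=> cxy h8 e xyC NB zE.
have B4 b : B ^+ 3 = 4 * b + 1 -> (4 %| B - 1)%Z.
  have [k [BE|BE]] := int_parity B; rewrite BE.
    by rewrite (_ : (2 * k) ^+ 3 = 8 * k ^+ 3); [clear; lia | ring].
  rewrite (_ : (2 * k + 1) ^+ 3 = 8 * k ^+ 3 + 12 * k ^+ 2 + 6 * k + 1); last by ring.
  by clear; lia.
have B4' b : B ^+ 3 = 4 * b - 1 -> (4 %| B + 1)%Z.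
  have [k [BE|BE]] := int_parity B; rewrite BE.
    by rewrite (_ : (2 * k) ^+ 3 = 8 * k ^+ 3); [clear; lia | ring].
  rewrite (_ : (2 * k + 1) ^+ 3 = 8 * k ^+ 3 + 12 * k ^+ 2 + 6 * k + 1); last by ring.
  by clear; lia.
have nboth : ~~ ((2 %| x)%Z && (2 %| y)%Z).
  apply/negP => /andP[x2 y2]; have : (2 %| gcdz x y)%Z by rewrite dvdz_gcd x2.
  by rewrite (eqP cxy).
have odd_case u v : (8 %| u)%Z -> u + v = 3 * C ^+ 3 -> u ^+ 2 - u * v + v ^+ 2 = 3 * B ^+ 3 ->
    ~~ ((2 %| u)%Z && (2 %| v)%Z) -> ~~ (2 %| C)%Z /\ (4 %| B + 1)%Z.
  move=> /dvdzP[u' uE] uvC NB' n2.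
  have v2 : ~~ (2 %| v)%Z by move: n2 uE; clear; lia.
  have [k [vE|vE]] := int_parity v; first by move: v2 vE; clear; lia.
  have [j vE2] := sqr_odd8 k; rewrite -vE in vE2.
  split.
    by rewrite -(dvd2X _ 2); move: uvC uE v2; move: (C ^+ 3) => c; clear; lia.
  apply: (B4' ((3 * B ^+ 3 + 3) %/ 12)%Z); move: NB'; rewrite vE2 uE; move: (B ^+ 3) => b.
  by rewrite (_ : _ - _ = 8 * (8 * u' ^+ 2 - u' * v)); [clear; lia | ring].
case/or3P: h8 => h8.
- by left; apply: (odd_case x y).
- left; apply: (odd_case y x) => //; first by rewrite addrC.
    by rewrite -NB; ring.
  by rewrite andbC.
have z2 : (2 %| z)%Z by move: h8; clear; lia.
have xy2 : (2 %| x ^+ 3 + y ^+ 3)%Z.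
  by rewrite e (_ : 9 * z ^+ 3 = z * (9 * z ^+ 2)); [rewrite dvdz_mulr | ring].
have x2 : ~~ (2 %| x)%Z.
  apply: contra nboth => x2; rewrite x2 /= -(dvd2X _ 2).
  by move: xy2 x2; rewrite -(dvd2X x 2); move: (x ^+ 3) (y ^+ 3) => a b; clear; lia.
have y2 : ~~ (2 %| y)%Z.
  apply: contra nboth => y2; rewrite y2 andbT -(dvd2X _ 2).
  by move: xy2 y2; rewrite -(dvd2X y 2); move: (x ^+ 3) (y ^+ 3) => a b; clear; lia.
have [k [xE|xE]] := int_parity x; first by move: x2 xE; clear; lia.
have [j xE2] := sqr_odd8 k; rewrite -xE in xE2.
have B2 : ~~ (2 %| B)%Z.
  rewrite -(dvd2X _ 2); have [l [yE|yE]] := int_parity y; first by move: y2 yE; clear; lia.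
  have [i yE2] := sqr_odd8 l; rewrite -yE in yE2.
  move: NB; rewrite xE2 yE2 xE yE; move: (B ^+ 3) => b.
  by rewrite (_ : (2 * k + 1) * _ = 4 * k * l + 2 * k + 2 * l + 1); [clear; lia | ring].
right; have C8 : (8 %| C)%Z.
  rewrite -(@Gauss_dvdzl _ _ B) -?zE // (_ : 8 = 2 ^+ 3) // coprimezXl //.
  by rewrite coprimezE prime_coprime // -dvdzE.
split; first by move: C8; clear; lia.
have yE : y = 3 * C ^+ 3 - x by rewrite -xyC; ring.
have /dvdzP[c CE] : (8 %| C ^+ 3)%Z by rewrite (_ : C ^+ 3 = C * C ^+ 2) ?dvdz_mulr //; ring.
apply: (B4 ((3 * B ^+ 3 - 3) %/ 12)%Z).
move: NB; rewrite yE (_ : _ - _ + _ = 3 * x ^+ 2 - 9 * x * C ^+ 3 + 9 * (C ^+ 3) ^+ 2); last by ring.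
rewrite xE2 CE (_ : 9 * x * _ = 8 * (9 * x * c)); last by ring.
rewrite (_ : 9 * _ ^+ 2 = 8 * (72 * c ^+ 2)); last by ring.
by move: (B ^+ 3) (9 * x * c) (72 * c ^+ 2) => b f g; clear; lia.
Qed.

(** Only 2 can divide both t and its cofactor 4 s^3 - 3 t^3. For even t a factor 4 leaves the
    cofactor, and the rest is prime to t. *)
Lemma halving_sqrt (s t C : int) :
    0 < t -> coprimez s t -> C ^+ 2 = t * (4 * s ^+ 3 - 3 * t ^+ 3) -> ~~ (3 %| s)%Z ->
  exists rho v : int, [/\ t = rho ^+ 2, v ^+ 2 = 4 * s ^+ 3 - 3 * rho ^+ 6 & C = rho * v].
Proof.
move=> t0 cst CE s3.
suff [rho tE] : exists rho, t = rho ^+ 2.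
  have rho0 : rho != 0 by apply: contraTneq t0 => r0; rewrite tE r0 expr0n.
  have /dvdzP[v vE] : (rho %| C)%Z by rewrite -(dvdz_pexp2r _ _ (k := 2)) // CE -tE dvdz_mulr.
  exists rho, v; split=> //; last by rewrite mulrC.
  apply: (mulfI (x := rho ^+ 2)); first by rewrite expf_neq0.
  by rewrite -exprMn mulrC -vE CE tE; ring.
have [t2|t2] := boolP (2 %| t)%Z; last first.
  apply: (coprimez_square (n := 4 * s ^+ 3 - 3 * t ^+ 3) (c := C)); rewrite ?ltW //.
  have : coprimez t (4 * s ^+ 3).
    have c2 : coprimez t 2 by rewrite coprimez_sym coprimezE prime_coprime // -dvdzE.
    by rewrite coprimezMr (_ : 4 = 2 ^+ 2) // !coprimezXr // coprimez_sym.
  by apply: (coprimez_span (p := 1) (q := 0) (r := 3 * t ^+ 2) (s := 1)); ring.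
have /dvdzP[t1 tE] := t2.
have s2 : ~~ (2 %| s)%Z.
  apply/negP => s2; have : (2 %| gcdz s t)%Z by rewrite dvdz_gcd s2.
  by rewrite (eqP cst).
have C2 : (2 %| C)%Z by rewrite -(dvd2X _ 1) CE tE mulrAC dvdz_mull.
have /dvdzP[c cE] := C2.
apply: (coprimez_square (n := s ^+ 3 - 6 * t1 ^+ 3) (c := c)); rewrite ?ltW //; last first.
  by apply: (mulfI (x := 4)) => //; transitivity (C ^+ 2); [rewrite CE tE; ring | rewrite cE; ring].
have : coprimez t (s ^+ 3) by rewrite coprimezXr // coprimez_sym.
by apply: (coprimez_span (p := 1) (q := 0) (r := 3 * t1 ^+ 2) (s := 1)); rewrite ?tE; ring.
Qed.

(** With a = 2 x' and b = 2 y': the curve equation of (x' : y' : z), then, for its double, the sum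
    and the difference of the first two coordinates, and the last coordinate. *)
Lemma doubling_identities (R : comNzRingType) (rho v s : R) :
    v ^+ 2 = 4 * s ^+ 3 - 3 * rho ^+ 6 ->
  let a := 3 * rho ^+ 3 + v in let b := 3 * rho ^+ 3 - v in let z := rho * s in
  [/\ a ^+ 3 + b ^+ 3 = 72 * z ^+ 3,
      - b * (72 * z ^+ 3 + a ^+ 3) + a * (b ^+ 3 + 72 * z ^+ 3) = 48 * (rho * v) ^+ 3,
      - b * (72 * z ^+ 3 + a ^+ 3) - a * (b ^+ 3 + 72 * z ^+ 3)
        = 16 * (2 * s ^+ 6 - 30 * s ^+ 3 * rho ^+ 6 - 9 * rho ^+ 12)
    & z * (a ^+ 3 - b ^+ 3) = 8 * (rho * v * (s * (s ^+ 3 + 6 * rho ^+ 6)))].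
Proof. by move=> v2 a b z; rewrite /a /b /z; split; ring: v2. Qed.

(** The right-hand sides are the duplication formula on the curve. The divisibility by 8 rules out
    the class of (1 : 2 : 1), and in the trivial class [halving_param] supplies the half point. *)
Lemma halving (x y z : int) :
    coprimez x y -> x ^+ 3 + y ^+ 3 = 9 * z ^+ 3 -> z != 0 ->
    [|| 8 %| x, 8 %| y | 8 %| z]%Z ->
  exists x' y' z' e : int, [/\ e ^+ 2 = 1 /\ x' ^+ 3 + y' ^+ 3 = 9 * z' ^+ 3,
    x = e * (- y' * (9 * z' ^+ 3 + x' ^+ 3)), y = e * (x' * (y' ^+ 3 + 9 * z' ^+ 3))
    & z = e * (z' * (x' ^+ 3 - y' ^+ 3))].
Proof.
move=> cxy e z0 h8; have [B [C [xyC NB zE B3 cBC]]] := param9 cxy e.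
have par := param9_parity cxy h8 e xyC NB zE.
have [L [al [al3 coords indepQ]]] := cube_root6_field.
have intE (a : int) : a%:~R = (a%:~R : rat)%:A :> L by rewrite scaler_int.
have indep (a b c : int) : a%:~R + b%:~R * al + c%:~R * al ^+ 2 = 0 -> [/\ a = 0, b = 0 & c = 0].
  rewrite !intE => /indepQ[/eqP a0 /eqP b0 /eqP c0].
  by move: a0 b0 c0; rewrite !intr_eq0 => /eqP-> /eqP-> /eqP->.
have C0 : C != 0 by apply: contraNneq z0 => C0; rewrite zE C0 mul0r.
have CL : (C%:~R : L) != 0 by apply: contraNneq C0 => /(indep_intr indep) ->.
have sq_coords (a b c : int) : is_square (a%:~R + b%:~R * al + c%:~R * al ^+ 2 : L) ->
    exists p q r : rat, [/\ p ^+ 2 + 12 * q * r = a%:~R, 2 * p * q + 6 * r ^+ 2 = b%:~R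
      & q ^+ 2 + 2 * p * r = c%:~R].
  case=> w; have [p [q [r ->]]] := coords w => wE.
  have algM u v : (u * v)%:A = u%:A * v%:A :> L by exact: (rmorphM (in_alg L)).
  have algD u v : (u + v)%:A = u%:A + v%:A :> L by exact: (rmorphD (in_alg L)).
  have algB u (n : int) : (u - n%:~R)%:A = u%:A - n%:~R :> L by rewrite scalerBl intE.
  have fa : (p ^+ 2 + 12 * q * r)%:A = p%:A ^+ 2 + 12 * q%:A * r%:A :> L.
    by rewrite algD !algM scaler_nat.
  have fb : (2 * p * q + 6 * r ^+ 2)%:A = 2 * p%:A * q%:A + 6 * r%:A ^+ 2 :> L.
    by rewrite algD !algM !scaler_nat.
  have fc : (q ^+ 2 + 2 * p * r)%:A = q%:A ^+ 2 + 2 * p%:A * r%:A :> L.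
    by rewrite algD !algM scaler_nat.
  have [|h1 h2 h3] := indepQ (p ^+ 2 + 12 * q * r - a%:~R) (2 * p * q + 6 * r ^+ 2 - b%:~R)
      (q ^+ 2 + 2 * p * r - c%:~R).
    rewrite (algB _ a) (algB _ b) (algB _ c).
    rewrite fa fb fc.
    transitivity ((p%:A + q%:A * al + r%:A * al ^+ 2) ^+ 2
                  - (a%:~R + b%:~R * al + c%:~R * al ^+ 2)).
      move: (p%:A) (q%:A) (r%:A : L) => P Q R; ring: al3.
    by rewrite wE subrr.
  by exists p, q, r; split; apply: subr0_eq.
pose F := tangent_form (al ^+ 2) x%:~R y%:~R z%:~R.
have FE : F = (3 * C%:~R ^+ 2) ^+ 2 * (0%:~R + (6 * B)%:~R * al + (- 3 * C ^+ 2)%:~R * al ^+ 2).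
  rewrite /F /tangent_form -intrD xyC zE !(rmorphM, rmorphXn, rmorphN) /=.
  by ring: al3.
have C3L : 3 * C%:~R ^+ 2 != 0 :> L.
  apply: contraNneq C0 => h; have := indep_intr indep (a := 3 * C ^+ 2).
  by rewrite rmorphM rmorphXn /= => /(_ h) /eqP; rewrite mulf_eq0 /= expf_eq0.
have descale (k b : L) : k != 0 -> is_square (k ^+ 2 * b) -> is_square b.
  move=> k0 [w wE]; exists (w / k); apply: (mulfI (x := k ^+ 2)); first by rewrite expf_neq0.
  by rewrite wE; field.
have al0 : al != 0.
  apply/eqP => al0; have [|_ //] := indep 0 1 0.
  by rewrite al0; ring.
have [sF|sF] := tangent_form_class al3 indep cxy e z0; last first.
  have [p [q [r [e1 e2 e3]]]] : exists p q r : rat,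
      [/\ p ^+ 2 + 12 * q * r = (9 * C ^+ 2)%:~R,
          2 * p * q + 6 * r ^+ 2 = (6 * B)%:~R & q ^+ 2 + 2 * p * r = (- 3 * (B + C ^+ 2))%:~R].
    apply: sq_coords; apply: (descale (3 * C%:~R ^+ 2 * al ^+ 2)).
      by rewrite mulf_neq0 // expf_neq0.
    rewrite (_ : _ * _ = F * (al ^+ 2 * (al ^+ 2 - 3))) //.
    by rewrite FE !(rmorphM, rmorphXn, rmorphN, rmorphD) /=; ring: al3.
  have [P [Q [R [N [N0 pP qQ rR]]]]] := rat_common_denom p q r.
  case: (no_twisted_root (P := P) (Q := Q) (R := R) par N0).
  - apply: (@intr_inj rat).
    transitivity ((p ^+ 2 + 12 * q * r) * N%:~R ^+ 2).
      by rewrite !(rmorphD, rmorphM, rmorphXn) /= -pP -qQ -rR; ring.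
    by rewrite e1 !(rmorphM, rmorphXn).
  - apply: (@intr_inj rat); apply: (mulfI (x := 2)) => //.
    transitivity ((2 * p * q + 6 * r ^+ 2) * N%:~R ^+ 2).
      by rewrite !(rmorphD, rmorphM, rmorphXn) /= -pP -qQ -rR; ring.
    by rewrite e2 !(rmorphM, rmorphXn) /=; ring.
  apply: (@intr_inj rat).
  transitivity ((q ^+ 2 + 2 * p * r) * N%:~R ^+ 2).
    by rewrite !(rmorphD, rmorphM, rmorphXn) /= -pP -qQ -rR; ring.
  by rewrite e3 !(rmorphM, rmorphXn, rmorphD, rmorphN).
have [p [q [r [e1 e2 e3]]]] : exists p q r : rat, [/\ p ^+ 2 + 12 * q * r = 0%:~R,
    2 * p * q + 6 * r ^+ 2 = (6 * B)%:~R & q ^+ 2 + 2 * p * r = (- 3 * C ^+ 2)%:~R].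
  by apply: sq_coords; apply: (descale _ _ C3L); rewrite -FE.
have [s [t [BE CE t0 cst s3]]] : exists s t : int, [/\ B = s * (s ^+ 3 + 6 * t ^+ 3),
    C ^+ 2 = t * (4 * s ^+ 3 - 3 * t ^+ 3), 0 < t, coprimez s t & ~~ (3 %| s)%Z].
  apply: (halving_param e1) => //; last by rewrite e3 rmorphM rmorphXn.
  apply: (mulfI (x := 2)) => //.
  transitivity (2 * p * q + 6 * r ^+ 2); first by ring.
  by rewrite e2 rmorphM /=; ring.
have [rho [v [tE v2 CE']]] := halving_sqrt t0 cst CE s3.
(* v^2 = 4 s^3 - 3 rho^6 gives v and rho the same parity. *)
have [x' x'E] : exists x', 2 * x' = 3 * rho ^+ 3 + v.
  have [k [vE|vE]] := int_parity v; have [l [rE|rE]] := int_parity rho.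
  - by exists (12 * l ^+ 3 + k); rewrite vE rE; ring.
  - exfalso; move: v2; rewrite vE rE (_ : (2 * l + 1) ^+ 6 = 2 * (32 * l ^+ 6 + 96 * l ^+ 5 + 120 * l ^+ 4 + 80 * l ^+ 3 + 30 * l ^+ 2 + 6 * l) + 1); last by ring.
    by rewrite (_ : (2 * k) ^+ 2 = 2 * (2 * k ^+ 2)); [clear; lia | ring].
  - exfalso; move: v2; rewrite vE rE (_ : (2 * l) ^+ 6 = 2 * (32 * l ^+ 6)); last by ring.
    by rewrite (_ : (2 * k + 1) ^+ 2 = 2 * (2 * k ^+ 2 + 2 * k) + 1); [clear; lia | ring].
  - by exists (12 * l ^+ 3 + 18 * l ^+ 2 + 9 * l + k + 2); rewrite vE rE; ring.
have [y' y'E] : exists y', 2 * y' = 3 * rho ^+ 3 - v.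
  by exists (3 * rho ^+ 3 - x'); rewrite mulrBr x'E; ring.
pose z' := rho * s; pose X := - y' * (9 * z' ^+ 3 + x' ^+ 3).
pose Y := x' * (y' ^+ 3 + 9 * z' ^+ 3).
have [] := doubling_identities v2; rewrite -x'E -y'E -/z' => i1 i2 i3 i4.
have e' : x' ^+ 3 + y' ^+ 3 = 9 * z' ^+ 3.
  by apply: (mulfI (x := 8)) => //; rewrite -[RHS]/(8 * _) mulrA -i1; ring.
have XY : X + Y = 3 * C ^+ 3.
  apply: (mulfI (x := 16)) => //; rewrite CE' mulrA -[RHS]i2 /X /Y; ring.
have ZE : z = z' * (x' ^+ 3 - y' ^+ 3).
  apply: (mulfI (x := 8)) => //; rewrite zE BE tE CE' -exprM -[LHS]i4; ring.
pose G := 2 * s ^+ 6 - 30 * s ^+ 3 * t ^+ 3 - 9 * t ^+ 6.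
have XmY : X - Y = G.
  by apply: (mulfI (x := 16)) => //; rewrite /G tE -!exprM -[RHS]i3 /X /Y; ring.
(* The sum x + y and the norm N are known, and 3 (x - y)^2 = 4 N - (x + y)^2 leaves only a sign
   open. The other sign exchanges x' and y' and makes e = -1. *)
have xmy : (x - y) ^+ 2 = G ^+ 2.
  apply: (mulfI (x := 3)) => //.
  transitivity (4 * (x ^+ 2 - x * y + y ^+ 2) - (x + y) ^+ 2); first by ring.
  rewrite NB xyC (_ : (3 * C ^+ 3) ^+ 2 = 9 * (C ^+ 2) ^+ 3); last by ring.
  by rewrite CE BE /G; ring.
have sumdiff (a b c d g k : int) : a + b = k -> c + d = k -> a - b = g -> c - d = g -> a = c /\ b = d.
  by clear; lia.
move/eqP: xmy; rewrite eqf_sqr => /orP[] /eqP xmy.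
  have [xX yY] := sumdiff _ _ _ _ _ _ xyC XY xmy XmY.
  by exists x', y', z', 1; split=> //; rewrite mul1r.
have YmX : Y - X = - G by rewrite -XmY opprB.
have [xY yX] := sumdiff _ _ _ _ _ _ xyC (etrans (addrC Y X) XY) xmy YmX.
exists y', x', z', (-1); split; first by rewrite addrC.
- by rewrite xY /Y; ring.
- by rewrite yX /X; ring.
- by rewrite ZE; ring.
Qed.

(** * The weighted diagonal system over the rationals *)

(** The inequality (om + xi)^3 <= 4 (om^3 + xi^3) excludes 2 eta <= om + xi, so eta = om + xi.
    Expanding the cube, 9 | be then gives 3 | om and next 3 | xi. *)
Lemma opposite_signs_absurd (be om xi eta : int) :
    0 < om -> 0 < xi -> (9 %| be)%Z -> 0 < be -> ~~ (3 %| xi)%Z ->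
    0 < eta -> eta ^+ 3 = be * om ^+ 3 + xi ^+ 3 -> (eta %| om + xi)%Z -> False.
Proof.
move=> om0 xi0 be9 be0 xi3 eta0 e /dvdzP[k kE].
have k0 : 0 < k by rewrite -(pmulr_lgt0 _ eta0) -kE addr_gt0.
have k1 : k = 1.
  apply/eqP; rewrite eq_le; apply/andP; split; last by move: k0; clear; lia.
  rewrite leNgt; apply/negP => k2.
  have h2 : 2 * eta <= om + xi by rewrite kE ler_pM2r //; move: k2; clear; lia.
  have : (2 * eta) ^+ 3 <= (om + xi) ^+ 3.
    by apply: lerXn2r => //; rewrite nnegrE; move: om0 xi0 eta0; clear; lia.
  have om30 : 0 < om ^+ 3 by rewrite exprn_gt0.
  have : (om + xi) ^+ 3 <= 4 * (om ^+ 3 + xi ^+ 3).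
    rewrite -subr_ge0 (_ : _ - _ = 3 * ((om + xi) * (om - xi) ^+ 2)); last by ring.
    by rewrite mulr_ge0 // mulr_ge0 ?sqr_ge0 // addr_ge0 ?ltW.
  have beo : om ^+ 3 <= be * om ^+ 3 by rewrite ler_peMl ?(ltW om30).
  have xi30 : 0 < xi ^+ 3 by rewrite exprn_gt0.
  rewrite (_ : (2 * eta) ^+ 3 = 8 * eta ^+ 3); last by ring.
  rewrite e; move: beo om30 xi30; move: (xi ^+ 3) (om ^+ 3) (be * om ^+ 3) ((om + xi) ^+ 3) => a b c d.
  by clear; lia.
have eE : eta = om + xi by rewrite kE k1 mul1r.
have e' : be * om ^+ 2 = om ^+ 2 + 3 * (xi * (om + xi)).
  apply: (mulfI (x := om)); first by rewrite gt_eqF.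
  by apply: (addIr (xi ^+ 3)); transitivity (eta ^+ 3); [rewrite e; ring | rewrite eE; ring].
have /dvdzP[b bE] := be9.
have om3 : (3 %| om)%Z.
  rewrite -(dvd3X _ 1) (_ : om ^+ 2 = 3 * (3 * b * om ^+ 2 - xi * (om + xi))) ?dvdz_mulr //.
  by apply: (addIr (3 * (xi * (om + xi)))); rewrite -e' bE; ring.
have /dvdzP[o oE] := om3.
have : (3 %| xi ^+ 2)%Z.
  have : 3 * xi ^+ 2 = 3 * (3 * (9 * b * o ^+ 2 - o ^+ 2 - xi * o)).
    by apply: (addIr (om ^+ 2 + 3 * xi * om)); transitivity (be * om ^+ 2); [rewrite e' | rewrite bE]; rewrite oE; ring.
  by move/(mulfI (x := 3)) => -> //; rewrite dvdz_mulr.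
by rewrite dvd3X (negPf xi3).
Qed.

Lemma same_sign_absurd (be W x' : int) :
  0 < W -> 0 < x' -> 9 <= be -> (be * W ^+ 3 + x' ^+ 3 %| W + x')%Z -> False.
Proof.
move=> W0 x0 be9 /dvdzP[k kE].
have W3 : W <= W ^+ 3 by rewrite ler_eXnr //; move: W0; clear; lia.
have x3 : x' <= x' ^+ 3 by rewrite ler_eXnr //; move: x0; clear; lia.
have beW : 9 * W ^+ 3 <= be * W ^+ 3 by rewrite ler_pM2r // exprn_gt0.
have q0 : W + x' < be * W ^+ 3 + x' ^+ 3.
  move: W3 x3 beW W0 x0. move: (x' ^+ 3) (W ^+ 3) (be * W ^+ 3) => a b c; clear; lia.
have S0 : 0 < W + x' by rewrite addr_gt0.
have k0 : 0 < k by rewrite -(pmulr_lgt0 _ (lt_trans S0 q0)) -kE.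
by move: kE q0 k0 S0; move: (W + x') (be * W ^+ 3 + x' ^+ 3) => a b; clear; nia.
Qed.

(* The two divisibilities come from reducing the line equation modulo the two factors
   [y'] and [be W^3 + x'^3] of the x-coordinate of the doubled point. *)
Lemma doubled_point_absurd (be M W x' y' : int) :
    coprimez x' y' -> ~~ (3 %| x')%Z -> (9 %| be)%Z -> 0 < be -> W != 0 ->
    x' ^+ 3 + y' ^+ 3 = be * W ^+ 3 ->
    W * (x' ^+ 3 - y' ^+ 3)
      = x' * (y' ^+ 3 + be * W ^+ 3) - M * (y' * (be * W ^+ 3 + x' ^+ 3)) -> False.
Proof.
move=> cxy x3 be9 be0 W0 e line.
have x0 : x' != 0 by apply: contraNneq x3 => ->.
have cyW : coprimez y' W.
  have : coprimez (y' ^+ 3) (x' ^+ 3) by rewrite coprimezXl // coprimezXr // coprimez_sym.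
  apply: (coprimez_span (p := y' ^+ 2) (q := 0) (r := - y' ^+ 2) (s := be * W ^+ 2)); first ring.
  by apply: (addIr (y' ^+ 3)); rewrite e; ring.
have cxW : coprimez x' W.
  have : coprimez (x' ^+ 3) (y' ^+ 3) by rewrite coprimezXl // coprimezXr.
  apply: (coprimez_span (p := x' ^+ 2) (q := 0) (r := - x' ^+ 2) (s := be * W ^+ 2)); first ring.
  by apply: (addrI (x' ^+ 3)); rewrite e; ring.
have yd : (y' %| W - x')%Z.
  rewrite -(@Gauss_dvdzr _ (x' ^+ 3)); last by rewrite coprimezXr // coprimez_sym.
  apply/dvdzP; exists (W * y' ^+ 2 + 2 * x' * y' ^+ 2 - M * (be * W ^+ 3 + x' ^+ 3)).
  have : W * (x' ^+ 3 - y' ^+ 3)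
     = x' * (y' ^+ 3 + (x' ^+ 3 + y' ^+ 3)) - M * (y' * (be * W ^+ 3 + x' ^+ 3)) by rewrite line e.
  move=> l; apply: (addIr (x' ^+ 4 - W * y' ^+ 3)).
  by transitivity (W * (x' ^+ 3 - y' ^+ 3)); [ring | rewrite l; ring].
set q := be * W ^+ 3 + x' ^+ 3 in line yd *.
have /dvdzP[b bE] := be9.
have qd : (q %| W + x')%Z.
  have cq : coprimez q (3 * x' ^+ 3).
    have cq3 : coprimez q 3.
      have q9 : q = 3 * (3 * (b * W ^+ 3)) + x' ^+ 3 by rewrite /q bE; ring.
      rewrite coprimez3; apply: contra x3; rewrite -(dvd3X x' 2) q9.
      by move: (b * W ^+ 3) (x' ^+ 3) => a c; clear; lia.
    have cx3 : coprimez x' 3 by rewrite coprimez3.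
    have cxq : coprimez x' q.
      have : coprimez x' (y' ^+ 3) by rewrite coprimezXr.
      apply: (coprimez_span (p := 1) (q := 0) (r := - 2 * x' ^+ 2) (s := 1)); first ring.
      by rewrite /q -e; ring.
    by rewrite coprimezMr cq3 coprimezXr // coprimez_sym.
  rewrite -(Gauss_dvdzr _ cq); apply/dvdzP; exists (W + 2 * x' - M * y').
  have ye : y' ^+ 3 = q - 2 * x' ^+ 3 by apply: (addrI (x' ^+ 3)); rewrite e /q; ring.
  have be' : be * W ^+ 3 = q - x' ^+ 3 by rewrite /q; ring.
  move: line; rewrite ye be' => l; apply: (addIr (- W * q - 2 * x' * q)).
  by transitivity (W * (x' ^+ 3 - (q - 2 * x' ^+ 3)) - x' * (2 * q - 3 * x' ^+ 3)); [ring | rewrite l; ring].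
have cube_sign (t u : int) : t ^+ 3 = u -> 0 < u -> 0 < t.
  by move=> <-; rewrite exprn_odd_gt0.
(* For equal signs q exceeds W + x' in absolute value, against [qd]; for opposite signs cancellation
   may make q small, and [yd] is used instead. *)
have [W0p|W0n] := ltrP 0 W; have [x0p|x0n] := ltrP 0 x'.
- by apply: (same_sign_absurd W0p x0p) qd; move: be0 bE; clear; lia.
- have x0n' : 0 < - x' by rewrite oppr_gt0 lt_neqAle x0.
  have ye : y' ^+ 3 = be * W ^+ 3 + (- x') ^+ 3 by rewrite -e; ring.
  apply: (opposite_signs_absurd W0p x0n' be9 be0 _ _ ye); rewrite ?rpredN //.
  by apply: cube_sign ye _; rewrite addr_gt0 ?mulr_gt0 ?exprn_gt0.
- have W0n' : 0 < - W by rewrite oppr_gt0 lt_neqAle W0.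
  have ye : (- y') ^+ 3 = be * (- W) ^+ 3 + x' ^+ 3.
    by apply: (addrI (y' ^+ 3 + be * W ^+ 3)); rewrite -{1}e; ring.
  apply: (opposite_signs_absurd W0n' x0p be9 be0 x3 _ ye).
    by apply: cube_sign ye _; rewrite addr_gt0 ?mulr_gt0 ?exprn_gt0.
  have -> : - W + x' = - (W - x') by ring.
  by move: yd => /dvdzP[k ->]; apply/dvdzP; exists k; ring.
have W0n' : 0 < - W by rewrite oppr_gt0 lt_neqAle W0.
have x0n' : 0 < - x' by rewrite oppr_gt0 lt_neqAle x0.
apply: (same_sign_absurd W0n' x0n' (be := be)); first by move: be0 bE; clear; lia.
have -> : be * (- W) ^+ 3 + (- x') ^+ 3 = - q by rewrite /q; ring.
by move: qd => /dvdzP[k kE]; apply/dvdzP; exists k; rewrite mulrN -kE; ring.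
Qed.

Lemma pow9_mod8 n : exists k : int, 9 ^+ n = 8 * k + 1.
Proof.
elim: n => [|n [k kE]]; first by exists 0.
by exists (9 * k + 1); rewrite exprS kE; ring.
Qed.

(** Modulo 8 powers of 9 are 1, so w = x + y and x^3 + y^3 = (x + y)^3. Hence 8 | x y (x + y), where
    exactly one factor is even. *)
Lemma line_cubic_dvd8 (x y w : int) b m :
    coprimez x y -> x ^+ 3 + y ^+ 3 = 9 ^+ b * w ^+ 3 -> w = y + 9 ^+ m * x ->
  [|| 8 %| x, 8 %| y | 8 %| w]%Z.
Proof.
move=> cxy e wE; have [l lE] := pow9_mod8 b; have [k kE] := pow9_mod8 m.
have {}wE : w = x + y + 8 * (k * x) by rewrite wE kE; ring.
have d8 : (8 %| x * y * (x + y))%Z.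
  have c83 : coprimez 8 3 by [].
  rewrite -(Gauss_dvdzr _ c83); apply/dvdzP.
  exists (- (l * w ^+ 3 + 3 * (x + y) ^+ 2 * (k * x) + 24 * (x + y) * (k * x) ^+ 2 + 64 * (k * x) ^+ 3)).
  apply: (addrI (x ^+ 3 + y ^+ 3)); transitivity ((x + y) ^+ 3); first by ring.
  by rewrite e lE wE; ring.
have c8 t : ~~ (2 %| t)%Z -> coprimez 8 t.
  by move=> t2; rewrite (_ : 8 = 2 ^+ 3) // coprimezXl // coprimezE prime_coprime // -dvdzE.
have [i [xE|xE]] := int_parity x; have [j [yE|yE]] := int_parity y.
- have : (2 %| gcdz x y)%Z by rewrite dvdz_gcd; move: xE yE; clear; lia.
  by rewrite (eqP cxy).
- apply/or3P; constructor 1; rewrite -(@Gauss_dvdzl _ _ (y * (x + y))) ?mulrA //.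
  by rewrite coprimezMr !c8 //; move: xE yE; clear; lia.
- apply/or3P; constructor 2; rewrite -(@Gauss_dvdzl _ _ (x * (x + y))) ?mulrA ?(mulrC y) //.
  by rewrite coprimezMr !c8 //; move: xE yE; clear; lia.
apply/or3P; constructor 3; rewrite wE rpredD // ?dvdz_mulr //.
rewrite -(@Gauss_dvdzr _ (x * y)) //.
by rewrite coprimezMr !c8 //; move: xE yE; clear; lia.
Qed.

Lemma line_cubic_coprime (x y w : int) b m :
    (0 < b)%N -> (0 < m)%N -> coprimez x y -> ~~ (3 %| x)%Z ->
    x ^+ 3 + y ^+ 3 = 9 ^+ b * w ^+ 3 -> w = y + 9 ^+ m * x -> False.
Proof.
move=> b0 m0 cxy x3 e wE.
have pow3 n : (0 < n)%N -> (3 %| 9 ^+ n)%Z.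
  by case: n => // n _; rewrite exprS (_ : 9 = 3 * 3) // -!mulrA dvdz_mulr.
have y3 : ~~ (3 %| y)%Z.
  apply: contra x3 => y3; rewrite -(dvd3X _ 2).
  have -> : x ^+ 3 = 9 ^+ b * w ^+ 3 - y ^+ 3 by rewrite -e; ring.
  by rewrite rpredB ?dvd3X // dvdz_mulr // pow3.
have w3 : ~~ (3 %| w)%Z.
  apply: contra y3 => w3; have -> : y = w - 9 ^+ m * x by rewrite wE; ring.
  by rewrite rpredB // dvdz_mulr // pow3.
have b3 : (b %% 3 = 1)%N.
  have := @sum_cubes_pow3 (2 * b) x y w cxy x3 y3 w3; rewrite exprM => /(_ e).
  by clear; lia.
pose j := (b %/ 3)%N; have bE : b = (1 + j * 3)%N by rewrite /j; move: b3; clear; lia.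
pose z := 9 ^+ j * w.
have ez : x ^+ 3 + y ^+ 3 = 9 * z ^+ 3 by rewrite e bE exprD exprM /z; ring.
have w0 : w != 0 by apply: contraNneq w3 => ->.
have j0 : (9 ^+ j : int) != 0 by rewrite expf_neq0.
have z0 : z != 0 by rewrite mulf_neq0.
have h8 : [|| 8 %| x, 8 %| y | 8 %| z]%Z.
  by case/or3P: (line_cubic_dvd8 cxy e wE) => h; rewrite ?h ?orbT // /z dvdz_mull ?orbT.
have [x' [y' [z' [s [[s2 e'] xE yE zE]]]]] := halving cxy ez z0 h8.
have s0 : s != 0 by apply: contra_eqN s2 => /eqP->; rewrite expr0n.
have cxy' : coprimez x' y'.
  apply: (coprimez_span (p := 0) (q := - s * (9 * z' ^+ 3 + x' ^+ 3))
    (r := s * (y' ^+ 3 + 9 * z' ^+ 3)) (s := 0)) cxy; rewrite ?xE ?yE; ring.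
have x3' : ~~ (3 %| x')%Z.
  apply/negP => h; have h' : (3 %| y')%Z.
    rewrite -(dvd3X _ 2) (_ : y' ^+ 3 = 3 * (3 * z' ^+ 3) - x' ^+ 3).
      by rewrite rpredB ?dvd3X // dvdz_mulr.
    by rewrite mulrA -[3 * 3]/(9 : int) -e'; ring.
  have : (3 %| gcdz x' y')%Z by rewrite dvdz_gcd h h'.
  by rewrite (eqP cxy').
have d3 : ~~ (3 %| x' ^+ 3 - y' ^+ 3)%Z.
  apply: contra x3'; rewrite -(dvd3X x' 2).
  by move: e'; move: (x' ^+ 3) (y' ^+ 3) (z' ^+ 3) => a c d; clear; lia.
(* z = 9^j w and x'^3 - y'^3 is prime to 3, so the whole 9^j lies in z', and the half point
   satisfies an equation with the same 9^b. *)
have /dvdzP[W zE'] : (9 ^+ j %| z')%Z.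
  rewrite -(@Gauss_dvdzl _ _ (x' ^+ 3 - y' ^+ 3)); last first.
    by rewrite (_ : 9 = 3 ^+ 2) // -exprM coprimezXl // coprimez_sym coprimez3.
  have -> : z' * (x' ^+ 3 - y' ^+ 3) = 9 ^+ j * (s * w).
    transitivity (s ^+ 2 * (z' * (x' ^+ 3 - y' ^+ 3))); first by rewrite s2 mul1r.
    by transitivity (s * z); [rewrite zE; ring | rewrite /z; ring].
  by rewrite dvdz_mulr.
have wW : w = s * (W * (x' ^+ 3 - y' ^+ 3)).
  by apply: (mulfI j0); rewrite -/z zE zE'; ring.
have z9 : 9 * z' ^+ 3 = 9 ^+ b * W ^+ 3 by rewrite zE' bE exprD exprM; ring.
have W0 : W != 0 by apply: contraNneq w0 => W0; rewrite wW W0; apply/eqP; ring.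
rewrite z9 in xE yE e'.
apply: (@doubled_point_absurd (9 ^+ b) (9 ^+ m) W x' y') => //.
- by case: (b) b0 => // b' _; rewrite exprS dvdz_mulr.
- by rewrite exprn_gt0.
apply: (mulfI s0); rewrite -wW wE.
by rewrite {1}yE {1}xE; ring.
Qed.

Lemma line_cubic (x y w : int) b m :
    (0 < b)%N -> (0 < m)%N -> ~~ (3 %| x)%Z ->
    x ^+ 3 + y ^+ 3 = 9 ^+ b * w ^+ 3 -> w = y + 9 ^+ m * x -> False.
Proof.
move=> b0 m0 x3 e wE.
have [x' xE] : exists x', x = gcdz x y * x'.
  by have /dvdzP[x' xE] := dvdz_gcdl x y; exists x'; rewrite mulrC.
have [y' yE] : exists y', y = gcdz x y * y'.
  by have /dvdzP[y' yE] := dvdz_gcdr x y; exists y'; rewrite mulrC.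
have [s [t stg]] := Bezoutz x y.
move: (gcdz x y) xE yE stg => g xE yE stg.
have g0 : g != 0 by apply: contraNneq x3 => g0; rewrite xE g0 mul0r.
have cxy : coprimez x' y'.
  apply/coprimezP; exists (s, t) => /=; apply: (mulfI g0).
  by rewrite mulr1 -[RHS]stg xE yE; ring.
have x3' : ~~ (3 %| x')%Z by apply: contra x3 => h; rewrite xE dvdz_mull.
apply: (line_cubic_coprime b0 m0 cxy x3' _ (erefl (y' + 9 ^+ m * x'))).
apply: (mulfI (x := g ^+ 3)); first by rewrite expf_neq0.
transitivity (x ^+ 3 + y ^+ 3); first by rewrite xE yE; ring.
by rewrite e wE xE yE; ring.
Qed.

(** For s > 0 both Y and z are multiples of 3, and dividing them by 3 turns (s, m) into (s - 3, m +
    1); [m] records this drift. The descent ends in [line_cubic] at s = 0, while s = 1 and s = 2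
    would give 3 | X. *)
Lemma pow3_line_cubic (X Y z : int) b s m :
    (0 < b)%N -> (0 < s + m)%N -> ~~ (3 %| X)%Z ->
    3 ^+ s * X ^+ 3 + Y ^+ 3 + 9 ^+ b * z ^+ 3 = 0 -> 3 ^+ (s + 2 * m) * X + Y + z = 0 -> False.
Proof.
move=> b0; have [n] := ubnP s; elim: n => // n IH in s m Y z * => lt sm X3 e1 e2.
have pow3 i : (0 < i)%N -> (3 %| 3 ^+ i)%Z by case: i => // i _; rewrite exprS dvdz_mulr.
have pow9 : (3 %| 9 ^+ b)%Z by rewrite (_ : 9 = 3 ^+ 2) // -exprM pow3 // muln_gt0 b0.
have [s0|s0] := posnP s.
  subst s; apply: (@line_cubic X Y (- z) b m) => //.
    by apply: (addIr (9 ^+ b * z ^+ 3)); rewrite -[X ^+ 3]mul1r -(expr0 3) e1; ring.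
  by apply: (addIr z); move: e2; rewrite add0n exprM -[3 ^+ 2]/(9 : int) => e2; rewrite addNr -e2; ring.
have Y3 : (3 %| Y)%Z.
  rewrite -(dvd3X _ 2) (_ : Y ^+ 3 = - (3 ^+ s * X ^+ 3 + 9 ^+ b * z ^+ 3)).
    by rewrite rpredN rpredD // dvdz_mulr // pow3.
  by apply: (addIr (3 ^+ s * X ^+ 3 + 9 ^+ b * z ^+ 3)); rewrite addNr -e1; ring.
have z3 : (3 %| z)%Z.
  rewrite (_ : z = - (3 ^+ (s + 2 * m) * X + Y)).
    by rewrite rpredN rpredD // dvdz_mulr // pow3 // ltn_addr.
  by apply: (addIr (3 ^+ (s + 2 * m) * X + Y)); rewrite addNr -e2; ring.
have /dvdzP[Y' YE] := Y3; have /dvdzP[z' zE] := z3.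
have e1' : 3 ^+ s * X ^+ 3 = 27 * - (Y' ^+ 3 + 9 ^+ b * z' ^+ 3).
  by apply: (addIr (Y ^+ 3 + 9 ^+ b * z ^+ 3)); rewrite addrA e1 YE zE; ring.
case: s => [|[|[|s]]] // in lt sm e1 e2 e1' s0 *.
- case/negP: X3; rewrite -(dvd3X _ 2).
  rewrite (_ : X ^+ 3 = 3 * (3 * - (Y' ^+ 3 + 9 ^+ b * z' ^+ 3))) ?dvdz_mulr //.
  by apply: (mulfI (x := 3)) => //; rewrite -[X in X * _ = _]expr1 e1'; ring.
- case/negP: X3; rewrite -(dvd3X _ 2).
  rewrite (_ : X ^+ 3 = 3 * - (Y' ^+ 3 + 9 ^+ b * z' ^+ 3)) ?dvdz_mulr //.
  by apply: (mulfI (x := 3 ^+ 2)) => //; rewrite e1'; ring.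
apply: (IH s m.+1 Y' z') => //; first by move: lt; clear; lia.
- by rewrite addnS.
- apply: (mulfI (x := 3 ^+ 3)) => //; rewrite mulr0 -e1 YE zE !exprS; ring.
apply: (mulfI (x := 3)) => //; rewrite mulr0 -e2 YE zE.
rewrite (_ : (s.+3 + 2 * m = (s + 2 * m.+1).+1)%N); last by lia.
by rewrite exprS; ring.
Qed.

Lemma pow3_line_cubic_eq0 (X Y z : int) b s :
    (0 < b)%N -> (0 < s)%N ->
    3 ^+ s * X ^+ 3 + Y ^+ 3 + 9 ^+ b * z ^+ 3 = 0 -> 3 ^+ s * X + Y + z = 0 ->
  [/\ X = 0, Y = 0 & z = 0].
Proof.
move=> b0 s0; have [n] := ubnP `|X|%N; elim: n => // n IH in X Y z * => lt e1 e2.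
have pow3 i : (0 < i)%N -> (3 %| 3 ^+ i)%Z by case: i => // i _; rewrite exprS dvdz_mulr.
have pow9 : (3 %| 9 ^+ b)%Z by rewrite (_ : 9 = 3 ^+ 2) // -exprM pow3 // muln_gt0 b0.
have [X0|X0] := eqVneq X 0.
  have YE : Y = - z by apply: (addIr z); rewrite addNr -e2 X0; ring.
  have : z ^+ 3 * (9 ^+ b - 1) = 0 by rewrite -e1 YE X0; ring.
  move/eqP; rewrite mulf_eq0 expf_eq0 subr_eq0 /= => /orP[/eqP z0|/eqP h].
    by split=> //; rewrite ?YE z0.
  by rewrite h in pow9.
have [X3|X3] := boolP (3 %| X)%Z; last first.
  case: (@pow3_line_cubic X Y z b s 0) => //; first by rewrite addn0.
  by rewrite muln0 addn0.
have Y3 : (3 %| Y)%Z.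
  rewrite -(dvd3X _ 2) (_ : Y ^+ 3 = - (3 ^+ s * X ^+ 3 + 9 ^+ b * z ^+ 3)).
    by rewrite rpredN rpredD // dvdz_mulr // pow3.
  by apply: (addIr (3 ^+ s * X ^+ 3 + 9 ^+ b * z ^+ 3)); rewrite addNr -e1; ring.
have z3 : (3 %| z)%Z.
  rewrite (_ : z = - (3 ^+ s * X + Y)).
    by rewrite rpredN rpredD // dvdz_mulr // pow3.
  by apply: (addIr (3 ^+ s * X + Y)); rewrite addNr -e2; ring.
have /dvdzP[X' XE] := X3; have /dvdzP[Y' YE] := Y3; have /dvdzP[z' zE] := z3.
have [|||X0' Y0' z0'] := IH X' Y' z'.
- by move: lt X0; rewrite XE; clear; lia.
- by apply: (mulfI (x := 3 ^+ 3)) => //; rewrite mulr0 -e1 XE YE zE; ring.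
- by apply: (mulfI (x := 3)) => //; rewrite mulr0 -e2 XE YE zE; ring.
by rewrite XE YE zE X0' Y0' z0'.
Qed.

Theorem weighted_cubic_anisotropic (k1 k2 k3 : nat) (c1 c2 c3 : rat) :
    (k2 < k1)%N -> (k3 < k2)%N ->
    (3 ^ k1)%:R * c1 + (3 ^ k2)%:R * c2 + (3 ^ k3)%:R * c3 = 0 ->
    (3 ^ k1)%:R * c1 ^+ 3 + (3 ^ k2)%:R * c2 ^+ 3 + (3 ^ k3)%:R * c3 ^+ 3 = 0 ->
  [/\ c1 = 0, c2 = 0 & c3 = 0].
Proof.
move=> h12 h23; rewrite !natrX.
pose b := (k2 - k3)%N; pose s := (k1 - k2)%N.
have [b0 s0] : (0 < b)%N /\ (0 < s)%N by rewrite !subn_gt0.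
rewrite (_ : k1 = (k3 + (b + s))%N); last by rewrite /b /s; lia.
rewrite (_ : k2 = (k3 + b)%N); last by rewrite /b; lia.
have [X [Y [Z [N [N0 XE YE ZE]]]]] := rat_common_denom c1 c2 c3 => e1 e2.
have N0' : (N%:~R : rat) != 0 by rewrite intr_eq0.
have p0 : (3 ^+ k3 : rat) != 0 by rewrite expf_neq0.
have i1 : 3 ^+ (b + s) * X + 3 ^+ b * Y + Z = 0.
  apply: (@intr_inj rat); apply: (mulfI p0); rewrite mulr0.
  transitivity ((3 ^+ (k3 + (b + s)) * c1 + 3 ^+ (k3 + b) * c2 + 3 ^+ k3 * c3) * N%:~R).
    by rewrite !(rmorphD, rmorphM, rmorphXn) /= -XE -YE -ZE !exprD; ring.
  by rewrite e1 mul0r.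
have i2 : 3 ^+ (b + s) * X ^+ 3 + 3 ^+ b * Y ^+ 3 + Z ^+ 3 = 0.
  apply: (@intr_inj rat); apply: (mulfI p0); rewrite mulr0.
  transitivity ((3 ^+ (k3 + (b + s)) * c1 ^+ 3 + 3 ^+ (k3 + b) * c2 ^+ 3 + 3 ^+ k3 * c3 ^+ 3)
                * N%:~R ^+ 3).
    by rewrite !(rmorphD, rmorphM, rmorphXn) /= -XE -YE -ZE !exprD; ring.
  by rewrite e2 mul0r.
(* By the linear equation 3^b divides Z; its cube brings 3^(3 b), and division by 3^b leaves the
   coefficient 9^b. *)
pose z := - (3 ^+ s * X + Y).
have Zz : Z = 3 ^+ b * z.
  by apply: (addrI (3 ^+ (b + s) * X + 3 ^+ b * Y)); rewrite i1 exprD /z; ring.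
have pb0 : (3 ^+ b : int) != 0 by rewrite expf_neq0.
have [||X0 Y0 z0] := @pow3_line_cubic_eq0 X Y z b s b0 s0.
- apply: (mulfI pb0); rewrite mulr0 -i2 Zz exprD.
  by rewrite (_ : 9 = 3 ^+ 2) // -exprM mulnC exprM; ring.
- by rewrite /z; ring.
have zero (c : rat) (C : int) : c * N%:~R = C%:~R -> C = 0 -> c = 0.
  by move=> cE C0; apply: (mulIf N0'); rewrite cE C0 mul0r.
by split; [exact: zero XE X0 | exact: zero YE Y0 | apply: zero ZE _; rewrite Zz z0 mulr0].
Qed.

(** * Traces modulo a monic polynomial *)

Section RingDivision.
Import Pdiv.Ring Pdiv.RingMonic.

(* Euler's formula: for a monic [f] of degree [n], the trace of the multiplication by [p] on
   [R[X]/(f)] is the coefficient of [X^(n-1)] in the remainder of [p f'] modulo [f]. *)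
Definition ptrace (R : comNzRingType) (f p : {poly R}) : R :=
  (rmodp (p * f^`()) f)`_(size f).-2.

Lemma coefM_top (R : comNzRingType) (p q : {poly R}) a b :
  (size p <= a.+1)%N -> (size q <= b.+1)%N -> (p * q)`_(a + b) = p`_a * q`_b.
Proof.
move=> sp sq; rewrite coefM (bigD1 (inord a)) //= inordK ?ltnS ?leq_addr //.
rewrite addKn big1 ?addr0 // => i; rewrite -val_eqE /= inordK ?ltnS ?leq_addr // => ia.
have [lt|le] := ltnP i a.
  by rewrite [q`__]nth_default ?mulr0 // (leq_trans sq) //; move: lt; lia.
by rewrite nth_default ?mul0r // (leq_trans sp) //; move: le ia; lia.
Qed.

Section PolyTrace.
Variable R : comNzRingType.
Implicit Types f g p q r : {poly R}.

Lemma ptraceE f p q r : f \is monic -> p * f^`() = q * f + r -> (size r < size f)%N ->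
  ptrace f p = r`_(size f).-2.
Proof. by move=> mf pE sr; rewrite /ptrace pE rmodp_addl_mul_small. Qed.

Lemma ptrace_modP f p : f \is monic ->
  exists q r, [/\ p * f^`() = q * f + r, (size r < size f)%N & ptrace f p = r`_(size f).-2].
Proof.
move=> mf; exists (rdivp (p * f^`()) f), (rmodp (p * f^`()) f).
by rewrite -rdivp_eq // ltn_rmodpN0 // monic_neq0.
Qed.

Lemma ptraceD f p q : f \is monic -> ptrace f (p + q) = ptrace f p + ptrace f q.
Proof. by move=> mf; rewrite /ptrace mulrDl rmodpD // coefD. Qed.

Lemma ptraceZ f c p : f \is monic -> ptrace f (c%:P * p) = c * ptrace f p.
Proof. by move=> mf; rewrite /ptrace -mulrA mul_polyC rmodpZ // coefZ. Qed.

Lemma ptrace_mulf f q : f \is monic -> ptrace f (f * q) = 0.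
Proof. by move=> mf; rewrite /ptrace -mulrA mulrC rmodp_mull // coef0. Qed.

Lemma ptrace0 f : f \is monic -> ptrace f 0 = 0.
Proof. by move=> mf; rewrite -(mulr0 f) ptrace_mulf. Qed.

Lemma ptrace_sum f (I : Type) (s : seq I) (G : I -> {poly R}) : f \is monic ->
  ptrace f (\sum_(i <- s) G i) = \sum_(i <- s) ptrace f (G i).
Proof.
move=> mf; elim: s => [|i s IH]; first by rewrite !big_nil ptrace0.
by rewrite !big_cons ptraceD // IH.
Qed.

(** By the Leibniz rule the remainders r of p f' and s of p g' combine into r g + f s, which is
    already reduced modulo f g. *)
Lemma ptraceM f g p : f \is monic -> g \is monic -> (1 < size f)%N -> (1 < size g)%N ->
  ptrace (f * g) p = ptrace f p + ptrace g p.
Proof.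
move=> mf mg sf sg; have [a [r [pE sr ->]]] := ptrace_modP p mf.
have [b [s [qE ss ->]]] := ptrace_modP p mg.
have sfg : size (f * g) = (size f + size g).-1 by rewrite size_monicM ?monic_neq0.
have srg : (size (r * g + f * s)%R < size (f * g)%R)%N.
  rewrite sfg; apply: leq_ltn_trans (size_polyD _ _) _; rewrite gtn_max.
  by apply/andP; split; apply: leq_ltn_trans (size_polyMleq _ _) _; move: sr ss sf sg; lia.
rewrite (@ptraceE _ _ (a + b) (r * g + f * s)) ?monicMl //; last first.
  transitivity (p * f^`() * g + f * (p * g^`())); first by rewrite derivM; ring.
  by rewrite pE qE; ring.
rewrite coefD sfg.
have -> : (size f + size g).-1.-2 = ((size f).-2 + (size g).-1)%N by move: sf sg; lia.
rewrite coefM_top; [|by move: sr sf; lia..|by move: sg; lia].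
have -> : ((size f).-2 + (size g).-1 = (size f).-1 + (size g).-2)%N by move: sf sg; lia.
rewrite coefM_top; [|by move: sf; lia|by move: ss sg; lia].
have lf : f`_(size f).-1 = 1 by move/monicP: mf.
have lg : g`_(size g).-1 = 1 by move/monicP: mg.
by rewrite lf lg mulr1 mul1r.
Qed.

End PolyTrace.

Lemma ptrace_map (R S : comNzRingType) (h : {rmorphism R -> S}) (f p : {poly R}) :
  f \is monic -> ptrace (map_poly h f) (map_poly h p) = h (ptrace f p).
Proof.
move=> mf; have [a [r [pE sr ->]]] := ptrace_modP p mf.
have sz : size (map_poly h f) = size f.
  by rewrite size_map_poly_id0 // (monicP mf) rmorph1 oner_neq0.
rewrite (@ptraceE _ _ _ (map_poly h a) (map_poly h r)) ?monic_map //.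
- by rewrite sz coef_map.
- by rewrite deriv_map -!rmorphM pE rmorphD.
by rewrite sz (leq_ltn_trans (size_poly _ _)).
Qed.

Section DualBasis.
Variable R : comNzRingType.
Implicit Types f p r : {poly R}.

(** (f(x) - f(y)) / (x - y) is the sum of the y^i times [drop_poly i.+1 f] in x; this is its value
    at y = x. *)
Lemma sum_drop_poly f :
  \sum_(i < (size f).-1) 'X^i * drop_poly i.+1 f = f^`().
Proof.
apply/polyP => k; rewrite coef_deriv coef_sum.
have [lt|le] := ltnP k (size f).-1; last first.
  rewrite nth_default ?mul0rn; last by move: le; case: (size f).
  rewrite big1 // => i _; rewrite coefXnM coef_drop_poly.
  by case: ltnP => // ik; rewrite nth_default // addnS subnK //; move: le; clear; case: (size f).
rewrite (eq_bigr (fun i : 'I_(size f).-1 => if (i <= k)%N then f`_k.+1 else 0)); last first.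
  move=> i _; rewrite coefXnM coef_drop_poly ltnNge; case: leqP => //= ik.
  by congr (_`__); move: ik; lia.
by rewrite -big_mkcond (big_ord_narrow lt) sumr_const card_ord.
Qed.

(* The polynomials [drop_poly i.+1 f] are dual to the powers [X^i]. *)
Lemma dual_power_basis f r i : f \is monic -> (size r < size f)%N -> (i < (size f).-1)%N ->
  (rmodp (r * drop_poly i.+1 f) f)`_(size f).-2 = r`_i.
Proof.
move=> mf sr lti.
have lf : f`_(size f).-1 = 1 by move/monicP: mf.
have mono k : (k < (size f).-1)%N ->
    (rmodp ('X^k * drop_poly i.+1 f) f)`_(size f).-2 = (k == i)%:R.
  move=> ltk; have [ki|ik] := leqP k i.
    have sz : (size ('X^k * drop_poly i.+1 f)%R <= (size f).-1 + k - i)%N.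
      apply: leq_trans (size_polyMleq _ _) _; rewrite size_polyXn size_drop_poly /=.
      by move: lti ki; clear; move: (size f) => s; lia.
    rewrite rmodp_small; last by apply: leq_ltn_trans sz _; move: ki lti; clear; move: (size f) => s; lia.
    have [->|ki'] := eqVneq k i.
      by rewrite coefXnM coef_drop_poly ifN -?leqNgt -?lf; [congr (_`__) |]; move: lti; clear; move: (size f) => s; lia.
    by rewrite nth_default //; apply: leq_trans sz _; move: ki ki' lti; clear; move: (size f) => s; lia.
  have -> : 'X^k * drop_poly i.+1 f = 'X^(k - i.+1) * f - 'X^(k - i.+1) * take_poly i.+1 f.
    transitivity ('X^(k - i.+1) * (take_poly i.+1 f + drop_poly i.+1 f * 'X^(i.+1))
                  - 'X^(k - i.+1) * take_poly i.+1 f); last by rewrite poly_take_drop.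
    by rewrite -{1}(subnK ik) exprD; ring.
  rewrite rmodpD // rmodp_mull // add0r rmodpN // rmodp_small.
    rewrite coefN nth_default ?oppr0 ?gtn_eqF //.
    apply: leq_trans (size_polyMleq _ _) _; rewrite size_polyXn.
    have := size_take_poly i.+1 f; move: ltk ik lti; clear.
    by move: (size (take_poly _ _)) (size f) => s' s; lia.
  apply: leq_ltn_trans (size_polyMleq _ _) _; rewrite size_polyXn.
  have := size_take_poly i.+1 f; move: ltk ik lti; clear.
    by move: (size (take_poly _ _)) (size f) => s' s; lia.
have rE : r = \sum_(k < (size f).-1) r`_k *: 'X^k.
  rewrite -poly_def; apply/polyP => k; rewrite coef_poly; case: ltnP => // le.
  by rewrite nth_default //; move: sr le; clear; move: (size r) (size f) => s' s; lia.
rewrite {1}rE mulr_suml rmodp_sum // coef_sum (bigD1 (Ordinal lti)) //=.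
rewrite -scalerAl rmodpZ // coefZ mono // eqxx mulr1 big1 ?addr0 // => k ki.
by rewrite -scalerAl rmodpZ // coefZ mono // -val_eqE /= in ki *; rewrite (negPf ki) mulr0.
Qed.

Lemma ptrace_sum_coef f p : f \is monic ->
  \sum_(i < (size f).-1) (rmodp (p * 'X^i) f)`_i = ptrace f p.
Proof.
move=> mf; rewrite /ptrace -(sum_drop_poly f) mulr_sumr rmodp_sum // coef_sum.
apply: eq_bigr => i _; rewrite -(dual_power_basis mf _ (ltn_ord i)); last first.
  by rewrite ltn_rmodpN0 // monic_neq0.
by rewrite [_ * drop_poly _ _]mulrC rmodp_mulmr // [drop_poly _ _ * _]mulrC mulrA.
Qed.

End DualBasis.

Lemma fieldTrace_ptrace (F : fieldType) (E : fieldExtType F) (z : E) (f p : {poly F}) :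
    f \is monic -> size f = (\dim {:E}).+1 -> root (map_poly (in_alg E) f) z ->
    <<1; z>>%VS = fullv ->
  fieldTrace (map_poly (in_alg E) p).[z] = ptrace f p.
Proof.
move=> mf sf fz gz; set n := \dim {:E} in sf *.
pose e : n.-tuple E := [tuple z ^+ i | i < n].
have eE i : (i < n)%N -> e`_i = z ^+ i.
  by move=> lti; rewrite -[i]/(val (Ordinal lti)) -tnth_nth tnth_mktuple.
pose ev q := (map_poly (in_alg E) q).[z].
have evmod q : ev q = ev (rmodp q f).
  rewrite /ev {1}(rdivp_eq mf q) rmorphD rmorphM /= hornerD hornerM.
  by move/rootP: fz => ->; rewrite mulr0 add0r.
have evsum (q : {poly F}) : (size q <= n)%N -> ev q = \sum_(i < n) q`_i *: e`_i.
  move=> sq; rewrite /ev (horner_coef_wide (n := n)).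
    by apply: eq_bigr => i _; rewrite eE // coef_map /= mulr_algl.
  by rewrite (leq_trans (size_poly _ _)).
have smod q : (size (rmodp q f) <= n)%N by rewrite -ltnS -sf ltn_rmodpN0 // monic_neq0.
have eB : basis_of {:E} e.
  rewrite basisEdim size_tuple leqnn andbT; apply/subvP => a _.
  have : a \in <<1; z>>%VS by rewrite gz memvf.
  move/Fadjoin_polyP => [q /polyOver1P[q' ->] ->].
  rewrite -[(map_poly _ _).[z]]/(ev q') evmod evsum //.
  by rewrite memv_suml // => i _; rewrite memvZ // memv_span // mem_nth // size_tuple.
rewrite (fieldTraceE _ eB) -ptrace_sum_coef // sf /=.
apply: eq_bigr => i _; rewrite !mxE /=.
rewrite passmx.vecof_delta.
rewrite lfunE /= eE //.
have -> : z ^+ i * (map_poly (in_alg E) p).[z] = ev (p * 'X^i).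
  by rewrite /ev rmorphM /= map_polyXn hornerM hornerXn mulrC.
by rewrite evmod evsum // coord_sum_free // (basis_free eB).
Qed.

End RingDivision.

(** * The substitution x^3 - t *)

Section CubicSubstitution.
Variables (R : comNzRingType) (t : R).
Implicit Types f p r : {poly R}.
Let phi : {poly R} := 'X^3 - t%:P.

Let size_phi : size phi = 4%N.
Proof. by rewrite /phi size_XnsubC. Qed.

Let phi3 : phi`_3 = 1.
Proof. by rewrite coefB coefXn coefC subr0. Qed.

Lemma size_comp_cubic r m : (size r <= m.+1)%N -> (size (r \Po phi) <= (3 * m).+1)%N.
Proof.
move=> sr; apply: leq_trans (size_comp_poly_leq _ _) _; rewrite size_phi.
by rewrite ltnS mulnC leq_mul2l /=; case: (size r) sr.
Qed.

Lemma coef_comp_cubic r m : (size r <= m.+1)%N -> (r \Po phi)`_(3 * m) = r`_m.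
Proof.
elim: m r => [|m IH] r sr.
  by rewrite (size1_polyC sr) comp_polyC.
rewrite -{1}(poly_take_drop 1 r) expr1 comp_polyD comp_polyM comp_polyX coefD.
rewrite (size1_polyC (size_take_poly 1 r)) comp_polyC coefC mulnS /= add0r addnC.
rewrite coefM_top ?size_phi //; last first.
  by apply: size_comp_cubic; rewrite size_drop_poly leq_subLR add1n.
by rewrite IH ?size_drop_poly ?leq_subLR ?add1n // phi3 mulr1 coef_drop_poly addn1.
Qed.

Lemma monic_comp_cubic f : f \is monic -> f \Po phi \is monic.
Proof.
move=> mf; have f0 := monic_neq0 mf.
have sf : (0 < size f)%N by rewrite size_poly_gt0.
have le : (size f <= (size f).-1.+1)%N by rewrite prednK.
have c1 : (f \Po phi)`_(3 * (size f).-1) = 1 by rewrite coef_comp_cubic // -lead_coefE (monicP mf).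
have s1 : size (f \Po phi) = (3 * (size f).-1).+1.
  apply/eqP; rewrite eqn_leq size_comp_cubic //=.
  by rewrite ltnNge; apply/negP => h; have := oner_neq0 R; rewrite -c1 nth_default ?eqxx.
by rewrite monicE lead_coefE s1 /= c1.
Qed.

Lemma size_comp_cubic_monic f : f \is monic -> size (f \Po phi) = (3 * (size f).-1).+1.
Proof.
move=> mf; have f0 := monic_neq0 mf.
have sf : (0 < size f)%N by rewrite size_poly_gt0.
have le : (size f <= (size f).-1.+1)%N by rewrite prednK.
have c1 : (f \Po phi)`_(3 * (size f).-1) = 1 by rewrite coef_comp_cubic // -lead_coefE (monicP mf).
apply/eqP; rewrite eqn_leq size_comp_cubic //=.
by rewrite ltnNge; apply/negP => h; have := oner_neq0 R; rewrite -c1 nth_default ?eqxx.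
Qed.

Variables (f : {poly R}).
Hypotheses (mf : f \is monic) (sf : (1 < size f)%N).

Let deriv_comp_cubic : (f \Po phi)^`() = 3%:R *: ((f^`() \Po phi) * 'X^2).
Proof.
rewrite deriv_comp /phi derivB derivC subr0 derivXn /= -scaler_nat.
by rewrite -scalerAr.
Qed.

(** By the chain rule (f o phi)' = 3 x^2 (f' o phi), so the division of p f' by f, composed with phi
    and multiplied by 3 x^2, is the division sought. *)
Lemma ptrace_comp_cubic p : ptrace (f \Po phi) (p \Po phi) = 3%:R * ptrace f p.
Proof.
have [q [r [pE sr ->]]] := ptrace_modP p mf.
have sr' : (size r <= (size f).-2.+1)%N by move: sr sf; lia.
rewrite (@ptraceE _ _ _ (3%:R *: ((q \Po phi) * 'X^2)) (3%:R *: ((r \Po phi) * 'X^2))).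
- rewrite coefZ size_comp_cubic_monic // coefMXn ifN; last by rewrite -leqNgt; move: sf; lia.
  by rewrite -(coef_comp_cubic sr'); congr (_ * _`__); move: sf; lia.
- exact: monic_comp_cubic.
- rewrite deriv_comp_cubic -scalerAr mulrA -comp_polyM pE comp_polyD comp_polyM.
  by rewrite mulrDl scalerDr -!scalerAl; congr (_ + _); rewrite mulrAC.
rewrite size_comp_cubic_monic // ltnS; apply: leq_trans (size_scale_leq _ _) _.
apply: leq_trans (size_polyMleq _ _) _; rewrite size_polyXn.
by have := size_comp_cubic sr'; move: sf; lia.
Qed.

(** x^j x^2 = x^3 x^(j-1), and x^3 = (X + t) o phi moves under the composition. The factor left,
    x^(j-1) instead of x^2, keeps the remainder below the top degree. *)
Let ptrace_comp_cubicM j p : (0 < j < 3)%N -> ptrace (f \Po phi) ((p \Po phi) * 'X^j) = 0.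
Proof.
move=> /andP[j0 j3]; have [q [r [pE sr _]]] := ptrace_modP (('X + t%:P) * p) mf.
have sr' : (size r <= (size f).-2.+1)%N by move: sr sf; lia.
rewrite (@ptraceE _ _ _ (3%:R *: ((q \Po phi) * 'X^(j.-1))) (3%:R *: ((r \Po phi) * 'X^(j.-1)))).
- rewrite coefZ nth_default ?mulr0 // size_comp_cubic_monic //.
  apply: leq_trans (size_polyMleq _ _) _; rewrite size_polyXn.
  by have := size_comp_cubic sr'; move: sf j3; lia.
- exact: monic_comp_cubic.
- have Xphi : 'X^3 = ('X + t%:P) \Po phi by rewrite comp_polyD comp_polyX comp_polyC subrK.
  rewrite deriv_comp_cubic -scalerAr.
  transitivity (3%:R *: (('X^3 * (p \Po phi) * (f^`() \Po phi)) * 'X^(j.-1))).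
    congr (_ *: _); rewrite -{1}(prednK j0) exprS; ring.
  rewrite Xphi -!comp_polyM pE comp_polyD comp_polyM mulrDl scalerDr -!scalerAl.
  by congr (_ + _); rewrite mulrAC.
rewrite size_comp_cubic_monic // ltnS; apply: leq_trans (size_scale_leq _ _) _.
apply: leq_trans (size_polyMleq _ _) _; rewrite size_polyXn.
by have := size_comp_cubic sr'; move: sf j3; lia.
Qed.

(* [x^(3 d + e) = x^e (u + t)^d] where [u = x^3 - t]. *)
Lemma ptrace_comp_cubicMXn p i : ptrace (f \Po phi) ((p \Po phi) * 'X^i)
  = if (3 %| i)%N then 3%:R * ptrace f (p * ('X + t%:P) ^+ (i %/ 3)) else 0.
Proof.
have Xphi : 'X^3 = ('X + t%:P) \Po phi by rewrite comp_polyD comp_polyX comp_polyC subrK.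
have XiE : (p \Po phi) * 'X^i = ((p * ('X + t%:P) ^+ (i %/ 3)) \Po phi) * 'X^(i %% 3).
  rewrite {1}(divn_eq i 3) exprD mulnC exprM Xphi comp_polyM mulrA; congr (_ * _ * _).
  by rewrite -rmorphXn.
rewrite XiE; case: ifP => [/eqP -> | i3]; first by rewrite mulr1 ptrace_comp_cubic.
by rewrite ptrace_comp_cubicM // ltn_mod andbT lt0n; apply/negbT.
Qed.

End CubicSubstitution.

Section TwoVariables.
Variable k : fieldType.
Implicit Types (f c : {poly k}) (b g h : {poly {poly k}}).

Let phi : {poly {poly k}} := 'X^3 - 'X%:P.

Definition cubic_subst : {poly k} -> {poly {poly k}} := comp_poly phi \o map_poly polyC.
HB.instance Definition _ := GRing.RMorphism.on cubic_subst.

(* The substitution [t := x^3 - t] in [k[t][x]]; it is an involution. *)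
Definition cubic_flip : {poly {poly k}} -> {poly {poly k}} :=
  horner_eval 'X \o map_poly cubic_subst.
HB.instance Definition _ := GRing.RMorphism.on cubic_flip.

Lemma cubic_substE c : cubic_subst c = map_poly polyC c \Po ('X^3 - 'X%:P).
Proof. by []. Qed.

Lemma cubic_flipC c : cubic_flip c%:P = cubic_subst c.
Proof. by rewrite /cubic_flip /= map_polyC /horner_eval hornerC. Qed.

Lemma cubic_flipX : cubic_flip 'X = 'X.
Proof. by rewrite /cubic_flip /= map_polyX /horner_eval hornerX. Qed.

Lemma cubic_flip_subst c : cubic_flip (cubic_subst c) = c%:P.
Proof.
elim/poly_ind: c => [|c a IH]; first by rewrite !rmorph0.
have aE : cubic_subst a%:P = a%:P%:P by rewrite cubic_substE map_polyC comp_polyC.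
have XE : cubic_subst 'X = 'X^3 - 'X%:P by rewrite cubic_substE map_polyX comp_polyX.
have substD : {morph cubic_subst : p q / p + q} := rmorphD _.
have substM : {morph cubic_subst : p q / p * q} := rmorphM _.
have flipD : {morph cubic_flip : p q / p + q} := rmorphD _.
have flipN : {morph cubic_flip : p / - p} := rmorphN _.
have flipM : {morph cubic_flip : p q / p * q} := rmorphM _.
rewrite substD substM aE XE flipD flipM IH cubic_flipC aE flipD flipN.
rewrite !exprS expr0 mulr1 !flipM cubic_flipX cubic_flipC XE.
by rewrite polyCD polyCM; congr (_ * _ + _); ring.
Qed.

(** This automorphism identifies k[t][x] modulo f(x^3 - t) with the polynomials in x over k[u]/(f),
    where u = x^3 - t, so that coefficients can be reduced modulo f. *)
Lemma cubic_flipK : involutive cubic_flip.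
Proof.
move=> b; elim/poly_ind: b => [|b c IH]; first by rewrite !rmorph0.
have flipD : {morph cubic_flip : p q / p + q} := rmorphD _.
have flipM : {morph cubic_flip : p q / p * q} := rmorphM _.
by rewrite !(flipD, flipM) IH !(cubic_flipX, cubic_flipC) cubic_flip_subst.
Qed.

Lemma cubic_flip_sum b : cubic_flip b = \sum_(i < size b) cubic_subst b`_i * 'X^i.
Proof.
rewrite /cubic_flip /= /horner_eval (horner_coef_wide (n := size b)).
  by apply: eq_bigr => i _; rewrite coef_map.
exact: size_poly.
Qed.

Lemma coef_ptrace_map_polyC f g d : f \is monic ->
  (ptrace (map_poly polyC f) g)`_d = ptrace f (swapXY g)`_d.
Proof.
move=> mf; rewrite -{1}(swapXYK g); move: (swapXY g) => h.
rewrite -{1}[h]coefK poly_def rmorph_sum /= ptrace_sum ?monic_map // coef_sum.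
have term i : ptrace (map_poly polyC f) (swapXY (h`_i *: 'X^i)) = (ptrace f h`_i) *: 'X^i.
  rewrite -mul_polyC rmorphM rmorphXn /= swapXY_X swapXY_polyC -rmorphXn mulrC.
  by rewrite ptraceZ ?monic_map // ptrace_map // mulrC mul_polyC.
rewrite (eq_bigr (fun i : 'I_(size h) => (ptrace f h`_i *: 'X^i)`_d)); last by move=> i _; rewrite term.
have [lt|le] := ltnP d (size h).
  rewrite (bigD1 (Ordinal lt)) //= coefZ coefXn eqxx mulr1 big1 ?addr0 // => i id.
  by rewrite coefZ coefXn eq_sym -val_eqE /= in id *; rewrite (negPf id) mulr0.
rewrite [h`_d]nth_default // ptrace0 // big1 // => i _.
by rewrite coefZ coefXn gtn_eqF ?mulr0 // (leq_trans (ltn_ord i)).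
Qed.

(** Since x^3 = u + t, only the x^i with 3 | i contribute, and x^(3 j) = (u + t)^j reaches t^d only
    for j >= d. The bound on b leaves j = d. *)
Lemma coef_ptrace_cubic_flip f b d : f \is monic -> (1 < size f)%N ->
    (size b <= (3 * d).+3)%N ->
  (ptrace (cubic_subst f) (cubic_flip b))`_d = 3%:R * ptrace f b`_(3 * d).
Proof.
move=> mf sf sb; have mf' : map_poly polyC f \is monic by rewrite monic_map.
have sf' : (1 < size (map_poly polyC f))%N by rewrite size_map_polyC.
rewrite cubic_flip_sum ptrace_sum; last exact: monic_comp_cubic.
have term i : (ptrace (cubic_subst f) (cubic_subst b`_i * 'X^i))`_d
    = if (3 %| i)%N then 3%:R * ptrace f (b`_i * (('X + 'X%:P) ^+ (i %/ 3))`_d) else 0.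
  rewrite !cubic_substE (ptrace_comp_cubicMXn 'X mf' sf'); case: ifP => _; last by rewrite coef0.
  rewrite !mulr_natl coefMn coef_ptrace_map_polyC // rmorphM rmorphXn rmorphD /=.
  by rewrite swapXY_X swapXY_Y swapXY_map_polyC coefCM [_ + 'X]addrC.
rewrite coef_sum (eq_bigr _ (fun i _ => term (val i))) /=.
have XE : 'X + 'X%:P = 'X - (- 'X)%:P :> {poly {poly k}} by rewrite polyCN opprK.
have small i : (i %/ 3 < d)%N ->
    3%:R * ptrace f (b`_i * (('X + 'X%:P : {poly {poly k}}) ^+ (i %/ 3))`_d) = 0.
  move=> h; have -> : (('X + 'X%:P : {poly {poly k}}) ^+ (i %/ 3))`_d = 0.
    by rewrite nth_default // XE size_exp_XsubC.
  by rewrite mulr0 ptrace0 // mulr0.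
have [lt|le] := ltnP (3 * d) (size b); last first.
  rewrite [b`_(3 * d)]nth_default // ptrace0 // mulr0 big1 // => i _; case: ifP => // i3.
  by apply: small; rewrite ltn_divLR // mulnC (leq_trans (ltn_ord i)).
rewrite (bigD1 (Ordinal lt)) //= dvdn_mulr // mulKn // big1 => [|i id].
  have -> : (('X + 'X%:P) ^+ d : {poly {poly k}})`_d = 1.
    have := monic_exp d (monicXsubC (- 'X : {poly k})).
    by rewrite -XE monicE lead_coefE XE size_exp_XsubC -XE => /eqP.
  by rewrite mulr1 addr0.
case: ifP => // i3; apply: small; case: i id i3 => j lj /=.
rewrite -val_eqE /=; move: lj sb; clear; move: (size b) => s; lia.
Qed.

End TwoVariables.

(** * Clearing denominators and ascent of anisotropy from k to k(t) *)

Lemma fraction_denom (R : idomainType) (x : {fraction R}) :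
  exists n d : R, d != 0 /\ FracField.tofrac d * x = FracField.tofrac n.
Proof.
elim/quotW: x => y; have dy := denom_ratioP y.
exists (\n_y), (\d_y); split=> //; unlock FracField.tofrac.
rewrite -[LHS]FracField.pi_mul /FracField.mulf !numden_Ratio ?oner_neq0 //.
apply/eqmodP/eqP; rewrite !numden_Ratio ?oner_neq0 ?mulf_neq0 ?oner_neq0 //.
by rewrite !mulr1 mul1r mulrC.
Qed.

Lemma poly_fraction_denom (R : idomainType) (G : {poly {fraction R}}) :
  exists (d : R) (g : {poly R}),
    d != 0 /\ (FracField.tofrac d)%:P * G = map_poly (@FracField.tofrac R) g.
Proof.
elim/poly_ind: G => [|G c [d [g [d0 gE]]]].
  by exists 1, 0; rewrite oner_eq0 rmorph0 mulr0.
have [n [e [e0 nE]]] := fraction_denom c.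
exists (d * e), (e%:P * g * 'X + (d * n)%:P); split; first by rewrite mulf_neq0.
have mapD : {morph map_poly (@FracField.tofrac R) : p q / p + q} := rmorphD _.
have mapM : {morph map_poly (@FracField.tofrac R) : p q / p * q} := rmorphM _.
have toM : {morph @FracField.tofrac R : p q / p * q} := rmorphM _.
rewrite mapD !mapM !map_polyC map_polyX /= -gE !toM -nE !polyCM.
by ring.
Qed.

Lemma coefX3_top (R : comNzRingType) (p : {poly R}) a :
  (size p <= a.+1)%N -> (p ^+ 3)`_(3 * a) = p`_a ^+ 3.
Proof.
move=> sp; have sp2 : (size (p * p)%R <= (a + a).+1)%N.
  by apply: leq_trans (size_polyMleq _ _) _; move: sp; move: (size p) => s; lia.
rewrite (_ : p ^+ 3 = p * p * p); last by ring.
rewrite (_ : (3 * a = a + a + a)%N); last by lia.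
by rewrite coefM_top // coefM_top // !exprS expr0; ring.
Qed.

Lemma size_exp3_leq (R : comNzRingType) (p : {poly R}) a :
  (size p <= a.+1)%N -> (size (p ^+ 3)%R <= (3 * a).+1)%N.
Proof.
by move=> sp; apply: leq_trans (size_poly_exp_leq _ _) _; move: (size p) sp => s; lia.
Qed.

Lemma size_leq_coef0 (R : nzRingType) (p : {poly R}) a :
  (size p <= a.+1)%N -> p`_a = 0 -> (size p <= a)%N.
Proof.
move=> sp pa; apply/leq_sizeP => j; rewrite leq_eqVlt => /orP[/eqP<- //|aj].
by rewrite nth_default // (leq_trans sp).
Qed.

Section Anisotropic.
Variable k : fieldType.
Implicit Types f g c : {poly k}.

Definition cube_aniso f := forall g, ptrace f (g ^+ 3) = 0 -> f %| g.

Definition triple_aniso f1 f2 f3 (w1 w2 w3 : nat) := forall g1 g2 g3,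
  w1%:R * ptrace f1 g1 + w2%:R * ptrace f2 g2 + w3%:R * ptrace f3 g3 = 0 ->
  w1%:R * ptrace f1 (g1 ^+ 3) + w2%:R * ptrace f2 (g2 ^+ 3) + w3%:R * ptrace f3 (g3 ^+ 3) = 0 ->
  [/\ f1 %| g1, f2 %| g2 & f3 %| g3].

(** For such a polynomial a top coefficient shown to be divisible by f is zero, so the size
    drops. *)
Definition coef_reduced f (h : {poly {poly k}}) := forall i, f %| h`_i -> h`_i = 0.

Lemma coef_reduction f (h : {poly {poly k}}) : f \is monic ->
  exists u r, h = f%:P * u + r /\ coef_reduced f r.
Proof.
move=> mf; exists (map_poly (fun c => c %/ f) h), (map_poly (fun c => c %% f) h); split.
  apply/polyP => i; rewrite coefD coefCM !coef_map_id0 ?div0p ?mod0p // mulrC.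
  exact: divp_eq.
move=> i; rewrite coef_map_id0 ?mod0p // => /modp_eq0P.
by rewrite modp_small // ltn_modp monic_neq0.
Qed.

End Anisotropic.

Lemma ptrace_mod_l (R : comNzRingType) (f u r : {poly R}) : f \is monic ->
  ptrace f (f * u + r) = ptrace f r.
Proof. by move=> mf; rewrite ptraceD // ptrace_mulf // add0r. Qed.

Lemma ptrace_mod_cube (R : comNzRingType) (f u r : {poly R}) : f \is monic ->
  ptrace f ((f * u + r) ^+ 3) = ptrace f (r ^+ 3).
Proof.
move=> mf.
transitivity (ptrace f (f * (f ^+ 2 * u ^+ 3 + 3%:R * f * u ^+ 2 * r + 3%:R * u * r ^+ 2) + r ^+ 3)).
  by congr (ptrace _ _); ring.
exact: ptrace_mod_l.
Qed.

Section Descent.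
Variable k : fieldType.
Hypothesis char0 : [pchar k] =i pred0.
Implicit Types f : {poly k}.

Lemma natr_cancel (n : nat) (x : k) : (0 < n)%N -> n%:R * x = 0 -> x = 0.
Proof.
move=> n0 /eqP; rewrite mulf_eq0 => /orP[|/eqP //].
by have /pcharf0P -> := char0; rewrite eqn0Ngt n0.
Qed.

Lemma cube_aniso_flip f b : f \is monic -> (1 < size f)%N -> cube_aniso f -> coef_reduced f b ->
  ptrace (cubic_subst f) (cubic_flip b ^+ 3) = 0 -> b = 0.
Proof.
move=> mf sf af rb e.
suff H n : (size b <= n)%N -> (size b <= 0)%N by apply/eqP; rewrite -size_poly_leq0 (H (size b)).
elim: n => // n IH sb; apply: IH; apply: size_leq_coef0 => //; apply: rb; apply: af.
apply: (natr_cancel (n := 3)) => //; rewrite -coefX3_top // -coef_ptrace_cubic_flip //.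
  by rewrite rmorphXn e coef0.
by apply: leq_trans (size_exp3_leq sb) _; clear; lia.
Qed.

Lemma cube_aniso_swap f h : f \is monic -> cube_aniso f -> coef_reduced f h ->
  ptrace (map_poly polyC f) (swapXY h ^+ 3) = 0 -> h = 0.
Proof.
move=> mf af rh e.
suff H n : (size h <= n)%N -> (size h <= 0)%N by apply/eqP; rewrite -size_poly_leq0 (H (size h)).
elim: n => // n IH sh; apply: IH; apply: size_leq_coef0 => //; apply: rh; apply: af.
rewrite -coefX3_top // -[h ^+ 3]swapXYK -coef_ptrace_map_polyC // rmorphXn /= e.
by rewrite coef0.
Qed.

Lemma coef_natr_mul (n d : nat) (p : {poly k}) : (n%:R * p)`_d = n%:R * p`_d.
Proof. by rewrite !mulr_natl coefMn. Qed.

(** As t has the weight of x^3, size n for b goes with size (n + 2) %/ 3, the ceiling of n / 3, for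
    h2 and h3. At t^n the cubic equation sees only b unless 3 | n; for n = 3 d it is paired with the
    linear equation at t^d, and the trace of x^3 - t turns w1 into 3 w1. *)
Lemma triple_aniso_flip f1 f2 f3 (w1 w2 w3 : nat) b h2 h3 :
    f1 \is monic -> f2 \is monic -> f3 \is monic -> (1 < size f1)%N -> (0 < w1)%N ->
    cube_aniso f1 -> triple_aniso f1 f2 f3 (3 * w1) w2 w3 ->
    coef_reduced f1 b -> coef_reduced f2 h2 -> coef_reduced f3 h3 ->
    w1%:R * ptrace (cubic_subst f1) (cubic_flip b)
      + w2%:R * ptrace (map_poly polyC f2) (swapXY h2)
      + w3%:R * ptrace (map_poly polyC f3) (swapXY h3) = 0 ->
    w1%:R * ptrace (cubic_subst f1) (cubic_flip b ^+ 3)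
      + w2%:R * ptrace (map_poly polyC f2) (swapXY h2 ^+ 3)
      + w3%:R * ptrace (map_poly polyC f3) (swapXY h3 ^+ 3) = 0 ->
  [/\ b = 0, h2 = 0 & h3 = 0].
Proof.
move=> m1 m2 m3 s1 w10 a1 aniso r1 r2 r3 e1 e2.
suff H n : (size b <= n)%N -> (size h2 <= (n + 2) %/ 3)%N -> (size h3 <= (n + 2) %/ 3)%N ->
    [/\ size b <= 0, size h2 <= 0 & size h3 <= 0]%N.
  have [|||] := H (size b + 3 * size h2 + 3 * size h3)%N.
  - by rewrite -addnA leq_addr.
  - by rewrite leq_divRL //; move: (size _) (size _) (size _) => *; lia.
  - by rewrite leq_divRL //; move: (size _) (size _) (size _) => *; lia.
  by rewrite !size_poly_leq0 => /eqP -> /eqP -> /eqP ->.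
elim: n => // n IH sb sh2 sh3.
have sb3 : (size (b ^+ 3)%R <= (3 * n).+3)%N by apply: leq_trans (size_exp3_leq sb) _; clear; lia.
have E2 := congr1 (fun p : {poly k} => p`_n) e2.
rewrite /= !coefD !coef_natr_mul coef0 -!rmorphXn /= coef_ptrace_cubic_flip // in E2.
rewrite !coef_ptrace_map_polyC // !swapXYK coefX3_top // mulrA -natrM mulnC in E2.
have [n3|n3] := boolP (3 %| n)%N; last first.
  have szh (h : {poly {poly k}}) : (size h <= (n.+1 + 2) %/ 3)%N ->
      (size h <= (n + 2) %/ 3)%N /\ (h ^+ 3)`_n = 0.
    move=> sh; have sh' : (size h <= (n %/ 3).+1)%N by move: sh n3; clear; move: (size h) => s; lia.
    split; first by move: sh n3; clear; move: (size h) => s; lia.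
    rewrite nth_default //; apply: leq_trans (size_exp3_leq sh') _.
    by move: n3; clear; lia.
  have [sh2' h20] := szh h2 sh2; have [sh3' h30] := szh h3 sh3.
  rewrite h20 h30 !ptrace0 // !mulr0 !addr0 in E2.
  apply: IH => //; apply: size_leq_coef0 => //; apply: r1; apply: a1.
  by apply: natr_cancel E2; rewrite muln_gt0.
have /dvdnP[d nE] := n3; rewrite mulnC in nE.
have dE : ((n.+1 + 2) %/ 3 = d.+1)%N by rewrite nE; lia.
have dE' : ((n + 2) %/ 3 = d)%N by rewrite nE; lia.
rewrite dE in sh2 sh3; rewrite dE' in IH; rewrite !nE !coefX3_top // in E2.
have E1 := congr1 (fun p : {poly k} => p`_d) e1.
rewrite /= !coefD !coef_natr_mul coef0 coef_ptrace_cubic_flip // in E1; last first.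
  by apply: leq_trans sb _; rewrite nE; lia.
rewrite !coef_ptrace_map_polyC // !swapXYK mulrA -natrM mulnC in E1.
have [d1 d2 d3] := aniso _ _ _ E1 E2.
by apply: IH; apply: size_leq_coef0 => //; [rewrite nE; apply: r1 | apply: r2 | apply: r3].
Qed.

End Descent.

Notation map_frac := (map_poly (@FracField.tofrac _)).

Lemma poly_fraction_common_denom (R : idomainType) (G1 G2 G3 : {poly {fraction R}}) :
  exists (d : R) (g1 g2 g3 : {poly R}), d != 0 /\
    [/\ (FracField.tofrac d)%:P * G1 = map_frac g1, (FracField.tofrac d)%:P * G2 = map_frac g2
      & (FracField.tofrac d)%:P * G3 = map_frac g3].
Proof.
have [d1 [g1 [n1 e1]]] := poly_fraction_denom G1.
have [d2 [g2 [n2 e2]]] := poly_fraction_denom G2.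
have [d3 [g3 [n3 e3]]] := poly_fraction_denom G3.
exists (d1 * d2 * d3), ((d2 * d3)%:P * g1), ((d1 * d3)%:P * g2), ((d1 * d2)%:P * g3).
split; first by rewrite !mulf_neq0.
have mapM : {morph (map_poly (@FracField.tofrac R)) : p q / p * q} := rmorphM _.
have toM : {morph (@FracField.tofrac R) : p q / p * q} := rmorphM _.
by split; rewrite mapM map_polyC /= -?e1 -?e2 -?e3 !toM !polyCM; ring.
Qed.

Lemma dvdp_mulC_frac (R : idomainType) (d : R) (F G : {poly {fraction R}}) :
  d != 0 -> (F %| (FracField.tofrac d)%:P * G) = (F %| G).
Proof. by move=> d0; rewrite mul_polyC dvdpZr // tofrac_eq0. Qed.

Section Fractions.
Variables (R : idomainType) (f : {poly R}) (d : R) (g : {poly R}) (G : {poly {fraction R}}).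
Hypothesis mf : f \is monic.
Hypothesis gE : (FracField.tofrac d)%:P * G = map_frac g.

Lemma ptrace_denom :
  FracField.tofrac (ptrace f g) = FracField.tofrac d * ptrace (map_frac f) G.
Proof. by rewrite -ptrace_map // -gE ptraceZ // monic_map. Qed.

Lemma ptrace_denom_cube :
  FracField.tofrac (ptrace f (g ^+ 3)) = FracField.tofrac d ^+ 3 * ptrace (map_frac f) (G ^+ 3).
Proof.
have mapX : {morph map_frac : p / p ^+ 3} := rmorphXn _ 3.
rewrite -ptrace_map // mapX -gE -ptraceZ ?monic_map //; congr (ptrace _ _).
by rewrite polyC_exp exprMn.
Qed.

End Fractions.

Lemma flip_reduction (k : fieldType) (f : {poly k}) (g : {poly {poly k}}) : f \is monic ->
  exists u r, g = cubic_subst f * u + cubic_flip r /\ coef_reduced f r.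
Proof.
move=> mf; have [u [r [e rr]]] := coef_reduction (cubic_flip g) mf.
exists (cubic_flip u), r; split=> //.
by rewrite -[LHS]cubic_flipK e rmorphD rmorphM /= cubic_flipC.
Qed.

Lemma swap_reduction (k : fieldType) (f : {poly k}) (g : {poly {poly k}}) : f \is monic ->
  exists u r, g = map_poly polyC f * u + swapXY r /\ coef_reduced f r.
Proof.
move=> mf; have [u [r [e rr]]] := coef_reduction (swapXY g) mf.
exists (swapXY u), r; split=> //.
by rewrite -[LHS]swapXYK e rmorphD rmorphM /= swapXY_polyC.
Qed.

Section Step.
Variable k : fieldType.
Hypothesis char0 : [pchar k] =i pred0.
Local Notation K := {fraction {poly k}}.
Implicit Types f : {poly k}.

Definition cubic_ext f : {poly K} := map_frac (cubic_subst f).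
Definition const_ext f : {poly K} := map_frac (map_poly polyC f).

Lemma pchar_fraction : [pchar K] =i pred0.
Proof.
move=> p; rewrite -(char0 p) -(fmorph_pchar ((@FracField.tofrac {poly k}) \o polyC)).
by [].
Qed.

Lemma monic_cubic_subst f : f \is monic -> cubic_subst f \is monic.
Proof. by move=> mf; rewrite cubic_substE monic_comp_cubic // monic_map. Qed.

Lemma monic_cubic_ext f : f \is monic -> cubic_ext f \is monic.
Proof. by move=> mf; rewrite monic_map // monic_cubic_subst. Qed.

Lemma monic_const_ext f : f \is monic -> const_ext f \is monic.
Proof. by move=> mf; rewrite !monic_map. Qed.

Lemma size_map_frac (R : idomainType) (p : {poly R}) : size (map_frac p) = size p.
Proof. by apply: size_map_inj_poly; rewrite ?rmorph0 // => x y /eqP; rewrite tofrac_eq => /eqP. Qed.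

Lemma size_const_ext f : size (const_ext f) = size f.
Proof. by rewrite size_map_frac size_map_polyC. Qed.

Lemma size_cubic_ext f : f \is monic -> size (cubic_ext f) = (3 * (size f).-1).+1.
Proof.
move=> mf; rewrite size_map_frac cubic_substE size_comp_cubic_monic ?monic_map //.
by rewrite size_map_polyC.
Qed.

Lemma cube_aniso_const f : f \is monic -> cube_aniso f -> cube_aniso (const_ext f).
Proof.
move=> mf af G e; have [d [g [d0 gE]]] := poly_fraction_denom G.
have [u [r [gur rr]]] := swap_reduction g mf.
have mF : map_poly polyC f \is monic by rewrite monic_map.
have := ptrace_denom_cube mF gE; rewrite e mulr0 => /eqP.
rewrite tofrac_eq0 gur ptrace_mod_cube // => /eqP e'.
have r0 := cube_aniso_swap mf af rr e'.
rewrite -(dvdp_mulC_frac _ _ d0) gE gur r0 rmorph0 addr0 rmorphM /=.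
exact: dvdp_mulr.
Qed.

Lemma cube_aniso_cubic f : f \is monic -> (1 < size f)%N -> cube_aniso f -> cube_aniso (cubic_ext f).
Proof.
move=> mf sf af G e; have [d [g [d0 gE]]] := poly_fraction_denom G.
have [u [r [gur rr]]] := flip_reduction g mf.
have mF := monic_cubic_subst mf.
have := ptrace_denom_cube mF gE; rewrite e mulr0 => /eqP.
rewrite tofrac_eq0 gur ptrace_mod_cube // => /eqP e'.
have r0 := cube_aniso_flip char0 mf sf af rr e'.
rewrite -(dvdp_mulC_frac _ _ d0) gE gur r0 rmorph0 addr0 rmorphM /=.
exact: dvdp_mulr.
Qed.

Lemma triple_aniso_ext f1 f2 f3 (w1 w2 w3 : nat) :
    f1 \is monic -> f2 \is monic -> f3 \is monic -> (1 < size f1)%N -> (0 < w1)%N ->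
    cube_aniso f1 -> triple_aniso f1 f2 f3 (3 * w1) w2 w3 ->
  triple_aniso (cubic_ext f1) (const_ext f2) (const_ext f3) w1 w2 w3.
Proof.
move=> m1 m2 m3 s1 w10 a1 aniso G1 G2 G3 e1 e2.
have [d [g1 [g2 [g3 [d0 [gE1 gE2 gE3]]]]]] := poly_fraction_common_denom G1 G2 G3.
have [u1 [r1 [gu1 rr1]]] := flip_reduction g1 m1.
have [u2 [r2 [gu2 rr2]]] := swap_reduction g2 m2.
have [u3 [r3 [gu3 rr3]]] := swap_reduction g3 m3.
have M1 := monic_cubic_subst m1.
have M2 : map_poly polyC f2 \is monic by rewrite monic_map.
have M3 : map_poly polyC f3 \is monic by rewrite monic_map.
have toD : {morph (@FracField.tofrac {poly k}) : p q / p + q} := rmorphD _.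
have toM : {morph (@FracField.tofrac {poly k}) : p q / p * q} := rmorphM _.
have toN n : FracField.tofrac (n%:R : {poly k}) = n%:R by rewrite rmorph_nat.
have /eqP E1 : FracField.tofrac (w1%:R * ptrace (cubic_subst f1) g1
    + w2%:R * ptrace (map_poly polyC f2) g2 + w3%:R * ptrace (map_poly polyC f3) g3) = 0.
  rewrite !toD !toM !toN (ptrace_denom M1 gE1) (ptrace_denom M2 gE2) (ptrace_denom M3 gE3).
  by rewrite !(mulrCA _ (FracField.tofrac d)) -!mulrDr e1 mulr0.
have /eqP E2 : FracField.tofrac (w1%:R * ptrace (cubic_subst f1) (g1 ^+ 3)
    + w2%:R * ptrace (map_poly polyC f2) (g2 ^+ 3)
    + w3%:R * ptrace (map_poly polyC f3) (g3 ^+ 3)) = 0.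
  rewrite !toD !toM !toN (ptrace_denom_cube M1 gE1) (ptrace_denom_cube M2 gE2).
  rewrite (ptrace_denom_cube M3 gE3).
  by rewrite !(mulrCA _ (FracField.tofrac d ^+ 3)) -!mulrDr e2 mulr0.
move: E1 E2; rewrite !tofrac_eq0 gu1 gu2 gu3 !ptrace_mod_l // !ptrace_mod_cube //.
move=> /eqP E1 /eqP E2.
have [b0 h20 h30] := triple_aniso_flip char0 m1 m2 m3 s1 w10 a1 aniso rr1 rr2 rr3 E1 E2.
move: gE1 gE2 gE3; rewrite gu1 gu2 gu3 b0 h20 h30 !rmorph0 !addr0 => gE1 gE2 gE3.
have mapM : {morph (map_poly (@FracField.tofrac {poly k})) : p q / p * q} := rmorphM _.
split; rewrite -(dvdp_mulC_frac _ _ d0) ?gE1 ?gE2 ?gE3 mapM; exact: dvdp_mulr.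
Qed.

End Step.

Lemma ptraceX (R : comNzRingType) (g : {poly R}) : ptrace 'X g = g.[0].
Proof.
rewrite (@ptraceE _ _ _ (drop_poly 1 g) (take_poly 1 g)) ?monicX ?size_polyX //.
- by rewrite coef_take_poly /= horner_coef0.
- by rewrite derivX mulr1 -{1}(poly_take_drop 1 g) addrC.
- by rewrite ltnS size_take_poly.
Qed.

Lemma dvdXp (k : fieldType) (g : {poly k}) : ('X %| g) = (g.[0] == 0).
Proof. by rewrite -[X in X %| _](subr0 'X) dvdp_XsubCl. Qed.

(** The m are the exponents of the degrees reached, the e those of the weights still to be traded.
    The field is existential because each step replaces k by k(t). *)
Definition aniso_family (m1 m2 m3 e1 e2 e3 : nat) := exists (k : fieldType) (f1 f2 f3 : {poly k}),
  [/\ [pchar k] =i pred0,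
      [/\ f1 \is monic, f2 \is monic & f3 \is monic],
      [/\ size f1 = (3 ^ m1).+1, size f2 = (3 ^ m2).+1 & size f3 = (3 ^ m3).+1],
      [/\ cube_aniso f1, cube_aniso f2 & cube_aniso f3]
    & triple_aniso f1 f2 f3 (3 ^ e1) (3 ^ e2) (3 ^ e3)].

Lemma aniso_family_base (k1 k2 k3 : nat) : (k2 < k1)%N -> (k3 < k2)%N -> aniso_family 0 0 0 k1 k2 k3.
Proof.
move=> h12 h23; exists rat, 'X, 'X, 'X.
have cX : cube_aniso ('X : {poly rat}).
  by move=> g; rewrite ptraceX dvdXp horner_exp => /eqP; rewrite expf_eq0.
split=> //; first exact: pchar_num.
- by rewrite monicX.
- by rewrite size_polyX.
move=> g1 g2 g3; rewrite !ptraceX !dvdXp !horner_exp => e1 e2.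
by have [-> -> ->] := weighted_cubic_anisotropic h12 h23 e1 e2.
Qed.

Lemma aniso_family_rot (m1 m2 m3 e1 e2 e3 : nat) :
  aniso_family m1 m2 m3 e1 e2 e3 -> aniso_family m2 m3 m1 e2 e3 e1.
Proof.
move=> [k [f1 [f2 [f3 [c0 [m1' m2' m3'] [s1 s2 s3] [a1 a2 a3] tr]]]]].
exists k, f2, f3, f1; split=> // g2 g3 g1 E1 E2.
have [] := tr g1 g2 g3; rewrite -?addrA; last by [].
  by rewrite addrC.
by rewrite addrC.
Qed.

Lemma aniso_family_step (m1 m2 m3 e1 e2 e3 : nat) :
  aniso_family m1 m2 m3 e1.+1 e2 e3 -> aniso_family m1.+1 m2 m3 e1 e2 e3.
Proof.
move=> [k [f1 [f2 [f3 [c0 [m1' m2' m3'] [s1 s2 s3] [a1 a2 a3] tr]]]]].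
exists {fraction {poly k}}, (cubic_ext f1), (const_ext f2), (const_ext f3).
have s1' : (1 < size f1)%N by rewrite s1 ltnS expn_gt0.
split; first exact: pchar_fraction.
- by split; [apply: monic_cubic_ext | apply: monic_const_ext | apply: monic_const_ext].
- by rewrite size_cubic_ext // !size_const_ext s1 s2 s3 expnS.
- by split; [apply: cube_aniso_cubic | apply: cube_aniso_const | apply: cube_aniso_const].
by apply: triple_aniso_ext; rewrite ?expn_gt0 // -expnS.
Qed.

Lemma aniso_family_iter (m1 m2 m3 e1 e2 e3 : nat) :
  aniso_family m1 m2 m3 e1 e2 e3 -> aniso_family (m1 + e1) m2 m3 0 e2 e3.
Proof.
elim: e1 m1 => [|e1 IH] m1; first by rewrite addn0.
by move=> /aniso_family_step/IH; rewrite addnS addSn.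
Qed.

Lemma aniso_family_exists (k1 k2 k3 : nat) :
  (k2 < k1)%N -> (k3 < k2)%N -> aniso_family k1 k2 k3 0 0 0.
Proof.
move=> h12 h23; have := aniso_family_base h12 h23.
by do 3![move/aniso_family_iter/aniso_family_rot].
Qed.

(** * Coprimality and the deformation f - s *)

Section Product.
Variable k : fieldType.
Implicit Types f g d : {poly k}.

Lemma ptrace1 g : ptrace 1 g = 0.
Proof. by rewrite /ptrace derivC mulr0 Pdiv.Ring.rmod0p coef0. Qed.

Lemma ptrace_mul_monic d f g : d \is monic -> f \is monic -> (1 < size d)%N ->
  ptrace (d * f) g = ptrace d g + ptrace f g.
Proof.
move=> md mf sd; have [sf|sf] := ltnP 1 (size f); first exact: ptraceM.
have f0 : size f != 0%N by rewrite size_poly_eq0 monic_neq0.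
have [c fE] : exists c, f = c%:P by exists f`_0; exact: size1_polyC.
move: mf; rewrite fE monicE lead_coefC => /eqP ->.
by rewrite mulr1 ptrace1 addr0.
Qed.

(** If f1 = d e1 and f2 = d e2, the trace of e1 e2 modulo f1 or f2 is its trace modulo d, so the
    pair (e1 e2, - e1 e2) solves the system. Then f2 | e1 e2 gives d | e1 and f1 | e1^2, whence f1 |
    e1 by [cube_aniso], against degrees. *)
Lemma aniso_pair_coprime f1 f2 : f1 \is monic -> f2 \is monic -> cube_aniso f1 ->
    (forall g1 g2, ptrace f1 g1 + ptrace f2 g2 = 0 ->
       ptrace f1 (g1 ^+ 3) + ptrace f2 (g2 ^+ 3) = 0 -> f1 %| g1 /\ f2 %| g2) ->
  coprimep f1 f2.
Proof.
move=> m1 m2 a1 aniso.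
have lcg : lead_coef (gcdp f1 f2) != 0 by rewrite lead_coef_eq0 gcdp_eq0 negb_and monic_neq0.
pose d := (lead_coef (gcdp f1 f2))^-1 *: gcdp f1 f2.
have md : d \is monic by rewrite monicE lead_coefZ mulVf.
have [] : d %| f1 /\ d %| f2 by rewrite !dvdpZl ?invr_eq0 // dvdp_gcdl dvdp_gcdr.
rewrite /coprimep -(size_scale _ (a := (lead_coef (gcdp f1 f2))^-1)) ?invr_eq0 // -/d.
move=> /dvdpP[e1 f1E] /dvdpP[e2 f2E]; apply/negPn/negP => sd1.
have d0 := monic_neq0 md.
have sd : (1 < size d)%N by rewrite ltn_neqAle eq_sym sd1 size_poly_gt0.
rewrite mulrC in f1E; rewrite mulrC in f2E.
have me1 : e1 \is monic by rewrite -(monicMl _ md) -f1E.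
have me2 : e2 \is monic by rewrite -(monicMl _ md) -f2E.
have t1 g : ptrace f1 (e1 * g) = ptrace d (e1 * g).
  by rewrite f1E ptrace_mul_monic // ptrace_mulf // addr0.
have t2 g : ptrace f2 (e2 * g) = ptrace d (e2 * g).
  by rewrite f2E ptrace_mul_monic // ptrace_mulf // addr0.
have [||d1 d2] := aniso (e1 * e2) (e2 * - e1).
- by rewrite t1 t2 -ptraceD // -(ptrace0 md); congr (ptrace _ _); ring.
- rewrite (_ : (e1 * e2) ^+ 3 = e1 * (e1 ^+ 2 * e2 ^+ 3)); last by ring.
  rewrite (_ : (e2 * - e1) ^+ 3 = e2 * (- (e2 ^+ 2 * e1 ^+ 3))); last by ring.
  by rewrite t1 t2 -ptraceD // -(ptrace0 md); congr (ptrace _ _); ring.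
move: d2; rewrite f2E mulrN dvdpNr [d * _]mulrC dvdp_mul2l ?monic_neq0 //.
move=> /dvdpP[c e1E]; have : f1 %| e1.
  apply: a1; rewrite (_ : e1 ^+ 3 = f1 * (c * e1)) ?ptrace_mulf //.
  by rewrite f1E !exprS expr0 {1}e1E; ring.
move/(dvdp_leq (monic_neq0 me1)); rewrite f1E size_Mmonic ?monic_neq0 //.
have : (0 < size e1)%N by rewrite size_poly_gt0 monic_neq0.
by move: sd; clear; move: (size d) (size e1) => a b; lia.
Qed.

Lemma triple_aniso_product f1 f2 f3 g :
    f1 \is monic -> f2 \is monic -> f3 \is monic ->
    (1 < size f1)%N -> (1 < size f2)%N -> (1 < size f3)%N ->
    cube_aniso f1 -> cube_aniso f2 -> cube_aniso f3 -> triple_aniso f1 f2 f3 1 1 1 ->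
    ptrace (f1 * f2 * f3) g = 0 -> ptrace (f1 * f2 * f3) (g ^+ 3) = 0 ->
  f1 * f2 * f3 %| g.
Proof.
move=> m1 m2 m3 s1 s2 s3 a1 a2 a3 tr e e'.
have c12 : coprimep f1 f2.
  apply: aniso_pair_coprime => // g1 g2 E E'; have [||] // := tr g1 g2 0.
    by rewrite !mul1r ptrace0 // addr0.
  by rewrite expr0n !mul1r ptrace0 // addr0.
have c13 : coprimep f1 f3.
  apply: aniso_pair_coprime => // g1 g2 E E'; have [||] // := tr g1 0 g2.
    by rewrite !mul1r ptrace0 // addr0.
  by rewrite expr0n !mul1r ptrace0 // addr0.
have c23 : coprimep f2 f3.
  apply: aniso_pair_coprime => // g1 g2 E E'; have [||] // := tr 0 g1 g2.
    by rewrite !mul1r ptrace0 // add0r.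
  by rewrite expr0n !mul1r ptrace0 // add0r.
have T h : ptrace (f1 * f2 * f3) h = 1 * ptrace f1 h + 1 * ptrace f2 h + 1 * ptrace f3 h.
  rewrite -mulrA !ptrace_mul_monic // ?monicMl //.
  by rewrite !mul1r addrA.
rewrite !T in e e'; have [d1 d2 d3] := tr g g g e e'.
by rewrite !Gauss_dvdp ?d1 ?d2 ?d3 // coprimepMl c13.
Qed.

End Product.

Section Deformation.
Variables (k : fieldType) (f : {poly k}).
Hypotheses (mf : f \is monic) (sf : (1 < size f)%N).
Local Notation K := {fraction {poly k}}.

(** The f of interest is a product; subtracting the new variable s, here ['X%:P], makes it
    irreducible and keeps its value at s = 0. *)
Definition deformation : {poly {poly k}} := map_poly polyC f - 'X%:P.

Lemma size_deformation : size deformation = size f.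
Proof.
rewrite /deformation size_polyDl ?size_map_polyC // size_polyN size_polyC.
by rewrite polyX_eq0.
Qed.

Lemma monic_deformation : deformation \is monic.
Proof.
rewrite monicE lead_coefDl ?size_polyN ?size_polyC ?size_map_polyC ?polyX_eq0 //.
by rewrite -monicE monic_map.
Qed.

(** (swapXY g).[f] is g at s = f(x), and the kernel of this substitution is generated by f - s, of
    the same degree in x as f. *)
Lemma deformation_small_root (g : {poly {poly k}}) :
  (size g < size f)%N -> (swapXY g).[f] = 0 -> g = 0.
Proof.
move=> sg /rootP/factor_theorem[u gE].
have gE' : g = deformation * - swapXY u.
  rewrite -[LHS]swapXYK gE rmorphM rmorphB /= swapXY_X swapXY_polyC /deformation.
  by ring.
apply/eqP/negPn/negP => g0; move: sg; rewrite gE' size_monicM ?monic_deformation //.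
  have : (0 < size (- swapXY u)%R)%N.
    by rewrite size_poly_gt0; apply: contraNneq g0 => u0; rewrite gE' u0 mulr0.
  rewrite size_deformation; clear; move: (size f) (size _) => a b; lia.
by apply: contraNneq g0 => u0; rewrite gE' u0 mulr0.
Qed.

(** Modulo f - s the ring k[s][x] is the domain k[x]. In a factorization with denominators cleared,
    one factor therefore vanishes at s = f(x), and its smaller degree in x makes it zero. *)
Lemma deformation_irreducible : irreducible_poly (map_frac deformation).
Proof.
split=> [|Q sQ /dvdpP[A PE]]; first by rewrite size_map_frac size_deformation.
have mP : map_frac deformation \is monic by rewrite monic_map // monic_deformation.
have P0 := monic_neq0 mP.
have [Q0 A0] : Q != 0 /\ A != 0.
  by move: P0; rewrite PE mulf_eq0 negb_or => /andP[].
rewrite -dvdp_size_eqp ?PE ?dvdp_mull //.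
have sPE : size (map_frac deformation) = (size A + size Q).-1 by rewrite PE size_mul.
have sP : size (map_frac deformation) = size f by rewrite size_map_frac size_deformation.
have sA : (0 < size A)%N by rewrite size_poly_gt0.
have sQ0 : (0 < size Q)%N by rewrite size_poly_gt0.
have [sA1|sA1] := eqVneq (size A) 1%N; first by rewrite -PE sPE sA1.
have [d [q [d0 qE]]] := poly_fraction_denom Q.
have [e [a [e0 aE]]] := poly_fraction_denom A.
have sq : (size q < size f)%N.
  rewrite -(size_map_frac q) -qE size_Cmul ?tofrac_eq0 // -sP sPE.
  by move: sA1 sA sQ0; clear; move: (size A) (size Q) => x y; lia.
have sa : (size a < size f)%N.
  rewrite -(size_map_frac a) -aE size_Cmul ?tofrac_eq0 // -sP sPE.
  by move: sA sQ sQ0; clear; move: (size A) (size Q) => x y; lia.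
have aqE : a * q = (e * d)%:P * deformation.
  have mapM : {morph (map_poly (@FracField.tofrac {poly k})) : p q / p * q} := rmorphM _.
  have toM : {morph (@FracField.tofrac {poly k}) : p q / p * q} := rmorphM _.
  have inj : injective (map_poly (@FracField.tofrac {poly k})).
    by apply: map_inj_poly; rewrite ?rmorph0 // => x y /eqP; rewrite tofrac_eq => /eqP.
  apply: inj; rewrite !mapM -aE -qE map_polyC PE /= toM polyCM.
  exact: mulrACA.
have : (swapXY (a * q)).[f] = 0.
  rewrite aqE !rmorphM rmorphB /= swapXY_map_polyC swapXY_Y.
  by rewrite hornerM hornerD hornerN hornerC hornerX subrr mulr0.
rewrite rmorphM hornerM => /eqP; rewrite mulf_eq0 => /orP[] /eqP.
  move/(deformation_small_root sa) => a0; move: aE; rewrite a0 rmorph0 => /eqP.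
  by rewrite mulf_eq0 polyC_eq0 tofrac_eq0 (negPf e0) (negPf A0).
move/(deformation_small_root sq) => q0; move: qE; rewrite q0 rmorph0 => /eqP.
by rewrite mulf_eq0 polyC_eq0 tofrac_eq0 (negPf d0) (negPf Q0).
Qed.

Hypothesis aniso : forall g, ptrace f g = 0 -> ptrace f (g ^+ 3) = 0 -> f %| g.

(** Induction on the degree in s: at s = 0 the polynomial g is a multiple of f, hence zero by
    degree. So s divides g and can be cancelled from both equations. *)
Lemma deformation_aniso (g : {poly {poly k}}) : (size g < size f)%N ->
  ptrace deformation g = 0 -> ptrace deformation (g ^+ 3) = 0 -> g = 0.
Proof.
have [n] := ubnP (size (swapXY g)); elim: n g => // n IH g sg sgf e e'.
pose ev := map_poly (horner_eval (0 : k)).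
have evf : ev deformation = f.
  rewrite /ev /deformation rmorphB /= map_polyC /= {2}/horner_eval hornerX polyC0 subr0.
  rewrite -map_poly_comp map_poly_id // => x _ /=; exact: hornerC.
have evX : {morph ev : p / p ^+ 3} := rmorphXn _ 3.
have ev0 : ev g = 0.
  have : f %| ev g.
    apply: aniso; rewrite -?evX -evf /ev ptrace_map ?monic_deformation // ?e ?e' rmorph0 //.
  have [-> //|g0] := eqVneq (ev g) 0; move/(dvdp_leq g0); rewrite leqNgt.
  by rewrite (leq_ltn_trans (size_poly _ _)).
have /rootP/factor_theorem[u gE] : (swapXY g).[0%:P] = 0 by rewrite horner_swapXY.
rewrite polyC0 subr0 in gE.
have gE' : g = 'X%:P * swapXY u by rewrite -[LHS]swapXYK gE rmorphM /= swapXY_X mulrC.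
have [u0|u0] := eqVneq u 0; first by rewrite gE' u0 rmorph0 mulr0.
have X0 : ('X : {poly k}) != 0 by rewrite polyX_eq0.
rewrite gE' (IH (swapXY u)) ?mulr0 //.
- by rewrite swapXYK -ltnS -(size_mulX u0) -gE.
- by rewrite gE' size_Cmul in sgf.
- move: e; rewrite gE' ptraceZ ?monic_deformation // => /eqP.
  by rewrite mulf_eq0 (negPf X0) => /eqP.
move: e'; rewrite gE' exprMn -polyC_exp ptraceZ ?monic_deformation // => /eqP.
by rewrite mulf_eq0 expf_eq0 (negPf X0) => /eqP.
Qed.

Lemma deformation_extension :
  exists E : fieldExtType K, \dim {:E} = (size f).-1 /\
    forall x : E, fieldTrace x = 0 -> fieldTrace (x ^+ 3) = 0 -> x = 0.
Proof.
pose P := map_frac deformation.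
have mP : P \is monic by rewrite monic_map // monic_deformation.
have sP : size P = size f by rewrite size_map_frac size_deformation.
have [E dE [z zP zE]] := irredp_FAdjoin deformation_irreducible.
exists E; split=> [|x e e']; first by rewrite dE -/P sP.
have sPd : size P = (\dim {:E}).+1 by rewrite dE -/P prednK // sP ltnW.
have : x \in <<1; z>>%VS by rewrite zE memvf.
move/Fadjoin_polyP => [q /polyOver1P[G ->] xE].
pose H := G %% P.
have xE' : x = (map_poly (in_alg E) H).[z].
  rewrite xE {1}(divp_eq G P) rmorphD rmorphM /= hornerD hornerM.
  by rewrite (rootP zP) mulr0 add0r.
have mapX : {morph (map_poly (in_alg E)) : p / p ^+ 3} := rmorphXn _ 3.
move: e e'; rewrite xE' -horner_exp -mapX !(fieldTrace_ptrace _ mP sPd zP zE) => e e'.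
have [d [h [d0 hE]]] := poly_fraction_denom H.
have sh : (size h < size f)%N.
  rewrite -(size_map_frac h) -hE size_Cmul ?tofrac_eq0 // -sP.
  by rewrite ltn_modp monic_neq0.
have md := monic_deformation.
have h0 : h = 0.
  apply: deformation_aniso => //; apply/eqP; rewrite -tofrac_eq0.
    by rewrite (ptrace_denom md hE) e mulr0 eqxx.
  by rewrite (ptrace_denom_cube md hE) e' mulr0 eqxx.
move: hE; rewrite h0 rmorph0 => /eqP.
rewrite mulf_eq0 polyC_eq0 tofrac_eq0 (negPf d0) => /eqP ->.
by rewrite rmorph0 horner0.
Qed.

End Deformation.

Theorem theorem1p2 (k1 k2 k3 : nat) (h12 : (k2 < k1)%N) (h23 : (k3 < k2)%N) :
  exists (F : fieldType) (E : fieldExtType F),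
    [/\ [pchar F] =i pred0,
        \dim {:E} = (3 ^ k1 + 3 ^ k2 + 3 ^ k3)%N
      & ~ exists delta : E,
            [/\ delta != 0, fieldTrace delta = 0 & fieldTrace (delta ^+ 3) = 0]].
Proof.
have [k [f1 [f2 [f3 [c0 [m1 m2 m3] [s1 s2 s3] [a1 a2 a3] tr]]]]] := aniso_family_exists h12 h23.
have pos m : (1 < (3 ^ m).+1)%N by rewrite ltnS expn_gt0.
have mf : f1 * f2 * f3 \is monic by rewrite !monicMl.
have sf : size (f1 * f2 * f3) = (3 ^ k1 + 3 ^ k2 + 3 ^ k3).+1.
  by rewrite !size_monicM ?monicMl ?monic_neq0 // s1 s2 s3 !addnS !addSn.
have sf1 : (1 < size (f1 * f2 * f3)%R)%N by rewrite sf ltnS !addn_gt0 !expn_gt0.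
have [|E [dE aE]] := deformation_extension mf sf1.
  by move=> g; apply: triple_aniso_product => //; rewrite ?s1 ?s2 ?s3 pos.
exists {fraction {poly k}}, E; split; first exact: pchar_fraction.
  by rewrite dE sf.
by move=> [x [x0 e e']]; rewrite (aE x e e') eqxx in x0.
Qed.
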